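(* Let $\nu$ be the centered Lévy noise measure on $\mathcal D'$ with Lévy measure $\sigma$ satisfying $\int_{(0,\infty)}\tau^2\,\sigma(d\tau)<\infty$, let $\varkappa:[0,\infty)^2\to[0,\infty)$ be measurable and locally bounded, let $X_{s,t}$ be the associated field, let $\mu_{s,t}$ be deterministic and continuous in $(s,t)$ on $\{0\le s\le t\}$, and let $F_{s,t}=\mu_{s,t}+X_{s,t}$, $0\le s\le t$, be the forward rates, with spot rates $R_s$, discounted bond prices $Z_{s,t}$ and $\sigma$-algebras $\mathcal F_s$ as defined in the context. Suppose that $\sigma$ additionally satisfies $$\langle\tau\rangle_\sigma:=\int_{(0,\infty)}\tau\,\sigma(d\tau)<\infty .$$ Suppose that for each $t\ge0$ the process $\{Z_{s,t},\ \mathcal F_s,\ 0\le s\le t\}$ is a martingale under $\nu$, and suppose that the initial term structure $\{\mu_{0,t},\ t\ge0\}$ satisfies $$\mu_{0,t}\ \ge\ \int_0^t\int_0^t\varkappa(x,y)\,dx\,dy\cdot\langle\tau\rangle_\sigma,\qquad t\ge0 .$$ Then the forward rate process $\{F_{s,t},\ 0\le s\le t<\infty\}$ and the spot rate process $\{R_t,\ t\ge0\}$ take on non-negative values $\nu$-a.s.; that is, for all $0\le s\le t<\infty$ one has $F_{s,t}\ge0$ $\nu$-a.s., and for all $t\ge 0$ one has $R_t\ge0$ $\nu$-a.s.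
   Context: **Lévy noise.** Let $\mathcal D=C_0^\infty(\mathbb R^2)$ be the space of real-valued infinitely differentiable compactly supported functions on $\mathbb R^2$ with its standard nuclear topology, and $\mathcal D'$ its dual with respect to $L^2(\mathbb R^2,dx\,dy)$, so that $\mathcal D'\supset L^2(\mathbb R^2,dx\,dy)\supset\mathcal D$, with dual pairing $\langle\cdot,\cdot\rangle$ generated by the scalar product of $L^2(\mathbb R^2,dx\,dy)$. Let $\mathcal C(\mathcal D')$ be the cylinder $\sigma$-algebra on $\mathcal D'$. Let $\sigma$ be a positive measure on the Borel sets of $(0,\infty)$ with $\int_{(0,\infty)}\tau^2\,\sigma(d\tau)<\infty$. The centered Lévy noise measure with Lévy measure $\sigma$ is the probability measure $\nu$ on $(\mathcal D',\mathcal C(\mathcal D'))$ (existing by the Minlos theorem) with Fourier transform $$\int_{\mathcal D'}e^{i\langle\omega,\varphi\rangle}\,\nu(d\omega)=\exp\Bigl[\int_{\mathbb R^2}\int_{(0,\infty)}\bigl(e^{i\tau\varphi(x,y)}-1-i\tau\varphi(x,y)\bigr)\,\sigma(d\tau)\,dx\,dy\Bigr],\qquad\varphi\in\mathcal D .$$ One has $\int_{\mathcal D'}\langle\omega,\varphi\rangle^2\,\nu(d\omega)=\int_{(0,\infty)}\tau^2\sigma(d\tau)\int_{\mathbb R^2}\varphi^2\,dx\,dy$ for $\varphi\in\mathcal D$, so the map $\varphi\mapsto\langle\cdot,\varphi\rangle$ extends by continuity from $\mathcal D$ to a map $L^2(\mathbb R^2,dx\,dy)\to L^2(\mathcal D',\nu)$;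 its value at $f\in L^2(\mathbb R^2,dx\,dy)$ is again denoted $\langle\cdot,f\rangle$ (a random variable defined $\nu$-a.s.). **The field $X$.** For $s,t\ge0$, $$X_{s,t}(\omega)=\langle\omega(x,y),\mathbf 1_{[0,s]}(x)\mathbf 1_{[0,t]}(y)\varkappa(x,y)\rangle\quad\text{for }\nu\text{-a.e. }\omega\in\mathcal D',$$ where $x,y$ denote the variables in which the dualization is carried out. **Interest rates.** The forward rate for date $t$ at time $s$ is $F_{s,t}=\mu_{s,t}+X_{s,t}$, $0\le s\le t$. The bond price is $P_{s,t}=\exp\bigl[-\int_s^tF_{s,u}\,du\bigr]$, the spot rate is $R_s=F_{s,s}$, and the discounted bond-price process is $Z_{s,t}=P_{s,t}\exp\bigl[-\int_0^sR_u\,du\bigr]$. The integrals here are $\nu$-a.s. well defined, and $\nu$-a.s. $$\int_s^tX_{s,u}\,du=\langle\omega(x,y),\mathbf 1_{[0,s]}(x)\mathbf 1_{[0,t]}(y)\varkappa(x,y)(t-(s\vee y))\rangle,$$ $$\int_0^sR_u\,du=\int_0^s\mu_{u,u}\,du+\langle\omega(x,y),\mathbf 1_{[0,s]}(x)\mathbf 1_{[0,s]}(y)\varkappa(x,y)(s-(x\vee y))\rangle .$$ For $s\ge0$, $\mathcal F_s$ is the $\sigma$-algebra generated by the random variables $F_{u,v}$, $0\le u\le s$, $u\le v$. Notation: $x\vee y=\max(x,y)$. *)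

(* Defs.v *)
From HB Require Import structures.
From mathcomp Require Import all_boot all_order all_algebra.
From mathcomp Require Import all_classical all_reals all_analysis.
From mathcomp Require Import complex.

Set Implicit Arguments.
Unset Strict Implicit.
Unset Printing Implicit Defensive.

Import Order.TTheory GRing.Theory Num.Theory.
Import numFieldNormedType.Exports.
Local Open Scope classical_set_scope.
Local Open Scope ring_scope.

Section test_functions.
Context {R : realType}.
Implicit Types (f g : R * R -> R^o) (l : seq bool).

Definition axis (b : bool) : R * R := if b then (0, 1) else (1, 0).

(* [deriv_along l f] is the iterated partial derivative of [f] along the axes
   listed in [l] (the last axis of [l] is used first) *)
Definition deriv_along l f : R * R -> R^o :=
  foldr (fun b g => 'D_(axis b) g) f l.

Definition smooth f := forall l,
  continuous (deriv_along l f) /\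
  forall b p, derivable (deriv_along l f) p (axis b).

Definition compactly_supported f := compact (closure [set p | f p != 0]).

Definition test_pred : {pred R * R -> R^o} :=
  fun f => `[< smooth f /\ compactly_supported f >].

Lemma deriv_along_lin a f g l : smooth f -> smooth g ->
  deriv_along l (a *: f + g) = a *: deriv_along l f + deriv_along l g.
Proof.
move=> sf sg; elim: l => [//|b l IH] /=; rewrite IH; apply/funext => p.
have df := (sf l).2 b p; have dg := (sg l).2 b p.
by rewrite deriveD ?deriveZ//; exact: derivableZ.
Qed.

Lemma smooth_lin a f g : smooth f -> smooth g -> smooth (a *: f + g).
Proof.
move=> sf sg l; rewrite deriv_along_lin//; split.
  move=> p; apply: continuousD; last exact: (sg l).1.
  by apply: continuousZl_tmp; exact: (sf l).1.
move=> b p; apply: derivableD; last exact: (sg l).2.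
by apply: derivableZ; exact: (sf l).2.
Qed.

Lemma deriv_along0 l : deriv_along l 0 = 0.
Proof.
elim: l => [//|b l /= ->]; apply/funext => p.
by rewrite (@derive_cst _ _ _ 0).
Qed.

Lemma test_submod_closed : submod_closed test_pred.
Proof.
split=> [|a f g]; rewrite !unfold_in.
  apply/asboolP; split.
    move=> l; rewrite deriv_along0; split; first exact: cst_continuous.
    by move=> b p; exact: (@derivable_cst _ _ _ 0 p (axis b)).
  rewrite /compactly_supported (_ : [set p | _] = set0) ?closure0.
    exact: compact0.
  by apply/seteqP; split=> p //=; rewrite eqxx.
move=> /asboolP[sf cf] /asboolP[sg cg]; apply/asboolP; split.
  exact: smooth_lin.
have cU := compactU cf cg.
apply: (subclosed_compact _ cU); first exact: closed_closure.
rewrite -closureU; apply: closure_subset => p /= fgp.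
have [fp0|fp0] := eqVneq (f p) 0; last by left.
right; apply: contra_neq fgp => gp0.
rewrite [LHS]/(a *: f p + g p) fp0 gp0 scaler0; exact: addr0.
Qed.

HB.instance Definition _ :=
  GRing.isSubmodClosed.Build R (R * R -> R^o) test_pred test_submod_closed.

Record test_space := TestFun {
  test_fun :> R * R -> R^o;
  test_funP : test_fun \in test_pred }.

HB.instance Definition _ := [isSub for test_fun].
HB.instance Definition _ := [Choice of test_space by <:].
HB.instance Definition _ := [SubChoice_isSubLmodule of test_space by <:].

(* The topology of [test_space] is the locally convex inductive limit of the
   Frechet spaces D_K of smooth functions supported in a compact set K, whose
   topology is given by the suprema of the partial derivatives.  A basis of
   neighbourhoods of 0 consists of the absolutely convex sets whose trace on
   every D_K is a neighbourhood of 0 in D_K. *)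
Definition basic_nbhs0 (V : set test_space) :=
  (forall (a b : R) u v, `|a| + `|b| <= 1 -> V u -> V v ->
     V (a *: u + b *: v)) /\
  (forall K : set (R * R), compact K ->
     exists n : nat, exists2 e : R, 0 < e &
       forall u : test_space, (forall p, ~ K p -> u p = 0) ->
         (forall l p, (size l <= n)%N -> `|deriv_along l u p| < e) -> V u).

Definition test_open (U : set test_space) :=
  forall u, U u -> exists2 V, basic_nbhs0 V & forall v, V v -> U (u + v).

Lemma basic_nbhs0I V W :
  basic_nbhs0 V -> basic_nbhs0 W -> basic_nbhs0 (V `&` W).
Proof.
move=> [cV nV] [cW nW]; split.
  by move=> a b u v ab [Vu Wu] [Vv Wv]; split; [exact: cV|exact: cW].
move=> K cK; have [m [d d0 hV]] := nV K cK; have [n [e e0 hW]] := nW K cK.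
exists (maxn m n), (Num.min d e); first by rewrite lt_min d0 e0.
move=> u uK hu; split.
  apply: hV => // l p lm.
  have := hu l p; rewrite lt_min leq_max lm => /(_ isT).
  by case/andP.
apply: hW => // l p ln.
have := hu l p; rewrite lt_min leq_max ln orbT => /(_ isT).
by case/andP.
Qed.

Lemma test_openT : test_open setT.
Proof.
move=> u _; exists setT => //; split=> // K _; exists 0%N.
by exists 1; first exact: ltr01.
Qed.

Lemma test_openI : setI_closed test_open.
Proof.
move=> A B oA oB u [Au Bu].
have [V bV hV] := oA _ Au; have [W bW hW] := oB _ Bu.
exists (V `&` W); first exact: basic_nbhs0I.
by move=> v [Vv Wv]; split; [exact: hV|exact: hW].
Qed.

Lemma test_open_bigU (I : Type) (F : I -> set test_space) :
  (forall i, test_open (F i)) -> test_open (\bigcup_i F i).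
Proof.
move=> oF u [i _ Fiu]; have [V bV hV] := oF i _ Fiu.
by exists V => // v Vv; exists i => //; exact: hV.
Qed.

HB.instance Definition _ := isOpenTopological.Build test_space
  test_openT test_openI test_open_bigU.

Record distribution := Distribution {
  dual_fun :> {linear test_space -> R^o};
  dual_continuous : continuous dual_fun }.

HB.instance Definition _ := gen_eqMixin distribution.
HB.instance Definition _ := gen_choiceMixin distribution.

Lemma null_dual_continuous :
  continuous (\0 : {linear test_space -> R^o}).
Proof. exact: cst_continuous. Qed.

HB.instance Definition _ :=
  isPointed.Build distribution (Distribution null_dual_continuous).

(* One-dimensional cylinder sets suffice: they generate the same sigma-algebra
   as all cylinder sets. *)
Definition cylinder_sets : set (set distribution) :=
  [set A | exists u (B : set R),
    measurable B /\ A = [set w : distribution | B (w u)]].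

End test_functions.

Arguments test_space R : clear implicits.
Arguments distribution R : clear implicits.
Arguments cylinder_sets R : clear implicits.

Definition dual_space (R : realType) := g_sigma_algebraType (cylinder_sets R).

HB.instance Definition _ (R : realType) := Measurable.on (dual_space R).

Definition pairing (R : realType) (w : dual_space R) (u : test_space R) : R :=
  (w : distribution R) u.

Definition lebesgue2 (R : realType) :
    {measure set (measurableTypeR R * measurableTypeR R) -> \bar R} :=
  [the measure _ _ of (@lebesgue_measure R \x @lebesgue_measure R)%E].

Section complex_integral.
Context {R : realType}.
Local Open Scope complex_scope.

Definition cexp (z : R[i]) : R[i] :=
  (expR (complex.Re z))%:C *
  (cos (complex.Im z) +i* sin (complex.Im z)).

Definition Cintegral d (T : measurableType d) (m : {measure set T -> \bar R})
    (D : set T) (f : T -> R[i]) : R[i] :=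
  (\int[m]_(x in D) complex.Re (f x)) +i* (\int[m]_(x in D) complex.Im (f x)).

End complex_integral.

Section levy_noise.
Context {R : realType}.
Local Open Scope complex_scope.

(* The Levy measure, a measure on the Borel sets of ]0, +oo[, is represented by
   a Borel measure on the line, only integrated over ]0, +oo[. *)
Definition levy_exponent (sg : {measure set (measurableTypeR R) -> \bar R})
    (u : test_space R) : R[i] :=
  Cintegral (@lebesgue2 R) setT (fun p =>
    Cintegral sg `]0, +oo[%classic (fun tau =>
      cexp ('i * (tau * u p)%:C) - 1 - 'i * (tau * u p)%:C)).

Definition is_levy_noise (sg : {measure set (measurableTypeR R) -> \bar R})
    (nu : probability (dual_space R) R) :=
  forall u : test_space R,
    Cintegral nu setT (fun w => cexp ('i * (pairing w u)%:C)) =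
    cexp (levy_exponent sg u).

End levy_noise.

Section extended_pairing.
Context {R : realType}.

Definition cvg_L2 d (T : measurableType d) (m : {measure set T -> \bar R})
    (f_ : nat -> T -> R) (f : T -> R) :=
  'N[m]_2%:E[(fun x => (f_ n x - f x)%:E)]%E @[n --> \oo] --> 0%E.

(* [Y] is a version of the random variable <., f>: the value at [f] of the
   extension by continuity of u |-> <., u> from D to L^2(dx dy) *)
Definition is_pairing (nu : probability (dual_space R) R)
    (f : measurableTypeR R * measurableTypeR R -> R) (Y : dual_space R -> R) :=
  measurable_fun setT Y /\
  exists u_ : nat -> test_space R,
    cvg_L2 (@lebesgue2 R) (fun n => u_ n : _ -> R) f /\
    cvg_L2 nu (fun n w => pairing w (u_ n)) Y.

(* The random variables [X s t] are only determined almost surely; joint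
   measurability selects versions whose pathwise integrals in the parameters
   s and t make sense almost surely. *)
Definition is_levy_field (nu : probability (dual_space R) R)
    (kappa : R * R -> R) (X : R -> R -> dual_space R -> R) :=
  measurable_fun
    [set q : dual_space R * (measurableTypeR R * measurableTypeR R) |
      0 <= q.2.1 /\ 0 <= q.2.2]
    (fun q => X q.2.1 q.2.2 q.1) /\
  forall s t : R, 0 <= s -> 0 <= t ->
    is_pairing nu
      (fun p => \1_`[0, s]%classic p.1 * \1_`[0, t]%classic p.2 * kappa p)
      (X s t).

End extended_pairing.

Section martingales.
Context {R : realType} d (T : measurableType d) (P : probability T R).
Implicit Types (G : set (set T)) (X Y : T -> R).

(* Random variables are identified when they are almost surely equal, so
   measurability with respect to a sub-sigma-algebra is that of some version. *)
Definition ae_measurable_wrt G Y :=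
  exists Y' : T -> R,
    (forall B : set R, measurable B -> G (Y' @^-1` B)) /\ ae_eq P setT Y Y'.

(* [Y] is a version of the conditional expectation E[X | G] *)
Definition is_cond_exp G X Y :=
  [/\ ae_measurable_wrt G Y, P.-integrable setT (EFin \o Y) &
      forall A, G A -> (\int[P]_(x in A) Y x = \int[P]_(x in A) X x)%R].

Definition is_martingale (I : set R) (Fil : R -> set (set T))
    (M : R -> T -> R) :=
  forall s, I s ->
    [/\ P.-integrable setT (EFin \o M s), ae_measurable_wrt (Fil s) (M s) &
        forall r, I r -> s <= r -> is_cond_exp (Fil s) (M r) (M s)].

End martingales.

Section interest_rates.
Context {R : realType} d (T : measurableType d).
Implicit Types (F : R -> R -> T -> R) (s t : R).

Definition forward_rate (mu : R -> R -> R) (X : R -> R -> T -> R) s t w :=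
  mu s t + X s t w.

Definition bond_price F s t w :=
  expR (- \int[lebesgue_measure]_(u in `[s, t]) F s u w).

Definition spot_rate F s w := F s s w.

Definition discounted_bond_price F s t w :=
  bond_price F s t w *
  expR (- \int[lebesgue_measure]_(u in `[0, s]) spot_rate F u w).

Definition rate_filtration F s : set (set T) :=
  <<s [set A | exists u v (B : set R),
    [/\ 0 <= u <= s, u <= v, measurable B & A = F u v @^-1` B]] >>.

End interest_rates.

(* Main.v *)
Require Import Defs.
From HB Require Import structures.
From mathcomp Require Import all_boot all_order all_algebra.
From mathcomp Require Import all_classical all_reals all_analysis.
From mathcomp Require Import measurable_realfun.
From mathcomp Require Import complex.
From mathcomp Require Import ring lra.
Import Order.TTheory GRing.Theory Num.Theory.
Import numFieldNormedType.Exports.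
Local Open Scope classical_set_scope.
Local Open Scope ring_scope.

(** The key point is that a centered noise variable with a nonnegative kernel is
    bounded below. For [f >= 0] integrable and square-integrable, adding the
    compensator [<tau> \int f] to [<., f>] cancels the centering in the Fourier
    transform of the noise: the characteristic function becomes
    [exp (\int (e^{i b h} - 1) dm)], where [m] is the product of the Levy measure
    and the Lebesgue measure of the plane and [h (tau, p) = tau f(p)] is
    nonnegative, that is, the characteristic function of a sum of nonnegative
    jumps over a Poisson process. The variable is then nonnegative
    ([poisson_cf_ge0]) and its Laplace transform is given by the same formula
    ([poisson_cf_laplace]). Hence almost surely
    [X_{s,t} >= - <tau> \int_0^t \int_0^t kappa >= - mu_{0,t}], and it remains to
    show that [mu_{s,t} >= mu_{0,t}].

    For this the discounted price is written as
    [Z_{s,t} = exp (- drift - I_{s,t})], where the drift is deterministic and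
    [I_{s,t} = \int_0^t X_{min(s,u),u} du] is the noise variable with kernel
    [1_{[0,s]}(x) 1_{[0,t]}(y) kappa(x,y) (t - max(x,y))]
    ([integrated_field_approx]). By the martingale property, the mean of
    [exp (- I_{s,t})] is the exponential of
    [\int_s^t (mu_{s,u} - mu_{0,u}) du] up to a factor that depends on [s] only.
    On the other hand it equals
    [exp (\int \int (tau g - 1 + e^{- tau g}) sigma(d tau) dx dy)] with [g] the
    above kernel, which is nondecreasing in [t]. So
    [\int_t^{t'} (mu_{s,u} - mu_{0,u}) du >= 0] for [s <= t < t'], and the
    continuity of [mu] concludes ([mu_ge_initial]).

    The two facts on a variable [W] with such a characteristic function rest on
    the size-bias identity [E (W k(W)) = \int h E k(W + h) dm]. For trigonometric
    [k] it is the derivative of the characteristic function; averaging over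
    frequencies against the Cauchy density gives it for [k x = e^{- |x + M|}]
    ([size_bias_exp]). Nonnegativity follows from a combination [k] of two such
    functions that is positive exactly on the negative half-line, and the Laplace
    transform from a linear differential equation. The noise is only known
    through smooth test functions; the passage to the kernels at hand goes through
    the relation [levy_approx], closed under the limits that occur, in particular
    under the limit of Riemann sums that defines [I_{s,t}]. *)

Set Implicit Arguments.
Unset Strict Implicit.
Unset Printing Implicit Defensive.

(** * Real-valued integrals, domination and Fubini *)
Section sigma_finite_packing.
Context d (T : measurableType d) (R : realType).
Variables (mu : {measure set T -> \bar R}) (h : sigma_finite setT mu).

(** A copy of [mu] that remembers a proof of sigma-finiteness, so that the
    structure required by Fubini's theorem can be attached to it: products and
    restrictions of sigma-finite measures do not carry that structure. *)
Definition as_sigma_finite of sigma_finite setT mu : set T -> \bar R := mu.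

HB.instance Definition _ := Measure.on (as_sigma_finite h).
HB.instance Definition _ := Measure_isSigmaFinite.Build _ _ _ (as_sigma_finite h) h.
Definition sigma_finite_pack : {sigma_finite_measure set T -> \bar R} := as_sigma_finite h.
End sigma_finite_packing.

Section sigma_finite_prod.
Context d1 d2 (T1 : measurableType d1) (T2 : measurableType d2) (R : realType).
Variables (m1 : {sigma_finite_measure set T1 -> \bar R})
  (m2 : {sigma_finite_measure set T2 -> \bar R}).

Lemma sigma_finite_prod : sigma_finite setT (m1 \x m2)%E.
Proof.
have [F TF mF] := sigma_finiteT m1; have [G TG mG] := sigma_finiteT m2.
pose e n : nat * nat := odflt (0%N, 0%N) (unpickle n).
exists (fun n => F (e n).1 `*` G (e n).2).
  apply/seteqP; split=> // -[x y] _.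
  have : [set: T1] x by []. rewrite TF => -[i _ Fix].
  have : [set: T2] y by []. rewrite TG => -[j _ Gjy].
  by exists (pickle (i, j)) => //; rewrite /e pickleK.
move=> n; have [mFn Fn] := mF (e n).1; have [mGn Gn] := mG (e n).2.
split; first exact: measurableX.
by rewrite product_measure1E// lte_mul_pinfty// ge0_fin_numE.
Qed.
End sigma_finite_prod.

Section real_integral.
Context d (T : measurableType d) (R : realType).
Variable m : {measure set T -> \bar R}.

Lemma integrable_le (D : set T) (f g : T -> R) : measurable D ->
  measurable_fun D f -> m.-integrable D (EFin \o g) ->
  (forall x, D x -> `|f x| <= g x) -> m.-integrable D (EFin \o f).
Proof.
move=> mD mf ig fg; apply: (le_integrable mD _ _ ig) => //.
  exact/measurable_EFinP.
move=> x Dx /=; rewrite lee_fin (le_trans (fg x Dx))//; exact: ler_norm.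
Qed.

Lemma integrableZlR (D : set T) (k : R) (f : T -> R) : measurable D ->
  m.-integrable D (EFin \o f) ->
  m.-integrable D (EFin \o (fun x => k * f x)).
Proof.
move=> mD intf; apply: eq_integrable (integrableZl mD k intf) => //.
Qed.

Lemma integrableDR (D : set T) (f g : T -> R) : measurable D ->
  m.-integrable D (EFin \o f) -> m.-integrable D (EFin \o g) ->
  m.-integrable D (EFin \o (fun x => f x + g x)).
Proof.
by move=> mD intf intg; apply: eq_integrable (integrableD mD intf intg) => //.
Qed.

Lemma integrableBR (D : set T) (f g : T -> R) : measurable D ->
  m.-integrable D (EFin \o f) -> m.-integrable D (EFin \o g) ->
  m.-integrable D (EFin \o (fun x => f x - g x)).
Proof.
by move=> mD intf intg; apply: eq_integrable (integrableB mD intf intg) => //.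
Qed.

Lemma Rdominated_cvg (D : set T) (f_ : nat -> T -> R) (f g : T -> R) :
  measurable D -> (forall n, measurable_fun D (f_ n)) -> measurable_fun D f ->
  {ae m, forall x, D x -> f_ n x @[n --> \oo] --> f x} ->
  m.-integrable D (EFin \o g) ->
  (forall n x, D x -> `|f_ n x| <= g x) ->
  \int[m]_(x in D) f_ n x @[n --> \oo] --> \int[m]_(x in D) f x.
Proof.
move=> mD mf_ mf ff ig fg.
have [] := @dominated_convergence _ _ _ m D mD (fun n => EFin \o f_ n)
  (EFin \o f) (EFin \o g) => //.
- by move=> n; exact/measurable_EFinP.
- exact/measurable_EFinP.
- by apply: filterS ff => x h Dx; apply: cvg_EFin; [exact: nearW|exact: h].
- by apply: aeW => x n Dx /=; rewrite lee_fin fg.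
move=> intf _; rewrite /= -[X in _ --> X]fineK; last exact: integrable_fin_num.
by move/fine_cvg.
Qed.
Lemma Rintegral0_ae (f : T -> R) : m.-integrable setT (EFin \o f) ->
  (forall x, 0 <= f x) -> \int[m]_x f x = 0 -> {ae m, forall x, f x = 0}.
Proof.
move=> intf f0 If0.
have mf := measurable_int m intf.
have : (\int[m]_x `|(f x)%:E| = 0)%E.
  under eq_integral do rewrite gee0_abs ?lee_fin//.
  rewrite -[LHS]fineK; last exact: integrable_fin_num.
  by rewrite -/(Rintegral m setT f) If0.
move/(ae_eq_integral_abs m measurableT mf).
by apply: filterS => x /(_ I) [].
Qed.

Lemma ae_eq_Rintegral (f g : T -> R) : measurable_fun setT f -> measurable_fun setT g ->
  {ae m, forall x, f x = g x} -> \int[m]_x f x = \int[m]_x g x.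
Proof.
move=> mf mg fg; congr fine; apply: ae_eq_integral => //.
- exact/measurable_EFinP.
- exact/measurable_EFinP.
- by apply: filterS fg => x /= -> .
Qed.
End real_integral.

Lemma prob_bounded_integrable d (T : measurableType d) (R : realType)
    (P : probability T R) (f : T -> R) (B : R) :
  measurable_fun setT f -> (forall w, `|f w| <= B) -> P.-integrable setT (EFin \o f).
Proof.
move=> mf fB; apply: (@integrable_le _ _ _ P setT _ (fun=> B)) => //.
exact: finite_measure_integrable_cst.
Qed.

Section ftc.
Variable R : realType.
Notation leb := (@lebesgue_measure R).

(** The antiderivative is only assumed to converge along the integers, and the
    integrand may change sign: integrability of [f] makes the integrals over
    [[0, n]] converge by domination. *)
Lemma Rintegral_FTC0y (f F : R -> R) (l : R) :
  (forall x : R, is_derive x 1 F (f x)) -> continuous f ->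
  leb.-integrable `[0, +oo[ (EFin \o f) -> F n%:R @[n --> \oo] --> l ->
  \int[leb]_(x in `[0, +oo[) f x = l - F 0.
Proof.
move=> dF cf intf Fl.
have h1 : \int[leb]_(x in `[0, +oo[) (f \_ `[0, n%:R]) x @[n --> \oo] -->
    \int[leb]_(x in `[0, +oo[) f x.
  apply: (@Rdominated_cvg _ _ _ leb _ _ _ (fun x => `|f x|)) => //.
  - move=> n; apply/measurable_restrict => //.
    by apply: measurable_funTS; exact: continuous_measurable_fun.
  - by apply: measurable_funTS; exact: continuous_measurable_fun.
  - apply: aeW => x /=; rewrite in_itv/= andbT => x0.
    apply: (@cvg_near_cst _ R); near=> n.
    rewrite patchE ifT// inE/= in_itv/= x0/=.
    by near: n; exact: nbhs_infty_ger.
  - exact: integrable_norm.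
  - by move=> n x _; rewrite patchE; case: ifPn => // _; rewrite normr0.
have h2 : \int[leb]_(x in `[0, +oo[) (f \_ `[0, n%:R]) x @[n --> \oo] --> l - F 0.
  apply: cvg_trans (cvgB Fl (cvg_cst (F 0))); apply: near_eq_cvg.
  near=> n.
  rewrite -Rintegral_mkcondr setIidr; last first.
    by move=> x /=; rewrite !in_itv/= andbT => /andP[].
  have n0 : (0 : R) < n%:R by rewrite ltr0n; near: n; exists 1%N.
  rewrite /Rintegral (@continuous_FTC2 _ f F)//.
  - by apply: continuous_subspaceT => x; exact: cf.
  - split.
    + by move=> x _; apply: ex_derive.
    + apply: cvg_at_right_filter; apply: differentiable_continuous.
      by apply/derivable1_diffP.
    + apply: cvg_at_left_filter; apply: differentiable_continuous.
      by apply/derivable1_diffP.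
  - by move=> x _; rewrite derive1E; apply: derive_val.
exact: (cvg_unique _ h1 h2).
Unshelve. all: by end_near. Qed.
End ftc.

(** * The Fourier representation of the two-sided exponential *)
Section derivation_rules.
Variable R : realType.
Implicit Types (f g : R -> R) (x df dg : R).

Lemma isd_comp f g x df dg : is_derive (g x) (1 : R) f df ->
  is_derive x (1 : R) g dg -> is_derive x (1 : R) (fun y => f (g y)) (df * dg).
Proof. by move=> hf hg; have := is_derive1_comp hf hg; exact. Qed.

Lemma isd_mul f g x df dg : is_derive x (1 : R) f df ->
  is_derive x (1 : R) g dg ->
  is_derive x (1 : R) (fun y => f y * g y) (df * g x + f x * dg).
Proof.
move=> hf hg; have := is_deriveM hf hg => h; apply: is_derive_eq h _.
by rewrite /GRing.scale/= addrC mulrC; congr (_ + _).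
Qed.

Lemma isd_add f g x df dg : is_derive x (1 : R) f df ->
  is_derive x (1 : R) g dg -> is_derive x (1 : R) (fun y => f y + g y) (df + dg).
Proof. exact: is_deriveD. Qed.

Lemma isd_opp f x df : is_derive x (1 : R) f df ->
  is_derive x (1 : R) (fun y => - f y) (- df).
Proof. exact: is_deriveN. Qed.

Lemma isd_scale f x df c : is_derive x (1 : R) f df ->
  is_derive x (1 : R) (fun y => c * f y) (c * df).
Proof.
move=> hf; apply: is_derive_eq (isd_mul (is_derive_cst c x 1) hf) _.
by rewrite mul0r add0r.
Qed.

Lemma isd_id x : is_derive x (1 : R) (fun y => y) 1.
Proof. exact: is_derive_id. Qed.

Lemma isd_cst (c : R) x : is_derive x (1 : R) (fun=> c) 0.
Proof. exact: is_derive_cst. Qed.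

Lemma der_continuous f (df : R -> R) :
  (forall x, is_derive x (1 : R) f (df x)) -> continuous f.
Proof.
move=> h x; apply: differentiable_continuous; apply/derivable1_diffP.
by case: (h x).
Qed.
End derivation_rules.

Section exponential_cosine.
Variable R : realType.
Notation leb := (@lebesgue_measure R).

Lemma integrable_expRN (a : R) : 0 < a ->
  leb.-integrable `[0, +oo[ (EFin \o (fun x => expR (- (a * x)))).
Proof.
move=> a0; have h := integrable_exponential_pdf a0.
have h2 : leb.-integrable `[0, +oo[ (EFin \o exponential_pdf a).
  by apply: integrableS h.
apply: eq_integrable (integrableZl _ a^-1 h2) => //.
move=> x; rewrite inE/= in_itv/= andbT => x0.
by rewrite exponential_pdfE// -EFinM mulrA mulVf ?gt_eqF// mul1r mulNr.
Qed.

Lemma cvg_expRMn (a : R) : 0 < a -> expR (- (a * n%:R)) @[n --> \oo] --> (0 : R).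
Proof.
move=> a0.
have : expR (- x) @[x --> +oo%R] --> (0 : R) by exact: cvgr_expR.
have h : (a * n%:R) @[n --> \oo] --> +oo%R.
  apply/cvgryPge => A; near=> n.
  rewrite mulrC -ler_pdivrMr//; near: n; exact: nbhs_infty_ger.
by move=> h2; exact: (cvg_comp _ _ h h2).
Unshelve. all: by end_near. Qed.

(** An explicit antiderivative vanishing at infinity gives the Laplace
    transform of the cosine. *)
Lemma Rintegral_expRcos (a b : R) : 0 < a ->
  \int[leb]_(x in `[0, +oo[) (expR (- (a * x)) * cos (b * x)) =
  a / (a ^+ 2 + b ^+ 2).
Proof.
move=> a0; have ab : a ^+ 2 + b ^+ 2 != 0.
  by rewrite gt_eqF// ltr_pwDl ?sqr_ge0// exprn_gt0.
pose F x := (a ^+ 2 + b ^+ 2)^-1 * (expR (- (a * x)) * (b * sin (b * x) - a * cos (b * x))).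
have dlin c x : is_derive x (1 : R) (fun y : R => c * y) c.
  by apply: is_derive_eq (isd_scale c (isd_id x)) _; rewrite mulr1.
have dexp x : is_derive x (1 : R) (fun y : R => expR (- (a * y))) (expR (- (a * x)) * - a).
  by apply: isd_comp; apply: isd_opp.
have dF x : is_derive x (1 : R) F (expR (- (a * x)) * cos (b * x)).
  apply: is_derive_eq (isd_scale _ (isd_mul (dexp x) (isd_add
    (isd_scale b (isd_comp (is_derive_sin _) (dlin b x)))
    (isd_opp (isd_scale a (isd_comp (is_derive_cos _) (dlin b x))))))) _.
  by field.
have cf : continuous (fun x => expR (- (a * x)) * cos (b * x)).
  exact: (der_continuous (fun x =>
    isd_mul (dexp x) (isd_comp (is_derive_cos _) (dlin b x)))).
rewrite (Rintegral_FTC0y dF cf _ (l := 0)).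
- rewrite /F !mulr0 oppr0 expR0 sin0 cos0; field => //.
- apply: integrable_le (integrable_expRN a0) _ => //.
    by apply: measurable_funTS; exact: continuous_measurable_fun.
  move=> x _; rewrite normrM ger0_norm ?expR_ge0// ler_piMr ?expR_ge0//.
  exact: cos_max.
- apply/norm_cvg0P.
  apply: (@squeeze_cvgr _ _ _ _ (cst 0)
    (fun n => ((a ^+ 2 + b ^+ 2)^-1 * (`|b| + a)) * expR (- (a * n%:R)))).
  + apply: nearW => n /=; rewrite normr_ge0/= /F normrM.
    rewrite ger0_norm; last by rewrite invr_ge0 addr_ge0// sqr_ge0.
    rewrite -mulrA ler_wpM2l ?invr_ge0 ?addr_ge0 ?sqr_ge0//.
    rewrite normrM ger0_norm ?expR_ge0// mulrC ler_wpM2r ?expR_ge0//.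
    rewrite (le_trans (ler_normB _ _))// lerD// normrM.
      by rewrite ler_piMr// sin_max.
    by rewrite gtr0_norm// ler_piMr ?cos_max// ltW.
  + exact: cvg_cst.
  + rewrite -[X in _ --> X](mulr0 ((a ^+ 2 + b ^+ 2)^-1 * (`|b| + a))).
    by apply: cvgM; [exact: cvg_cst|exact: cvg_expRMn].
Qed.
End exponential_cosine.

Section fubini.
Context d1 d2 (T1 : measurableType d1) (T2 : measurableType d2) (R : realType).
Variable m1 : {sigma_finite_measure set T1 -> \bar R}.
Variable m2 : {sigma_finite_measure set T2 -> \bar R}.
Variables (f : T1 * T2 -> R) (g : T1 -> R) (h : T2 -> R).
Hypothesis mf : measurable_fun setT f.
Hypothesis ig : m1.-integrable setT (EFin \o g).
Hypothesis ih : m2.-integrable setT (EFin \o h).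
Hypothesis fgh : forall x y, `|f (x, y)| <= g x * h y.

(** All applications of Fubini's theorem below have an integrand dominated by
    a product of integrable functions of one variable each. *)
Lemma integrable_prod_bound :
  (m1 \x m2)%E.-integrable setT (EFin \o f).
Proof.
have mEf : measurable_fun setT (EFin \o f) by exact/measurable_EFinP.
apply/(integrable12ltyP m1 m2 mEf) => /=.
have inh : m2.-integrable setT (fun y => (`|h y|)%:E) by exact: integrable_norm.
have ing : m1.-integrable setT (fun y => (`|g y|)%:E) by exact: integrable_norm.
have h1 x : (\int[m2]_y `|(f (x, y))%:E| <=
             (`|g x| * \int[m2]_y `|h y|)%:E)%E.
  rewrite EFinM /Rintegral fineK; last first.
    exact: integrable_fin_num.
  rewrite -ge0_integralZl//; last exact: measurable_int inh.
  apply: ge0_le_integral => //.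
  - apply: measurableT_comp => //; apply/measurable_EFinP.
    by apply: measurableT_comp mf _.
  - apply: emeasurable_funM => //; exact: measurable_int inh.
  - move=> y _; rewrite -EFinM lee_fin.
    by rewrite (le_trans (fgh x y))// -normrM ler_norm.
apply: (@le_lt_trans _ _ (\int[m1]_x (`|g x| * \int[m2]_y `|h y|)%:E)%E).
  apply: ge0_le_integral => //.
  - by move=> x _; apply: integral_ge0.
  - apply: (@measurable_fun_fubini_tonelli_F _ _ _ _ _ m2 (fun z => `|(f z)%:E|%E)) => //.
    exact: measurableT_comp.
  - apply/measurable_EFinP; apply: measurable_funM => //.
    by apply/measurable_EFinP; exact: measurable_int ing.
  by move=> x _; exact: h1.
under eq_integral do rewrite EFinM muleC.
rewrite ge0_integralZl//.
- rewrite lte_mul_pinfty ?lee_fin//; first exact: Rintegral_ge0.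
  by have /integrableP[_] := ig.
- exact: measurable_int ing.
- rewrite lee_fin; exact: Rintegral_ge0.
Qed.

Lemma integrable_section1 x : m2.-integrable setT (fun y => (f (x, y))%:E).
Proof.
apply: (@integrable_le _ _ _ m2 setT _ (fun y => g x * h y)) => //.
  by apply: measurableT_comp mf _.
have := integrableZl measurableT (g x) ih.
by apply: eq_integrable => // y _ /=; rewrite EFinM.
Qed.

Lemma integrable_section2 y : m1.-integrable setT (fun x => (f (x, y))%:E).
Proof.
apply: (@integrable_le _ _ _ m1 setT _ (fun x => h y * g x)) => //.
- by apply: measurableT_comp mf _.
- have := integrableZl measurableT (h y) ig.
  by apply: eq_integrable => // x _ /=; rewrite EFinM.
- by move=> x _; rewrite mulrC.
Qed.

Lemma RFubini12 : \int[m1]_x (\int[m2]_y f (x, y)) = \int[(m1 \x m2)%E]_z f z.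
Proof.
rewrite [RHS]/Rintegral -(integral12_prod_meas1 integrable_prod_bound)/=.
rewrite [LHS]/Rintegral; congr fine; apply: eq_integral => x _.
by rewrite /Rintegral fineK//; apply: integrable_fin_num => //; exact: integrable_section1.
Qed.

Lemma RFubini21 : \int[m2]_y (\int[m1]_x f (x, y)) = \int[(m1 \x m2)%E]_z f z.
Proof.
rewrite [RHS]/Rintegral -(integral21_prod_meas1 integrable_prod_bound)/=.
rewrite [LHS]/Rintegral; congr fine; apply: eq_integral => x _.
by rewrite /Rintegral fineK//; apply: integrable_fin_num => //; exact: integrable_section2.
Qed.

Lemma RFubini : \int[m1]_x (\int[m2]_y f (x, y)) = \int[m2]_y (\int[m1]_x f (x, y)).
Proof. by rewrite RFubini12 RFubini21. Qed.
End fubini.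

Section abel_regularisation.
Variable R : realType.

Lemma continuous_invr (q : R -> R) : continuous q -> (forall x, q x != 0) ->
  continuous (fun x => (q x)^-1).
Proof. by move=> cq q0 x; apply: cvgV; [exact: q0|exact: cq]. Qed.

Lemma continuous_poisson (a w : R) : 0 < a ->
  continuous (fun x : R => a / (a ^+ 2 + (x - w) ^+ 2)).
Proof.
move=> a0 x; apply: cvgM; first exact: cvg_cst.
apply: (@continuous_invr (fun x => a ^+ 2 + (x - w) ^+ 2)) => [y|y].
  apply: cvgD; first exact: cvg_cst.
  by apply: cvgM; (apply: cvgB; [exact: cvg_id|exact: cvg_cst]).
by rewrite gt_eqF// ltr_pwDl ?sqr_ge0// exprn_gt0.
Qed.

Lemma poisson_le (a y : R) : 0 < a -> 0 <= a / (a ^+ 2 + y ^+ 2) <= a^-1.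
Proof.
move=> a0; rewrite divr_ge0 ?addr_ge0 ?sqr_ge0 ?(ltW a0)//=.
rewrite ler_pdivrMr; last by rewrite ltr_pwDl ?sqr_ge0// exprn_gt0.
rewrite mulrDr expr2 mulrA mulVf ?gt_eqF// mul1r lerDl.
by rewrite mulr_ge0 ?sqr_ge0// invr_ge0 ltW.
Qed.

Notation leb := (@lebesgue_measure R).

Lemma integrable_mkcondR (D : set R) (f : R -> R) : measurable D ->
  leb.-integrable D (EFin \o f) <-> leb.-integrable setT (EFin \o (f \_ D)).
Proof. by move=> mD; rewrite -restrict_EFin; exact: integrable_mkcond. Qed.

(** The factor [expR (- (a * b))] makes the integral over [b] absolutely
    convergent after [(1 + b ^+ 2)^-1] has been written as the Laplace transform
    of [cos (b * x)] at [1]; exchanging the integrals turns the product of two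
    cosines into a pair of Poisson kernels of width [a]. *)
Lemma cauchy_kernel_abel (a w : R) : 0 < a ->
  \int[leb]_(b in `[0, +oo[) (expR (- (a * b)) * cos (b * w) / (1 + b ^+ 2)) =
  2^-1 * \int[leb]_(x in `[0, +oo[) (expR (- x) *
    (a / (a ^+ 2 + (x - w) ^+ 2) + a / (a ^+ 2 + (x + w) ^+ 2))).
Proof.
move=> a0.
have pt0 : point = 0 :> R by [].
pose D : set R := `[0, +oo[%classic.
have mD : measurable D by exact: measurable_itv.
have mexp c : measurable_fun setT (fun x : R => expR (- (c * x))).
  by apply: measurableT_comp => //; apply: measurableT_comp.
pose g b := ((fun b => expR (- (a * b))) \_ D) b.
pose h x := ((fun x => expR (- (1 * x))) \_ D) x.
pose f z := g z.1 * h z.2 * (cos (z.1 * w) * cos (z.2 * z.1)).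
have ig : leb.-integrable setT (EFin \o g).
  by apply/(integrable_mkcondR _ mD); exact: integrable_expRN.
have ih : leb.-integrable setT (EFin \o h).
  by apply/(integrable_mkcondR _ mD); exact: integrable_expRN.
have mg : measurable_fun setT g by have /integrableP[/measurable_EFinP] := ig.
have mh : measurable_fun setT h by have /integrableP[/measurable_EFinP] := ih.
have mf : measurable_fun setT f.
  apply: measurable_funM.
    by apply: measurable_funM; exact: measurableT_comp.
  apply: measurable_funM; apply: measurableT_comp (continuous_measurable_fun (@continuous_cos R)) _.
    by apply: measurable_funM.
  by apply: measurable_funM.
have g0 x : 0 <= g x by rewrite /g patchE; case: ifP => // _; exact: expR_ge0.
have h0 x : 0 <= h x by rewrite /h patchE; case: ifP => // _; exact: expR_ge0.
have fgh x y : `|f (x, y)| <= g x * h y.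
  rewrite /f/= normrM ger0_norm ?mulr_ge0// ler_piMr ?mulr_ge0//.
  by rewrite normrM mulr_ile1// cos_max.
have mcos (c : R) : measurable_fun setT (fun x : R => cos (c * x)).
  apply: measurableT_comp (continuous_measurable_fun (@continuous_cos R)) _.
  exact: (measurable_funM (measurable_cst c) (@measurable_id _ _ setT)).
have := @RFubini _ _ (measurableTypeR R) (measurableTypeR R) R leb leb f g h mf ig ih fgh.
have -> : \int[leb]_x \int[leb]_y f (x, y) =
    \int[leb]_(b in D) (expR (- (a * b)) * cos (b * w) / (1 + b ^+ 2)).
  rewrite [RHS]Rintegral_mkcond; apply: eq_Rintegral => b _.
  have -> : (fun y => f (b, y)) = (fun y => (g b * cos (b * w)) *
      ((fun y => expR (- (1 * y)) * cos (b * y)) \_ D) y).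
    apply/funext => y; rewrite /f/= /h !patchE mulrC [y * b]mulrC.
    case: ifP => _; rewrite ?pt0; ring.
  rewrite RintegralZl//; last first.
    apply/(integrable_mkcondR _ mD).
    apply: integrable_le (integrable_expRN ltr01) _ => //.
      by apply: measurable_funTS; exact: (measurable_funM (mexp _) (mcos _)).
    move=> x _; rewrite normrM ger0_norm ?expR_ge0// ler_piMr ?expR_ge0//.
    exact: cos_max.
  rewrite -Rintegral_mkcond Rintegral_expRcos// /g !patchE; case: ifP => _.
    by rewrite expr1n div1r.
  by rewrite pt0 !mul0r.
have -> : \int[leb]_y \int[leb]_x f (x, y) =
    \int[leb]_(x in D) (2^-1 * (expR (- x) *
    (a / (a ^+ 2 + (x - w) ^+ 2) + a / (a ^+ 2 + (x + w) ^+ 2)))).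
  rewrite [RHS]Rintegral_mkcond; apply: eq_Rintegral => x _.
  have icos c : leb.-integrable setT (EFin \o ((fun b => expR (- (a * b)) * cos (c * b)) \_ D)).
    apply/(integrable_mkcondR _ mD).
    apply: integrable_le (integrable_expRN a0) _ => //.
      by apply: measurable_funTS; exact: (measurable_funM (mexp _) (mcos _)).
    move=> b _; rewrite normrM ger0_norm ?expR_ge0// ler_piMr ?expR_ge0//.
    exact: cos_max.
  have -> : (fun b => f (b, x)) = (fun b => (h x * 2^-1) *
    (((fun b => expR (- (a * b)) * cos ((x - w) * b)) \_ D) b +
     ((fun b => expR (- (a * b)) * cos ((x + w) * b)) \_ D) b)).
    apply/funext => b; rewrite /f/= /g !patchE; case: ifP => _; last by rewrite pt0; ring.
    rewrite [(x + w) * b]mulrDl [(x - w) * b]mulrBl cosB cosD [w * b]mulrC; by field.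
  rewrite RintegralZl//; last exact: (integrableD measurableT (icos _) (icos _)).
  rewrite RintegralD// -!Rintegral_mkcond !Rintegral_expRcos//.
  rewrite /h !patchE; case: ifP => _; rewrite ?pt0 ?mul1r ?mul0r//; ring.
move=> ->; apply: (@RintegralZl _ (measurableTypeR R) R leb); first exact: mD.
apply: (@integrable_le _ (measurableTypeR R) R leb D _ (fun x => (2 / a) * expR (- (1 * x)))) => //.
- apply: measurable_funTS; apply: measurable_funM.
    exact: measurableT_comp (@measurable_expR R) (@oppr_measurable R setT).
  apply: measurable_funD; apply: continuous_measurable_fun.
    exact: continuous_poisson.
  have := @continuous_poisson a (- w) a0.
  by under eq_fun do rewrite opprK.
- exact: (@integrableZlR _ (measurableTypeR R) R leb D (2 / a) _ mD (integrable_expRN ltr01)).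
- move=> x _; rewrite mul1r normrM ger0_norm ?expR_ge0// mulrC ler_wpM2r ?expR_ge0//.
  have /andP[? ?] := poisson_le (x - w) a0; have /andP[? ?] := poisson_le (x + w) a0.
  rewrite ger0_norm ?addr_ge0//.
  by have -> : 2 / a = a^-1 + a^-1 by [field; rewrite gt_eqF]; exact: lerD.
Qed.
End abel_regularisation.

Section poisson_kernel.
Variable R : realType.
Notation leb := (@lebesgue_measure R).

Lemma der_expRN (x : R) : is_derive x 1 (fun x : R => expR (- x)) (- expR (- x)).
Proof.
apply: is_derive_eq (isd_comp (is_derive_expR (- x)) (isd_opp (isd_id x))) _.
by rewrite mulrN1.
Qed.

Lemma continuous_expRN : continuous (fun x : R => expR (- x)).
Proof. exact: der_continuous der_expRN. Qed.

Lemma integrable_expRN1 : leb.-integrable `[0, +oo[ (EFin \o (fun x : R => expR (- x))).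
Proof.
have := @integrable_expRN R 1 ltr01.
by under [X in EFin \o X]eq_fun do rewrite mul1r.
Qed.

Lemma Rintegral_expRN (w : R) : 0 <= w ->
  \int[leb]_(x in `[0, +oo[) (expR (- x) * \1_(`]w, +oo[%classic) x) = expR (- w).
Proof.
move=> w0.
have -> : (fun x : R => expR (- x) * \1_(`]w, +oo[%classic) x) =
   (fun x : R => expR (- x)) \_ `]w, +oo[.
  apply/funext => x; rewrite patchE indicE; case: ifP => _ /=.
    by rewrite mulr1.
  by rewrite mulr0.
rewrite -Rintegral_mkcondr setIidr; last first.
  by move=> x /=; rewrite !in_itv/= !andbT => /ltW; exact: le_trans.
rewrite Rintegral_itv_obnd_cbnd; last first.
  apply: integrableS integrable_expRN1 => //.
  by move=> x /=; rewrite !in_itv/= !andbT => /ltW; exact: le_trans.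
have dF (x : R) : is_derive x 1 (fun x : R => - expR (- x)) (expR (- x)).
  by apply: is_derive_eq (isd_opp (der_expRN x)) _; rewrite opprK.
have cF : continuous (fun x : R => - expR (- x)) by exact: der_continuous dF.
rewrite (@Rintegral_ge0_continuous_FTC2y _ _ (fun x : R => - expR (- x)) w 0).
- by rewrite sub0r opprK.
- by move=> x _; exact: expR_ge0.
- by apply: continuous_subspaceT; exact: continuous_expRN.
- by rewrite -oppr0; apply: cvgN; exact: cvgr_expR.
- by move=> x _; case: (dF x).
- by apply: cvg_at_right_filter; exact: cF.
- by move=> x _; rewrite derive1E; apply: derive_val.
Qed.

Lemma atan_abs (x : R) : `|atan x| <= pi / 2.
Proof. by rewrite ler_norml ltW ?atan_gtNpi2//= ltW// atan_ltpi2. Qed.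

(** The Poisson kernels concentrate at [w] and [- w] as [a] goes to 0. One
    integration by parts replaces them by bounded arctangents, to which
    dominated convergence applies. *)
Lemma poisson_by_parts (a w : R) : 0 < a ->
  \int[leb]_(x in `[0, +oo[) (expR (- x) *
    (a / (a ^+ 2 + (x - w) ^+ 2) + a / (a ^+ 2 + (x + w) ^+ 2))) =
  \int[leb]_(x in `[0, +oo[) (expR (- x) *
    (atan ((x - w) / a) + atan ((x + w) / a))).
Proof.
move=> a0.
pose k x := a / (a ^+ 2 + (x - w) ^+ 2) + a / (a ^+ 2 + (x + w) ^+ 2).
pose t x := atan ((x - w) / a) + atan ((x + w) / a).
have dat (c x : R) : is_derive x 1 (fun x : R => atan ((x + c) / a))
    (a / (a ^+ 2 + (x + c) ^+ 2)).
  apply: is_derive_eq (@isd_comp _ _ (fun x => (x + c) / a) _ _ _ (is_derive1_atan _)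
    (isd_mul (isd_add (isd_id x) (isd_cst c x)) (isd_cst a^-1 x))) _.
  have p1 : a ^+ 2 + (x + c) ^+ 2 != 0.
    by rewrite gt_eqF// ltr_pwDl ?sqr_ge0// exprn_gt0.
  field; rewrite p1/= gt_eqF//=.
have dt (x : R) : is_derive x 1 t (k x) by apply: isd_add; exact: dat.
have ct : continuous t by exact: der_continuous dt.
have ck : continuous k.
  have -> : k = (fun x => a / (a ^+ 2 + (x - w) ^+ 2) + a / (a ^+ 2 + (x - (- w)) ^+ 2)).
    by apply/funext => x; rewrite opprK.
  by move=> x; apply: cvgD; exact: continuous_poisson.
have kb x : `|k x| <= 2 / a.
  have /andP[? ?] := poisson_le (x - w) a0; have /andP[? ?] := poisson_le (x + w) a0.
  rewrite ger0_norm ?addr_ge0//.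
  by have -> : 2 / a = a^-1 + a^-1; [field; rewrite gt_eqF|exact: lerD].
have tb x : `|t x| <= pi.
  rewrite (le_trans (ler_normD _ _))// (splitr pi) lerD//; exact: atan_abs.
have mD : measurable (`[0, +oo[%classic : set (measurableTypeR R)).
  exact: measurable_itv.
have ib (q : R -> R) (B : R) : continuous q -> (forall x, `|q x| <= B) ->
    leb.-integrable `[0, +oo[ (EFin \o (fun x => expR (- x) * q x)).
  move=> cq qB.
  apply: (@integrable_le _ (measurableTypeR R) R leb _ _ (fun x => B * expR (- x))) => //.
  - apply: measurable_funTS; apply: continuous_measurable_fun.
    by move=> x; apply: cvgM; [exact: continuous_expRN|exact: cq].
  - exact: (@integrableZlR _ (measurableTypeR R) R leb _ B _ mD integrable_expRN1).
  - by move=> x _; rewrite normrM ger0_norm ?expR_ge0// mulrC ler_wpM2r ?expR_ge0.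
apply/eqP; rewrite -subr_eq0 -RintegralB//; [|exact: ib ck kb|exact: ib ct tb].
apply/eqP.
have dF (x : R) : is_derive x 1 (fun x => expR (- x) * t x)
   (expR (- x) * k x - expR (- x) * t x).
  by apply: is_derive_eq (isd_mul (der_expRN x) (dt x)) _; ring.
rewrite (Rintegral_FTC0y dF (l := 0)).
- by rewrite /t !sub0r add0r mulNr atanN addNr mulr0 oppr0.
- move=> x; apply: cvgB; apply: cvgM;
    [exact: continuous_expRN|exact: ck|exact: continuous_expRN|exact: ct].
- exact: (integrableBR mD (ib _ _ ck kb) (ib _ _ ct tb)).
- apply/norm_cvg0P.
  apply: (@squeeze_cvgr _ _ _ _ (cst 0) (fun n => pi * expR (- (1 * n%:R)))).
  + apply: nearW => n /=; rewrite normr_ge0/= normrM ger0_norm ?expR_ge0//.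
    by rewrite mulrC mul1r ler_wpM2r ?expR_ge0.
  + exact: cvg_cst.
  + rewrite -[X in _ --> X](mulr0 pi).
    by apply: cvgM; [exact: cvg_cst|exact: (cvg_expRMn ltr01)].
Qed.

Lemma cvg_atan_mul (y : R) :
  atan (y * n.+1%:R) @[n --> \oo] --> Num.sg y * (pi / 2).
Proof.
have h (z : R) : 0 < z -> atan (z * n.+1%:R) @[n --> \oo] --> pi / 2.
  move=> z0.
  have h1 : (z * n.+1%:R) @[n --> \oo] --> +oo%R.
    apply/cvgryPge => A; near=> n.
    rewrite mulrC -ler_pdivrMr// (@le_trans _ _ n%:R)//; last by rewrite ler_nat.
    near: n; exact: nbhs_infty_ger.
  exact: (cvg_comp _ _ h1 (@cvgy_atan R)).
have [->|y0|y0] := sgrP y.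
- rewrite mul0r (_ : (fun n => _) = cst 0); first exact: cvg_cst.
  by apply/funext => n; rewrite mul0r atan0.
- by rewrite mul1r; exact: h.
- rewrite mulN1r (_ : (fun n => _) = (fun n => - atan (- y * n.+1%:R))).
    by apply: cvgN; apply: h; rewrite oppr_gt0.
  by apply/funext => n; rewrite mulNr atanN opprK.
Unshelve. all: by end_near. Qed.
End poisson_kernel.

Section cauchy_kernel.
Variable R : realType.
Notation leb := (@lebesgue_measure R).

Lemma integrable_cauchy :
  leb.-integrable `[0, +oo[ (EFin \o (fun b : R => (1 + b ^+ 2)^-1)).
Proof.
apply/integrableP; split.
  apply/measurable_EFinP; apply: measurable_funTS.
  exact: continuous_measurable_fun (@continuous_oneDsqrV R).
under eq_integral => x _ do rewrite /= ger0_norm ?invr_ge0 ?addr_ge0 ?sqr_ge0//.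
by rewrite (@integral0y_oneDsqr R) ltry.
Qed.

(** The Fourier transform of the Cauchy distribution, obtained by letting the
    width [a] of the regularisation go to 0: the arctangents converge to
    [pi] times the indicator of [`]w, +oo[]. *)
Lemma cauchy_kernel (w : R) :
  \int[leb]_(b in `[0, +oo[) (cos (b * w) / (1 + b ^+ 2)) =
  pi / 2 * expR (- `|w|).
Proof.
wlog w0 : w / 0 <= w => [H|].
  have [/H//|w0] := leP 0 w.
  have := H (- w); rewrite normrN => <-; last by rewrite oppr_ge0 ltW.
  by apply: eq_Rintegral => b _; rewrite mulrN cosN.
rewrite ger0_norm//.
have mD : measurable (`[0, +oo[%classic : set (measurableTypeR R)).
  exact: measurable_itv.
have mcos : measurable_fun setT (fun b : R => cos (b * w)).
  apply: measurableT_comp (continuous_measurable_fun (@continuous_cos R)) _.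
  exact: mulrr_measurable.
have mV : measurable_fun setT (fun b : R => (1 + b ^+ 2)^-1).
  exact: continuous_measurable_fun (@continuous_oneDsqrV R).
have h1 : \int[leb]_(b in `[0, +oo[) (expR (- (n.+1%:R^-1 * b)) * cos (b * w) / (1 + b ^+ 2))
    @[n --> \oo] --> \int[leb]_(b in `[0, +oo[) (cos (b * w) / (1 + b ^+ 2)).
  apply: (@Rdominated_cvg _ (measurableTypeR R) R leb _ _ _ (fun b => (1 + b ^+ 2)^-1)) => //.
  - move=> n; apply: measurable_funTS; apply: measurable_funM => //.
    apply: measurable_funM => //; apply: measurableT_comp => //.
    by apply: measurableT_comp.
  - by apply: measurable_funTS; exact: measurable_funM.
  - apply: aeW => b _;
    suff : (expR (- (n.+1%:R^-1 * b)) * cos (b * w) / (1 + b ^+ 2))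
        @[n --> \oo] --> 1 * cos (b * w) / (1 + b ^+ 2) by rewrite mul1r.
    apply: cvgM; last exact: cvg_cst.
    apply: cvgM; last exact: cvg_cst.
    have h0 : (n.+1%:R^-1 * b) @[n --> \oo] --> (0 : R) * b.
      by apply: cvgM; [exact: (@cvg_harmonic R)|exact: cvg_cst].
    have h1 := cvg_comp _ _ (cvgN h0) (@continuous_expR R _).
    move: h1; rewrite mul0r oppr0 expR0. by apply.
  - exact: integrable_cauchy.
  - move=> n b /=; rewrite in_itv/= andbT => b0.
    rewrite normrM [X in _ * X]ger0_norm ?invr_ge0 ?addr_ge0 ?sqr_ge0//.
    rewrite ler_piMl ?invr_ge0 ?addr_ge0 ?sqr_ge0// normrM mulr_ile1//.
      by rewrite ger0_norm ?expR_ge0// -expR0 ler_expR oppr_le0 mulr_ge0.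
    exact: cos_max.
have h2 : \int[leb]_(b in `[0, +oo[) (expR (- (n.+1%:R^-1 * b)) * cos (b * w) / (1 + b ^+ 2))
    @[n --> \oo] --> 2^-1 * (pi * expR (- w)).
  have -> : (fun n => \int[leb]_(b in `[0, +oo[)
     (expR (- (n.+1%:R^-1 * b)) * cos (b * w) / (1 + b ^+ 2))) =
    (fun n => 2^-1 * \int[leb]_(x in `[0, +oo[) (expR (- x) *
    (atan ((x - w) * n.+1%:R) + atan ((x + w) * n.+1%:R)))).
    apply/funext => n; have n0 : (0:R) < n.+1%:R^-1 by rewrite invr_gt0 ltr0n.
    by rewrite (cauchy_kernel_abel w n0) (poisson_by_parts w n0) invrK.
  apply: cvgM; first exact: cvg_cst.
  rewrite -(Rintegral_expRN w0).
  rewrite -RintegralZl//; last first.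
    apply: (@integrable_le _ (measurableTypeR R) R leb _ _ (fun x => expR (- x))) => //.
    - apply: measurable_funM; apply: measurable_funTS => //.
      exact: continuous_measurable_fun (@continuous_expRN R).
    - exact: integrable_expRN1.
    - move=> x _; rewrite normrM ger0_norm ?expR_ge0// ler_piMr ?expR_ge0//.
      by rewrite indicE; case: (_ \in _); rewrite ?normr1 ?normr0.
  have matan (c r : R) : measurable_fun setT (fun x : R => atan ((x + c) * r)).
    apply: measurableT_comp (continuous_measurable_fun (@continuous_atan R)) _.
    by apply: measurable_funM => //; exact: measurable_funD.
  apply: (@Rdominated_cvg _ (measurableTypeR R) R leb _ _ _ (fun x => pi * expR (- x))) => //.
  - move=> n; apply: measurable_funTS; apply: measurable_funM.
      exact: continuous_measurable_fun (@continuous_expRN R).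
    apply: measurable_funD; exact: matan.
  - apply: measurable_funTS; apply: measurable_funM => //.
    apply: measurable_funM => //.
    exact: continuous_measurable_fun (@continuous_expRN R).
  - exists [set w]; split; [exact: measurable_set1|exact: lebesgue_measure_set1|].
    move=> x /=; apply: contra_notP => /eqP xw.
    rewrite in_itv/= andbT => x0.
    rewrite mulrCA; apply: cvgM; first exact: cvg_cst.
    have -> : pi * \1_(`]w, +oo[%classic) x =
      Num.sg (x - w) * (pi / 2) + Num.sg (x + w) * (pi / 2) :> R.
      rewrite indicE /= mem_setE in_itv/= andbT; case: ltgtP xw => // xw _.
        rewrite gtr0_sg ?subr_gt0// gtr0_sg ?ltr_wpDr//; last by rewrite (le_lt_trans w0).
        by rewrite mulr1 !mul1r -splitr.
      rewrite ltr0_sg ?subr_lt0// gtr0_sg ?ltr_wpDl//; last by rewrite (le_lt_trans x0).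
      by rewrite mulr0 mul1r mulN1r addNr.
    by apply: cvgD; exact: cvg_atan_mul.
  - exact: (@integrableZlR _ (measurableTypeR R) R leb _ pi _ mD (@integrable_expRN1 R)).
  - move=> n x _; rewrite normrM ger0_norm ?expR_ge0// mulrC ler_wpM2r ?expR_ge0//.
    rewrite (le_trans (ler_normD _ _))// (splitr pi) lerD//; exact: atan_abs.
by rewrite (cvg_unique _ h1 h2)//; ring.
Qed.

End cauchy_kernel.

Section cauchy_average.
Context d (S : measurableType d) (R : realType).
Variable q : {sigma_finite_measure set S -> \bar R}.
Notation leb := (@lebesgue_measure R).

(** Expectations of [expR (- `|V|)] are averages over frequencies of
    expectations of cosines. This is how information on characteristic functions
    is transferred to functions that detect the sign. *)
Lemma Rintegral_exp_cauchy (g V : S -> R) :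
  q.-integrable setT (EFin \o g) -> measurable_fun setT V ->
  pi / 2 * \int[q]_s (g s * expR (- `|V s|)) =
  \int[leb]_(b in `[0, +oo[) ((\int[q]_s (g s * cos (b * V s))) / (1 + b ^+ 2)).
Proof.
move=> ig mV.
have mg : measurable_fun setT g by have /integrableP[/measurable_EFinP] := ig.
pose D : set R := `[0, +oo[%classic.
have mD : measurable (D : set (measurableTypeR R)) by exact: measurable_itv.
have pt0 : point = 0 :> R by [].
pose k := (fun b : R => (1 + b ^+ 2)^-1) \_ D.
have ik : leb.-integrable setT (EFin \o k).
  by apply/(integrable_mkcondR _ mD); exact: integrable_cauchy.
have mk : measurable_fun setT k by have /integrableP[/measurable_EFinP] := ik.
have k0 b : 0 <= k b.
  by rewrite /k patchE; case: ifP => _ //; rewrite invr_ge0 addr_ge0 ?sqr_ge0.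
pose f (z : S * measurableTypeR R) := g z.1 * (cos (z.2 * V z.1) * k z.2).
have mf : measurable_fun setT f.
  apply: measurable_funM; first exact: measurableT_comp.
  apply: measurable_funM; last exact: measurableT_comp.
  apply: measurableT_comp (continuous_measurable_fun (@continuous_cos R)) _.
  by apply: measurable_funM => //; exact: measurableT_comp.
have fgk s b : `|f (s, b)| <= `|g s| * k b.
  rewrite /f normrM ler_wpM2l// normrM (ger0_norm (k0 b)) ler_piMl//.
  exact: cos_max.
have := @RFubini _ _ S (measurableTypeR R) R q leb f _ k mf (integrable_norm ig) ik fgk.
have -> : \int[q]_s \int[leb]_b f (s, b) = pi / 2 * \int[q]_s (g s * expR (- `|V s|)).
  rewrite -RintegralZl//; last first.
    apply: (@integrable_le _ _ _ q setT _ (fun s => `|g s|)) => //.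
    - apply: measurable_funM => //; apply: measurableT_comp => //.
      by apply: measurableT_comp => //; apply: measurableT_comp.
    - exact: integrable_norm.
    - move=> s _; rewrite normrM ler_piMr// ger0_norm ?expR_ge0//.
  apply: eq_Rintegral => s _.
  have -> : (fun b => f (s, b)) = (fun b => g s * ((fun b => cos (b * V s) / (1 + b ^+ 2)) \_ D) b).
    by apply/funext => b; rewrite /f/= /k !patchE; case: ifP => _; rewrite ?pt0 ?mulr0.
  rewrite RintegralZl//.
    by rewrite -Rintegral_mkcond cauchy_kernel; ring.
  apply/(integrable_mkcondR _ mD).
  apply: (@integrable_le _ (measurableTypeR R) R leb D _ (fun b => (1 + b ^+ 2)^-1)) => //.
  - apply: measurable_funTS; apply: measurable_funM.
      apply: measurableT_comp (continuous_measurable_fun (@continuous_cos R)) _.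
      exact: mulrr_measurable.
    exact: continuous_measurable_fun (@continuous_oneDsqrV R).
  - exact: integrable_cauchy.
  - move=> b _; rewrite normrM [X in _ * X]ger0_norm ?invr_ge0 ?addr_ge0 ?sqr_ge0//.
    by rewrite ler_piMl ?invr_ge0 ?addr_ge0 ?sqr_ge0//; exact: cos_max.
move=> ->; rewrite [RHS]Rintegral_mkcond; apply: eq_Rintegral => b _.
rewrite patchE; case: ifP => bD; last first.
  rewrite (_ : (fun x => _) = cst 0) ?Rintegral_cst ?mul0r//.
  by apply/funext => s; rewrite /f/= /k patchE bD pt0 !mulr0.
rewrite -RintegralZr//; last first.
  apply: (@integrable_le _ _ _ q setT _ (fun s => `|g s|)) => //.
  - apply: measurable_funM => //.
    apply: measurableT_comp (continuous_measurable_fun (@continuous_cos R)) _.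
    exact: measurable_funM.
  - exact: integrable_norm.
  - by move=> s _; rewrite normrM ler_piMr//; exact: cos_max.
by apply: eq_Rintegral => s _; rewrite /f/= /k patchE bD mulrA.
Qed.
End cauchy_average.

(** * Derivatives under the integral and trigonometric bounds *)
Section derive_integral.
Context d (T : measurableType d) (R : realType).
Variable m : {measure set T -> \bar R}.

(** Differentiation under the integral sign, in the form of a statement on
    [is_derive], which chains with the derivation rules. *)
Lemma is_derive_Rintegral (f f' : R -> T -> R) (G : T -> R) (u v a : R) :
  u < a < v ->
  (forall x, m.-integrable setT (EFin \o f x)) ->
  (forall x y, is_derive x (1 : R) (f ^~ y) (f' x y)) ->
  (forall y, 0 <= G y) -> m.-integrable setT (EFin \o G) ->
  (forall x y, u < x < v -> `|f' x y| <= G y) ->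
  is_derive a (1 : R) (fun x => \int[m]_y f x y) (\int[m]_y f' a y).
Proof.
move=> ua intf df G0 iG fG.
have p1E x y : partial1of2 f x y = f' x y.
  by rewrite partial1of2E; apply: derive_val.
have Ia : [set` `]u, v[] a by rewrite /= in_itv.
have dd x y : [set` `]u, v[] x -> [set: T] y -> derivable (f ^~ y) x 1.
  by move=> _ _; case: (df x y).
have Gub x y : [set` `]u, v[] x -> [set: T] y -> `|partial1of2 f x y| <= G y.
  by rewrite /= in_itv/= => xuv _; rewrite p1E; exact: fG.
have intf' x : [set` `]u, v[] x -> m.-integrable setT (EFin \o f x) by [].
have D := @derivable_under_integral R _ T m f setT measurableT a u v Ia intf' dd G G0 iG Gub.
have V := @differentiation_under_integral R _ T m f setT measurableT a u v Ia intf' dd G G0 iG Gub.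
apply: DeriveDef => //.
by rewrite -derive1E V; apply: eq_Rintegral => y _; rewrite p1E.
Qed.
End derive_integral.

Section trig_bounds.
Variable R : realType.
Implicit Types a b x : R.

Lemma MVT_abs (f f' : R -> R) a b : (forall x, is_derive x (1 : R) f (f' x)) ->
  exists2 c, `|c| <= Num.max `|a| `|b| & f b - f a = f' c * (b - a).
Proof.
move=> df.
have cf : continuous f by exact: der_continuous df.
wlog ab : a b / a <= b => [H|].
  have [/H//|/ltW/H[c cab fE]] := leP a b.
  by exists c; [rewrite maxC|rewrite -opprB fE -mulrN opprB].
have [x xab fE] := @MVT_segment R f f' a b ab (fun x _ => df x) (continuous_subspaceT cf).
exists x => //; move: xab; rewrite in_itv/= => /andP[ax xb].
have [x0|x0] := leP 0 x.
  by rewrite le_max; apply/orP; right; rewrite ger0_norm// (le_trans xb)// ler_norm.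
rewrite le_max; apply/orP; left; rewrite ltr0_norm//.
by rewrite ltr0_norm ?lerN2//; exact: le_lt_trans x0.
Qed.

Lemma max_norm_le_add a b : Num.max `|a| `|b| <= `|a| + `|b|.
Proof. by rewrite ge_max lerDl lerDr !normr_ge0. Qed.

Lemma sin_abs_le x : `|sin x| <= `|x|.
Proof.
have [c _] := @MVT_abs sin cos 0 x (fun x => is_derive_sin x).
by rewrite sin0 !subr0 => ->; rewrite normrM ler_piMl// cos_max.
Qed.

Lemma one_sub_cos_le x : `|cos x - 1| <= `|x|.
Proof.
have [c _] := @MVT_abs cos (fun x => - sin x) 0 x (fun x => is_derive_cos x).
by rewrite cos0 subr0 => ->; rewrite normrM ler_piMl// normrN sin_max.
Qed.

Lemma cos_sub_le a b : `|cos a - cos b| <= `|a - b|.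
Proof.
have [c _ ->] := @MVT_abs cos (fun x => - sin x) b a (fun x => is_derive_cos x).
by rewrite normrM ler_piMl// normrN sin_max.
Qed.

Lemma sin_sub_le a b : `|sin a - sin b| <= `|a - b|.
Proof.
have [c _ ->] := @MVT_abs sin cos b a (fun x => is_derive_sin x).
by rewrite normrM ler_piMl// cos_max.
Qed.

Lemma cos_sub_le2 a b : `|cos a - cos b| <= `|a - b| * (`|a| + `|b|).
Proof.
have [c cab ->] := @MVT_abs cos (fun x => - sin x) b a (fun x => is_derive_cos x).
rewrite normrM mulrC ler_wpM2l// normrN (le_trans (sin_abs_le _))//.
by rewrite (le_trans cab)// addrC max_norm_le_add.
Qed.

Lemma sinN_sub_le2 a b :
  `|(sin a - a) - (sin b - b)| <= `|a - b| * (`|a| + `|b|).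
Proof.
have df x : is_derive x (1 : R) (fun x => sin x - x) (cos x - 1).
  exact: (isd_add (is_derive_sin x) (isd_opp (isd_id x))).
have [c cab ->] := @MVT_abs _ _ b a df.
rewrite normrM mulrC ler_wpM2l// (le_trans (one_sub_cos_le _))//.
by rewrite (le_trans cab)// addrC max_norm_le_add.
Qed.
End trig_bounds.

(** * Size bias for Poisson sums of nonnegative jumps *)
Section measurability.
Context d (T : measurableType d) (R : realType).
Implicit Types f : T -> R.

Lemma mfun_cos f : measurable_fun setT f -> measurable_fun setT (fun x => cos (f x)).
Proof. exact: measurableT_comp (continuous_measurable_fun (@continuous_cos R)). Qed.

Lemma mfun_sin f : measurable_fun setT f -> measurable_fun setT (fun x => sin (f x)).
Proof. exact: measurableT_comp (continuous_measurable_fun (@continuous_sin R)). Qed.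

Lemma mfun_exp f : measurable_fun setT f -> measurable_fun setT (fun x => expR (f x)).
Proof. exact: measurableT_comp (@measurable_expR R). Qed.

Lemma mfun_opp f : measurable_fun setT f -> measurable_fun setT (fun x => - f x).
Proof. exact: measurableT_comp (@oppr_measurable R setT). Qed.

Lemma mfun_norm f : measurable_fun setT f -> measurable_fun setT (fun x => `|f x|).
Proof. exact: measurableT_comp (@normr_measurable R setT). Qed.

Lemma mfun_scale (c : R) f : measurable_fun setT f -> measurable_fun setT (fun x => c * f x).
Proof. exact: measurableT_comp (@mulrl_measurable R setT c). Qed.
End measurability.

Section poisson_cf.
Context d1 d2 (O : measurableType d1) (T : measurableType d2) (R : realType).
Variables (P : probability O R) (m : {sigma_finite_measure set T -> \bar R}).

(** The real and imaginary parts of the characteristic function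
    [exp (\int (e^{i b h} - 1) dm)] of a sum of the jumps [h] over a Poisson
    point process of intensity [m]. *)
Definition poisson_cf (W : O -> R) (h : T -> R) := forall b : R,
  \int[P]_w cos (b * W w) =
    expR (\int[m]_x (cos (b * h x) - 1)) * cos (\int[m]_x sin (b * h x)) /\
  \int[P]_w sin (b * W w) =
    expR (\int[m]_x (cos (b * h x) - 1)) * sin (\int[m]_x sin (b * h x)).

Lemma poisson_cf_scale W h s : poisson_cf W h ->
  poisson_cf (fun w => s * W w) (fun x => s * h x).
Proof.
move=> H b.
have eW (f : R -> R) : (fun w => f (b * (s * W w))) = (fun w => f (b * s * W w)).
  by apply/funext => w; rewrite mulrA.
have eh (f : R -> R) : (fun x => f (b * (s * h x))) = (fun x => f (b * s * h x)).
  by apply/funext => x; rewrite mulrA.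
by rewrite (eW cos) (eW sin) (eh (fun y => cos y - 1)) (eh sin); exact: H.
Qed.

Section size_bias.
Variables (W : O -> R) (h : T -> R).
Hypothesis mW : measurable_fun setT W.
Hypothesis iW : P.-integrable setT (EFin \o W).
Hypothesis ih : m.-integrable setT (EFin \o h).
Hypothesis h0 : forall x, 0 <= h x.
Hypothesis cfW : poisson_cf W h.

Let mh : measurable_fun setT h.
Proof. by have /integrableP[/measurable_EFinP] := ih. Qed.

Let icosW0 b : P.-integrable setT (EFin \o (fun w => cos (b * W w))).
Proof.
by apply: prob_bounded_integrable => [|w]; [exact/mfun_cos/mfun_scale|exact: cos_max].
Qed.

Let isinW0 b : P.-integrable setT (EFin \o (fun w => sin (b * W w))).
Proof.
by apply: prob_bounded_integrable => [|w]; [exact/mfun_sin/mfun_scale|exact: sin_max].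
Qed.

Let imul d (S : measurableType d) (q : {measure set S -> \bar R}) (g f : S -> R) :
  q.-integrable setT (EFin \o g) -> measurable_fun setT f ->
  (forall x, `|f x| <= 1) -> q.-integrable setT (EFin \o (fun x => g x * f x)).
Proof.
move=> ig mf f1; apply: (@integrable_le _ _ _ q setT _ (fun x => `|g x|)) => //.
- by apply: measurable_funM => //; have /integrableP[/measurable_EFinP] := ig.
- exact: integrable_norm.
- by move=> x _; rewrite normrM ler_piMr.
Qed.

Let dlin (c b : R) : is_derive b (1 : R) (fun b => b * c) c.
Proof.
by apply: is_derive_eq (isd_mul (isd_id b) (isd_cst c b)) _; rewrite mul1r mulr0 addr0.
Qed.

Let dcos (c b : R) : is_derive b (1 : R) (fun b => cos (b * c)) (- (c * sin (b * c))).
Proof.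
apply: is_derive_eq (@isd_comp _ cos (fun b => b * c) _ _ _ (is_derive_cos _) (dlin c b)) _.
by rewrite mulNr mulrC.
Qed.

Let dsin (c b : R) : is_derive b (1 : R) (fun b => sin (b * c)) (c * cos (b * c)).
Proof.
apply: is_derive_eq (@isd_comp _ sin (fun b => b * c) _ _ _ (is_derive_sin _) (dlin c b)) _.
by rewrite mulrC.
Qed.

Let btw (a : R) : a - 1 < a < a + 1.
Proof. by rewrite ltrBlDr !ltrDl ltr01. Qed.

(** Differentiating the characteristic function [phi] in [b]: since
    [phi' = (\int i h e^{i b h} dm) phi], the mean of [W e^{i b W}] is the
    integral over [m] of [h] times the mean of [e^{i b (W + h)}]. *)
Lemma size_bias_trig b :
  \int[P]_w (W w * sin (b * W w)) =
    (\int[m]_x (h x * sin (b * h x))) * (\int[P]_w cos (b * W w)) +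
    (\int[m]_x (h x * cos (b * h x))) * (\int[P]_w sin (b * W w)) /\
  \int[P]_w (W w * cos (b * W w)) =
    (\int[m]_x (h x * cos (b * h x))) * (\int[P]_w cos (b * W w)) -
    (\int[m]_x (h x * sin (b * h x))) * (\int[P]_w sin (b * W w)).
Proof.
pose A b := \int[m]_x (cos (b * h x) - 1).
pose B b := \int[m]_x sin (b * h x).
pose A' := \int[m]_x - (h x * sin (b * h x)).
pose B' := \int[m]_x (h x * cos (b * h x)).
have nh : m.-integrable setT (EFin \o (fun x => `|h x|)) by exact: integrable_norm.
have nW : P.-integrable setT (EFin \o (fun w => `|W w|)) by exact: integrable_norm.
have dA : is_derive b (1 : R) A A'.
  apply: (@is_derive_Rintegral _ _ _ m (fun b x => cos (b * h x) - 1)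
    (fun b x => - (h x * sin (b * h x))) (fun x => `|h x|) _ _ _ (btw b)) => //.
  - move=> c; apply: (@integrable_le _ _ _ m setT _ (fun x => `|c| * `|h x|)) => //.
    + by apply: measurable_funB => //; exact/mfun_cos/mfun_scale.
    + exact: integrableZlR.
    + by move=> x _; rewrite -normrM one_sub_cos_le.
  - move=> c x; apply: is_derive_eq (isd_add (dcos (h x) c) (isd_cst _ c)) _.
    by rewrite addr0.
  - by move=> c x _; rewrite normrN normrM ler_piMr// sin_max.
have dB : is_derive b (1 : R) B B'.
  apply: (@is_derive_Rintegral _ _ _ m (fun b x => sin (b * h x))
    (fun b x => h x * cos (b * h x)) (fun x => `|h x|) _ _ _ (btw b)) => //.
  - move=> c; apply: (@integrable_le _ _ _ m setT _ (fun x => `|c| * `|h x|)) => //.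
    + exact/mfun_sin/mfun_scale.
    + exact: integrableZlR.
    + by move=> x _; rewrite -normrM sin_abs_le.
  - by move=> c x _; rewrite normrM ler_piMr// cos_max.
have dC : is_derive b (1 : R) (fun b => \int[P]_w cos (b * W w))
    (\int[P]_w - (W w * sin (b * W w))).
  apply: (@is_derive_Rintegral _ _ _ P (fun b w => cos (b * W w))
    (fun b w => - (W w * sin (b * W w))) (fun w => `|W w|) _ _ _ (btw b)) => //.
  by move=> c x _; rewrite normrN normrM ler_piMr// sin_max.
have dS : is_derive b (1 : R) (fun b => \int[P]_w sin (b * W w))
    (\int[P]_w (W w * cos (b * W w))).
  apply: (@is_derive_Rintegral _ _ _ P (fun b w => sin (b * W w))
    (fun b w => W w * cos (b * W w)) (fun w => `|W w|) _ _ _ (btw b)) => //.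
  by move=> c x _; rewrite normrM ler_piMr// cos_max.
have dE : is_derive b (1 : R) (fun b => expR (A b)) (expR (A b) * A').
  exact: (@isd_comp _ expR A _ _ _ (is_derive_expR _) dA).
have dcB : is_derive b (1 : R) (fun b => cos (B b)) (- sin (B b) * B').
  exact: (@isd_comp _ cos B _ _ _ (is_derive_cos _) dB).
have dsB : is_derive b (1 : R) (fun b => sin (B b)) (cos (B b) * B').
  exact: (@isd_comp _ sin B _ _ _ (is_derive_sin _) dB).
have dC2 := isd_mul dE dcB; have dS2 := isd_mul dE dsB.
have CE : (fun b => expR (A b) * cos (B b)) = (fun b => \int[P]_w cos (b * W w)).
  by apply/funext => c; have [-> _] := cfW c.
have SE : (fun b => expR (A b) * sin (B b)) = (fun b => \int[P]_w sin (b * W w)).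
  by apply/funext => c; have [_ ->] := cfW c.
rewrite CE in dC2; rewrite SE in dS2.
have EC : \int[P]_w - (W w * sin (b * W w)) = expR (A b) * A' * cos (B b) + expR (A b) * (- sin (B b) * B').
  by rewrite -(@derive_val _ _ _ _ _ _ _ dC) (@derive_val _ _ _ _ _ _ _ dC2).
have ES : \int[P]_w (W w * cos (b * W w)) = expR (A b) * A' * sin (B b) + expR (A b) * (cos (B b) * B').
  by rewrite -(@derive_val _ _ _ _ _ _ _ dS) (@derive_val _ _ _ _ _ _ _ dS2).
have negI d (S : measurableType d) (q : {measure set S -> \bar R}) (f : S -> R) :
    q.-integrable setT (EFin \o f) -> \int[q]_x - f x = - \int[q]_x f x.
  move=> intf; rewrite -[RHS]mulN1r -RintegralZl//.
  by apply: eq_Rintegral => x _; rewrite mulN1r.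
have ihs : m.-integrable setT (EFin \o (fun x => h x * sin (b * h x))).
  by apply: imul => //; [exact/mfun_sin/mfun_scale|move=> x; exact: sin_max].
have iWs : P.-integrable setT (EFin \o (fun x => W x * sin (b * W x))).
  by apply: imul => //; [exact/mfun_sin/mfun_scale|move=> x; exact: sin_max].
rewrite negI// in EC; rewrite /A' negI// in EC ES.
have [-> ->] := cfW b; rewrite -/(A b) -/(B b) -/B'; split.
  by rewrite -[LHS]opprK EC; ring.
by rewrite ES; ring.
Qed.

Let P' : {sigma_finite_measure set O -> \bar R} := P.

Let q : {sigma_finite_measure set (T * O)%type -> \bar R} :=
  sigma_finite_pack (sigma_finite_prod m P').

(** The identity [E (W k(W)) = \int h E k(W + h) dm], linear in [k], holds for
    sines and cosines; integrating it over the frequencies against the Cauchy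
    density gives it for [k x = expR (- `|x + M|)]. *)
Lemma size_bias_exp (M : R) :
  \int[P]_w (W w * expR (- `|W w + M|)) =
  \int[m]_x (h x * \int[P]_w expR (- `|W w + h x + M|)).
Proof.
have pi2 : pi / 2 != 0 :> R by rewrite gt_eqF// divr_gt0// pi_gt0.
apply: (mulfI pi2).
rewrite Rintegral_exp_cauchy//; last exact: measurable_funD.
have mV : measurable_fun setT (fun z : T * O => W z.2 + h z.1 + M).
  apply: measurable_funD => //; apply: measurable_funD; exact: measurableT_comp.
have mh1 : measurable_fun setT (fun z : T * O => h z.1) by exact: measurableT_comp.
have i1 : P.-integrable setT (EFin \o (fun=> 1 : R)).
  by apply: (@prob_bounded_integrable _ _ _ P _ 1) => // w; rewrite normr1.
have bnd (f : T * O -> R) : (forall z, `|f z| <= 1) ->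
   forall x w, `|h x * f (x, w)| <= `|h x| * 1.
  by move=> f1 x w; rewrite normrM ler_wpM2l.
have Fub (f : T * O -> R) : measurable_fun setT f -> (forall z, `|f z| <= 1) ->
   \int[m]_x (\int[P]_w (h x * f (x, w))) = \int[q]_z (h z.1 * f z).
  move=> mf f1.
  exact: (@RFubini12 _ _ T O R m P (fun z => h z.1 * f z) _ _
    (measurable_funM mh1 mf) (integrable_norm ih) i1 (bnd f f1)).
have ihP : q.-integrable setT (EFin \o (fun z : T * O => h z.1)).
  apply: (@integrable_prod_bound _ _ T O R m P (fun z => h z.1) (fun x => `|h x|) (fun=> 1)) => //.
    exact: integrable_norm.
  by move=> x w; rewrite mulr1.
have mexpV : measurable_fun setT (fun z : T * O => expR (- `|W z.2 + h z.1 + M|)).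
  exact/mfun_exp/mfun_opp/mfun_norm.
have exp1 (z : T * O) : `|expR (- `|W z.2 + h z.1 + M|)| <= 1.
  by rewrite ger0_norm ?expR_ge0// -[leRHS]expR0 ler_expR oppr_le0.
have -> : \int[m]_x (h x * \int[P]_w expR (- `|W w + h x + M|)) =
    \int[q]_z (h z.1 * expR (- `|W z.2 + h z.1 + M|)).
  rewrite -Fub//; apply: eq_Rintegral => x _; rewrite RintegralZl//.
  apply: (@prob_bounded_integrable _ _ _ P _ 1) => [|w]; last exact: (exp1 (x, w)).
  apply/mfun_exp/mfun_opp/mfun_norm; do 2 apply: measurable_funD => //. exact: (measurable_cst (h x)).
rewrite (@Rintegral_exp_cauchy _ _ _ q (fun z => h z.1))//.
apply: eq_Rintegral => b _; congr (_ / _).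
rewrite -Fub//; last first.
- by move=> z; exact: cos_max.
- exact/mfun_cos/mfun_scale.
have ihc c : m.-integrable setT (EFin \o (fun x => h x * cos (b * h x + c))).
  apply: imul => //; last by move=> x; exact: cos_max.
  by apply: mfun_cos; apply: measurable_funD => //; exact: mfun_scale.
have ihs c : m.-integrable setT (EFin \o (fun x => h x * sin (b * h x + c))).
  apply: imul => //; last by move=> x; exact: sin_max.
  by apply: mfun_sin; apply: measurable_funD => //; exact: mfun_scale.
have ihc0 : m.-integrable setT (EFin \o (fun x => h x * cos (b * h x))).
  by apply: imul => //; [exact/mfun_cos/mfun_scale|move=> x; exact: cos_max].
have ihs0 : m.-integrable setT (EFin \o (fun x => h x * sin (b * h x))).
  by apply: imul => //; [exact/mfun_sin/mfun_scale|move=> x; exact: sin_max].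
have iWc : P.-integrable setT (EFin \o (fun x => W x * cos (b * W x))).
  by apply: imul => //; [exact/mfun_cos/mfun_scale|move=> x; exact: cos_max].
have iWs : P.-integrable setT (EFin \o (fun x => W x * sin (b * W x))).
  by apply: imul => //; [exact/mfun_sin/mfun_scale|move=> x; exact: sin_max].
pose C := \int[P]_w cos (b * W w); pose S := \int[P]_w sin (b * W w).
have [E1 E2] := size_bias_trig b; rewrite -/C -/S in E1 E2.
have -> : \int[P]_w (W w * cos (b * (W w + M))) =
  cos (b * M) * \int[P]_w (W w * cos (b * W w)) - sin (b * M) * \int[P]_w (W w * sin (b * W w)).
  rewrite -!RintegralZl// -RintegralB//; try exact: integrableZlR.
  by apply: eq_Rintegral => w _; rewrite mulrDr cosD; ring.
rewrite E1 E2.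
have -> : \int[m]_x \int[P]_w (h x * cos (b * (W (x, w).2 + h (x, w).1 + M))) =
  \int[m]_x ((C * cos (b * M) - S * sin (b * M)) * (h x * cos (b * h x)) -
             (S * cos (b * M) + C * sin (b * M)) * (h x * sin (b * h x))).
  apply: eq_Rintegral => x _ /=.
  have -> : (fun w => h x * cos (b * (W w + h x + M))) =
    (fun w => (h x * cos (b * h x + b * M)) * cos (b * W w) -
              (h x * sin (b * h x + b * M)) * sin (b * W w)).
    by apply/funext => w; rewrite -addrA mulrDr cosD (mulrDr b (h x) M); ring.
  rewrite RintegralB//; try exact: integrableZlR.
  by rewrite !RintegralZl// -/C -/S cosD sinD; ring.
rewrite RintegralB//; try exact: integrableZlR.
by rewrite !RintegralZl//; ring.
Qed.
End size_bias.
End poisson_cf.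

Section nonneg_laplace.
Context d1 d2 (O : measurableType d1) (T : measurableType d2) (R : realType).
Variables (P : probability O R) (m : {sigma_finite_measure set T -> \bar R}).
Variables (W : O -> R) (h : T -> R).
Hypothesis mW : measurable_fun setT W.
Hypothesis iW : P.-integrable setT (EFin \o W).
Hypothesis ih : m.-integrable setT (EFin \o h).
Hypothesis h0 : forall x, 0 <= h x.
Hypothesis cfW : poisson_cf P m W h.

Lemma expRN_abs_le1 (x : R) : `|expR (- `|x|)| <= 1.
Proof. by rewrite ger0_norm ?expR_ge0// -[leRHS]expR0 ler_expR oppr_le0. Qed.

Let mh : measurable_fun setT h.
Proof. by have /integrableP[/measurable_EFinP] := ih. Qed.

(** The size-bias identity is applied to a function [k] that is null on
    [[0, +oo[] and positive on [`]-oo, 0[]. Then [W k(W) <= 0], whereas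
    [\int h E k(W + h) dm >= 0]; so [W k(W)] has null mean, hence is null almost
    surely. *)
Lemma poisson_cf_ge0 : {ae P, forall w, 0 <= W w}.
Proof.
(* a combination of the functions of [size_bias_exp] at [M = 1] and [M = 0] *)
pose k x := expR 1 * expR (- `|x + 1|) - expR (- `|x|) : R.
have k_ge0 x : 0 <= x -> k x = 0.
  move=> x0; rewrite /k ger0_norm ?addr_ge0// ger0_norm// -expRD.
  by rewrite opprD addrCA subrr addr0 subrr.
have k_lt0 x : x < 0 -> 0 < k x.
  move=> x0; rewrite subr_gt0 -expRD ltr_expR ltr0_norm// opprK.
  rewrite -ltrBlDl ltrNr opprB ltr_norml; apply/andP; split; lra.
have mexp (f : O -> R) : measurable_fun setT f ->
    measurable_fun setT (fun w => expR (- `|f w|)).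
  by move=> mf; exact/mfun_exp/mfun_opp/mfun_norm.
have iWe (c : R) : P.-integrable setT (EFin \o (fun w => W w * expR (- `|W w + c|))).
  apply: (@integrable_le _ _ _ P setT _ (fun w => `|W w|)) => //.
  - by apply: measurable_funM => //; apply: mexp; exact: measurable_funD.
  - exact: integrable_norm.
  - by move=> w _; rewrite normrM ler_piMr// expRN_abs_le1.
have ie (x : T) c : P.-integrable setT (EFin \o (fun w => expR (- `|W w + h x + c|))).
  apply: (@prob_bounded_integrable _ _ _ _ _ 1) => [|w]; last exact: expRN_abs_le1.
  by apply: mexp; do 2 apply: measurable_funD => //.
have mE c : measurable_fun setT (fun x => \int[P]_w expR (- `|W w + h x + c|)).
  have mV : measurable_fun setT (fun z : T * O => (expR (- `|W z.2 + h z.1 + c|))%:E).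
    apply/measurable_EFinP/mfun_exp/mfun_opp/mfun_norm.
    by apply: measurable_funD => //; apply: measurable_funD; exact: measurableT_comp.
  have V0 (z : T * O) : (0 <= (expR (- `|W z.2 + h z.1 + c|))%:E)%E.
    by rewrite lee_fin expR_ge0.
  have H := @measurable_fun_fubini_tonelli_F _ _ _ _ _ P _ mV V0.
  have H2 : measurable_fun setT (fine \o fubini_F P (fun z : T * O => (expR (- `|W z.2 + h z.1 + c|))%:E)).
    exact: measurableT_comp.
  exact: H2.
have ihe c : m.-integrable setT (EFin \o (fun x => h x * \int[P]_w expR (- `|W w + h x + c|))).
  apply: (@integrable_le _ _ _ m setT _ (fun w => `|h w|)) => //.
  - exact: measurable_funM.
  - exact: integrable_norm.
  - move=> x _; rewrite normrM ler_piMr// (le_trans (le_normr_Rintegral _ (ie x c)))//.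
    have -> : 1 = \int[P]_w (1 : R) by rewrite Rintegral_cst// mul1r (congr1 fine (probability_setT P)).
    apply: le_Rintegral => //.
    + exact: integrable_norm.
    + exact: finite_measure_integrable_cst.
    + by move=> w _; rewrite expRN_abs_le1.
have E1 : \int[P]_w (W w * k (W w)) = \int[m]_x (h x * \int[P]_w k (W w + h x)).
  have -> : \int[P]_w (W w * k (W w)) = expR 1 * \int[P]_w (W w * expR (- `|W w + 1|)) -
      \int[P]_w (W w * expR (- `|W w + 0|)).
    rewrite -RintegralZl// -RintegralB//; last exact: integrableZlR.
    by apply: eq_Rintegral => w _; rewrite /k addr0; ring.
  rewrite !(size_bias_exp mW iW ih cfW) -RintegralZl// -RintegralB//; last exact: integrableZlR.
  apply: eq_Rintegral => x _; rewrite mulrCA -mulrBr; congr (_ * _).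
  rewrite -RintegralZl// -RintegralB//; last exact: integrableZlR.
  by apply: eq_Rintegral => w _; rewrite /k addr0.
have kW w : 0 <= - (W w * k (W w)).
  have [Wn|Wp] := ltP (W w) 0; last by rewrite k_ge0// mulr0 oppr0.
  by rewrite -mulNr mulr_ge0// ?oppr_ge0 ltW// k_lt0.
have iWk : P.-integrable setT (EFin \o (fun w => - (W w * k (W w)))).
  have := integrableBR measurableT (iWe 0) (integrableZlR (expR 1) measurableT (iWe 1)).
  by apply: eq_integrable => // w _ /=; rewrite /k addr0; congr (_%:E); ring.
have : {ae P, forall w, - (W w * k (W w)) = 0}.
  apply: Rintegral0_ae => //; apply/eqP; rewrite eq_le Rintegral_ge0// andbT.
  have -> : \int[P]_w - (W w * k (W w)) = - \int[P]_w (W w * k (W w)).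
    rewrite -[RHS]mulN1r -RintegralZl//; first by apply: eq_Rintegral => w _; rewrite mulN1r.
    have := integrableZlR (-1) measurableT iWk.
    by apply: eq_integrable => // w _ /=; rewrite mulN1r opprK.
  rewrite oppr_le0 E1; apply: Rintegral_ge0 => x _; rewrite mulr_ge0//.
  apply: Rintegral_ge0 => w _.
  have [Wn|Wp] := ltP (W w + h x) 0; last by rewrite k_ge0.
  by rewrite ltW// k_lt0.
apply: filterS => w /eqP; rewrite oppr_eq0 mulf_eq0 => /orP[/eqP ->//|/eqP kw].
by rewrite leNgt; apply/negP => /k_lt0; rewrite kw ltxx.
Qed.
End nonneg_laplace.

Section laplace.
Context d1 d2 (O : measurableType d1) (T : measurableType d2) (R : realType).
Variables (P : probability O R) (m : {sigma_finite_measure set T -> \bar R}).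
Variables (W : O -> R) (h : T -> R).
Hypothesis mW : measurable_fun setT W.
Hypothesis iW : P.-integrable setT (EFin \o W).
Hypothesis ih : m.-integrable setT (EFin \o h).
Hypothesis h0 : forall x, 0 <= h x.
Hypothesis cfW : poisson_cf P m W h.

Let mh : measurable_fun setT h.
Proof. by have /integrableP[/measurable_EFinP] := ih. Qed.

(** The size-bias identity for [s W] and [k x = expR (- `|x|)]; by nonnegativity
    of [W] and [h] the exponential [k (s W + s h)] factorises. *)
Let size_bias_laplace s : 0 < s ->
  \int[P]_w (`|W w| * expR (- (s * `|W w|))) =
  (\int[m]_x (h x * expR (- (s * h x)))) * \int[P]_w expR (- (s * `|W w|)).
Proof.
move=> s0.
have Wge0 := poisson_cf_ge0 mW iW ih h0 cfW.
have := size_bias_exp (mfun_scale s mW) (integrableZlR s measurableT iW)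
  (integrableZlR s measurableT ih) (poisson_cf_scale s cfW) 0.
have mexp (f : O -> R) : measurable_fun setT f ->
    measurable_fun setT (fun w => expR (- `|f w|)).
  by move=> mf; exact/mfun_exp/mfun_opp/mfun_norm.
have mnW : measurable_fun setT (fun w => `|W w|) by exact: mfun_norm.
have mexpW : measurable_fun setT (fun w => expR (- (s * `|W w|))).
  exact/mfun_exp/mfun_opp/mfun_scale.
have -> : \int[P]_w (s * W w * expR (- `|s * W w + 0|)) =
    s * \int[P]_w (`|W w| * expR (- (s * `|W w|))).
  rewrite -RintegralZl//; last first.
    apply: (@integrable_le _ _ _ P setT _ (fun w => `|W w|)) => //.
    - exact: measurable_funM.
    - exact: integrable_norm.
    - move=> w _; rewrite normrM normr_id ler_piMr//.
      by rewrite ger0_norm ?expR_ge0// -[leRHS]expR0 ler_expR oppr_le0 mulr_ge0// ltW.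
  apply: ae_eq_Rintegral.
  - apply: measurable_funM; first exact: mfun_scale.
    by apply: mexp; apply: measurable_funD => //; exact: mfun_scale.
  - by apply: mfun_scale; exact: measurable_funM.
  - apply: filterS Wge0 => w w0.
    by rewrite addr0 normrM (gtr0_norm s0) ger0_norm// mulrA.
have -> : \int[m]_x (s * h x * \int[P]_w expR (- `|s * W w + s * h x + 0|)) =
   s * ((\int[m]_x (h x * expR (- (s * h x)))) * \int[P]_w expR (- (s * `|W w|))).
  have ihe : m.-integrable setT (EFin \o (fun x => h x * expR (- (s * h x)))).
    apply: (@integrable_le _ _ _ m setT _ (fun w => `|h w|)) => //.
    - by apply: measurable_funM => //; exact/mfun_exp/mfun_opp/mfun_scale.
    - exact: integrable_norm.
    - move=> w _; rewrite normrM ler_piMr//.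
      by rewrite ger0_norm ?expR_ge0// -[leRHS]expR0 ler_expR oppr_le0 mulr_ge0// ltW.
  set E := \int[P]_w expR (- (s * `|W w|)).
  rewrite [RHS]mulrCA [RHS]mulrC -[RHS]RintegralZl//.
  apply: eq_Rintegral => x _.
  rewrite (_ : s * E * _ = s * h x * (expR (- (s * h x)) * E)); last by ring.
  congr (_ * _); rewrite /E.
  rewrite -RintegralZl//; last first.
    apply: (@prob_bounded_integrable _ _ _ _ _ 1) => // w.
    by rewrite ger0_norm ?expR_ge0// -[leRHS]expR0 ler_expR oppr_le0 mulr_ge0// ltW.
  apply: ae_eq_Rintegral.
  - apply: mexp; do 2 apply: measurable_funD => //; exact: mfun_scale.
  - exact: mfun_scale.
  - apply: filterS Wge0 => w w0.
    rewrite addr0 -expRD (ger0_norm w0) ger0_norm; first by congr expR; ring.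
    by rewrite addr_ge0// mulr_ge0// ltW.
by move/(mulfI (lt0r_neq0 s0)).
Qed.

(** The mean [L] of [expR (- s W)] solves [L' = - (\int h expR (- s h) dm) L] by
    the size-bias identity, and so does the right-hand side; both are 1 at
    [s = 0]. *)
Lemma poisson_cf_laplace :
  \int[P]_w expR (- W w) = expR (- \int[m]_x (1 - expR (- h x))).
Proof.
have Wge0 := poisson_cf_ge0 mW iW ih h0 cfW.
have mnW : measurable_fun setT (fun w => `|W w|) by exact: mfun_norm.
(* [s = r * r], so that the derivative at 0 is two-sided *)
pose L r := \int[P]_w expR (- (r * r * `|W w|)).
pose K r := \int[m]_x (1 - expR (- (r * r * h x))).
have mexpW s : measurable_fun setT (fun w => expR (- (s * `|W w|))).
  exact/mfun_exp/mfun_opp/mfun_scale.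
have mexph s : measurable_fun setT (fun w => expR (- (s * h w))).
  exact/mfun_exp/mfun_opp/mfun_scale.
have dexp (c r : R) : is_derive r (1 : R) (fun r => expR (- (r * r * c)))
    (- (2 * r * c * expR (- (r * r * c)))).
  have dq : is_derive r (1 : R) (fun r => - (r * r * c)) (- (2 * r * c)).
    apply: is_derive_eq (isd_opp (isd_mul (isd_mul (isd_id r) (isd_id r)) (isd_cst c r))) _.
    by ring.
  apply: is_derive_eq (@isd_comp _ expR _ _ _ _ (is_derive_expR _) dq) _.
  by ring.
have le1 (r c : R) : 0 <= c -> `|expR (- (r * r * c))| <= 1.
  move=> c0; rewrite ger0_norm ?expR_ge0// -[leRHS]expR0 ler_expR oppr_le0.
  by rewrite mulr_ge0// -expr2 sqr_ge0.
have bnd (a r c : R) : 0 <= c -> a - 1 < r < a + 1 ->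
   `|2 * r * c * expR (- (r * r * c))| <= 2 * (`|a| + 1) * c.
  move=> c0 /andP[ar ra]; rewrite normrM (le_trans (ler_piMr _ (le1 _ _ c0)))//.
  rewrite normrM (ger0_norm c0) ler_wpM2r// normrM ger0_norm// ler_wpM2l//.
  rewrite ler_norml; apply/andP; split.
    by have := ler_norm (- a); rewrite normrN; lra.
  by have := ler_norm a; lra.
have btw (a : R) : a - 1 < a < a + 1 by rewrite ltrBlDr !ltrDl ltr01.
have dL a : is_derive a (1 : R) L (\int[P]_w - (2 * a * `|W w| * expR (- (a * a * `|W w|)))).
  apply: (@is_derive_Rintegral _ _ _ P (fun r w => expR (- (r * r * `|W w|)))
    (fun r w => - (2 * r * `|W w| * expR (- (r * r * `|W w|))))
    (fun w => 2 * (`|a| + 1) * `|W w|) _ _ _ (btw a)) => //.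
  - move=> r; apply: (@prob_bounded_integrable _ _ _ _ _ 1) => // w; exact: le1.
  - by apply: integrableZlR => //; exact: integrable_norm.
  - by move=> r w rab; rewrite normrN bnd.
have dK a : is_derive a (1 : R) K (\int[m]_x (2 * a * h x * expR (- (a * a * h x)))).
  apply: (@is_derive_Rintegral _ _ _ m (fun r x => 1 - expR (- (r * r * h x)))
    (fun r x => 2 * r * h x * expR (- (r * r * h x)))
    (fun x => 2 * (`|a| + 1) * h x) _ _ _ (btw a)) => //.
  - move=> r; apply: (@integrable_le _ _ _ m setT _ (fun x => (r * r) * h x)) => //.
    + exact: measurable_funB.
    + exact: integrableZlR.
    + move=> x _; rewrite ger0_norm; last first.
        by rewrite subr_ge0 (le_trans (ler_norm _))// le1.
      by have := expR_ge1Dx (- (r * r * h x)); lra.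
  - move=> r x; apply: is_derive_eq (isd_add (isd_cst _ r) (isd_opp (dexp (h x) r))) _.
    by rewrite add0r opprK.
  - by move=> x; rewrite !mulr_ge0 ?addr_ge0.
  - exact: integrableZlR.
  - by move=> r x rab; exact: bnd.
have dE r : is_derive r (1 : R) (fun r => L r * expR (K r)) 0.
  apply: is_derive_eq (isd_mul (dL r) (@isd_comp _ expR K _ _ _ (is_derive_expR _) (dK r))) _.
  have [->|r0] := eqVneq r 0.
    under eq_Rintegral do rewrite mulr0 !mul0r oppr0.
    under [X in _ * (_ * X)]eq_Rintegral do rewrite mulr0 !mul0r.
    by rewrite !Rintegral_cst// !mul0r !mulr0 addr0.
  have rr0 : 0 < r * r by rewrite -expr2 exprn_even_gt0.
  have -> : \int[P]_w - (2 * r * `|W w| * expR (- (r * r * `|W w|))) =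
      - (2 * r) * \int[P]_w (`|W w| * expR (- (r * r * `|W w|))).
    rewrite -RintegralZl//; first by apply: eq_Rintegral => w _; ring.
    apply: (@integrable_le _ _ _ P setT _ (fun w => `|W w|)) => //.
    - exact: measurable_funM.
    - exact: integrable_norm.
    - by move=> w _; rewrite normrM normr_id ler_piMr// le1.
  have -> : \int[m]_x (2 * r * h x * expR (- (r * r * h x))) =
      2 * r * \int[m]_x (h x * expR (- (r * r * h x))).
    rewrite -RintegralZl//; first by apply: eq_Rintegral => w _; ring.
    apply: (@integrable_le _ _ _ m setT _ (fun w => `|h w|)) => //.
    - exact: measurable_funM.
    - exact: integrable_norm.
    - by move=> w _; rewrite normrM ler_piMr// le1.
  by rewrite (size_bias_laplace rr0) -/(L r); ring.
have := @is_derive_0_is_cst _ _ 1 0 dE.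
have -> : L 0 = 1.
  rewrite /L; under eq_Rintegral do rewrite !mul0r oppr0 expR0.
  by rewrite Rintegral_cst// mul1r (congr1 fine (probability_setT P)).
have -> : K 0 = 0.
  rewrite /K; under eq_Rintegral do rewrite !mul0r oppr0 expR0 subrr.
  by rewrite Rintegral_cst// mul0r.
rewrite expR0 mulr1 expRN.
have -> : K 1 = \int[m]_x (1 - expR (- h x)).
  by apply: eq_Rintegral => x _; rewrite !mul1r.
have -> : L 1 = \int[P]_w expR (- W w).
  apply: ae_eq_Rintegral => //; first exact/mfun_exp/mfun_opp.
  by apply: filterS Wge0 => w w0; rewrite !mul1r ger0_norm.
by move=> E; apply: (mulIf (lt0r_neq0 (expR_gt0 (\int[m]_x (1 - expR (- h x)))))); rewrite E mulVf// gt_eqF// expR_gt0.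
Qed.
End laplace.

(** * The noise tested against smooth functions *)
Section plane.
Variable R : realType.
Notation mR := (measurableTypeR R).

(** The plane carries the product sigma-algebra: an open set has to be
    written as a countable union of boxes, here with rational corners. *)
Lemma open_measurable_plane (A : set (R * R)) : open A ->
  measurable (A : set (mR * mR)).
Proof.
move=> oA.
pose box (i : (rat * rat) * (rat * rat)) : set (mR * mR) :=
  `]ratr i.1.1, ratr i.1.2[%classic `*` `]ratr i.2.1, ratr i.2.2[%classic.
pose F i := if `[< box i `<=` A >] then box i else set0.
have -> : A = \bigcup_i F i.
  apply/seteqP; split => [[x y] Axy|p [i _]]; last first.
    by rewrite /F; case: ifPn => // /asboolP h /h.
  have /nbhs_ballP[e /= e0 eA] := open_nbhs_nbhs (conj oA Axy).
  have rat_between (a b : R) : a < b -> exists q : rat, a < ratr q < b.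
    by move=> ab; have [q] := rat_in_itvoo ab; rewrite in_itv/= => ?; exists q.
  have [a1 /andP[a1x xa1]] := rat_between (x - e) x ltac:(by rewrite ltrBlDr ltrDl).
  have [a2 /andP[a2x xa2]] := rat_between x (x + e) ltac:(by rewrite ltrDl).
  have [b1 /andP[b1x xb1]] := rat_between (y - e) y ltac:(by rewrite ltrBlDr ltrDl).
  have [b2 /andP[b2x xb2]] := rat_between y (y + e) ltac:(by rewrite ltrDl).
  exists ((a1, a2), (b1, b2)) => //; rewrite /F ifT.
    by split; rewrite /= in_itv/=; apply/andP.
  apply/asboolP => -[x' y'] []; rewrite /= !in_itv/= => /andP[? ?] /andP[? ?].
  by apply: eA; split; rewrite /= /ball/= ltr_norml; apply/andP; split; lra.
apply: countable_bigcupT_measurable => [|i]; first exact: countableP.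
rewrite /F; case: ifP => _ //.
by apply: measurableX; exact: measurable_itv.
Qed.

Lemma continuous_measurable_plane (f : R * R -> R) : continuous f ->
  measurable_fun setT (f : mR * mR -> R).
Proof.
move=> /continuousP cf; apply: (measurability _ (RGenOpens.measurableE R)).
move=> _ [_ [a [b ->] <-]]; rewrite setTI.
by apply: open_measurable_plane; apply: cf; exact: interval_open.
Qed.

Lemma test_fun_continuous (u : test_space R) : continuous (u : R * R -> R^o).
Proof.
have /asboolP[su _] := test_funP u.
by have [] := su [::].
Qed.

Lemma test_fun_measurable (u : test_space R) :
  measurable_fun setT (u : mR * mR -> R).
Proof. by apply: continuous_measurable_plane; exact: test_fun_continuous. Qed.

Lemma pairing_measurable (u : test_space R) :
  measurable_fun setT (fun w : dual_space R => pairing w u).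
Proof.
move=> _ B mB; rewrite setTI.
by apply: sub_sigma_algebra; exists u, B.
Qed.

Lemma pairing_lin (w : dual_space R) (a : R) (u v : test_space R) :
  pairing w (a *: u + v) = a * pairing w u + pairing w v.
Proof. by rewrite /pairing linearP. Qed.

Lemma test_fun_lin (a : R) (u v : test_space R) (p : R * R) :
  (a *: u + v) p = a * u p + v p.
Proof. by []. Qed.

End plane.

Section exponent.
Variable R : realType.
Notation mR := (measurableTypeR R).
Variable sg : {measure set mR -> \bar R}.
Local Notation D0 := (`]0, +oo[%classic : set mR).
Hypothesis sg2 : (\int[sg]_(tau in `]0%R, +oo[) (tau ^+ 2)%:E < +oo)%E.

(** The real and imaginary parts of the exponent
    [\int (e^{i tau v} - 1 - i tau v) sigma(d tau)], and its second moment. *)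
Definition levy_cos (v : R) := \int[sg]_(tau in `]0, +oo[) (cos (tau * v) - 1).
Definition levy_sin (v : R) := \int[sg]_(tau in `]0, +oo[) (sin (tau * v) - tau * v).
Definition levy_var := \int[sg]_(tau in `]0, +oo[) (tau ^+ 2).

Lemma integrable_tau2 : sg.-integrable D0 (EFin \o (fun tau => tau ^+ 2)).
Proof.
apply/integrableP; split.
  by apply/measurable_EFinP; apply: measurable_funX.
by under eq_integral do rewrite /= ger0_norm ?sqr_ge0//.
Qed.

Lemma levy_var_ge0 : 0 <= levy_var.
Proof. by apply: Rintegral_ge0 => x _; rewrite sqr_ge0. Qed.

Let mD0 : measurable D0. Proof. exact: measurable_itv. Qed.

Let mcosv v : measurable_fun D0 (fun tau : mR => cos (tau * v) - 1).
Proof.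
apply: measurable_funTS; apply: measurable_funB => //.
by apply: mfun_cos; exact: mulrr_measurable.
Qed.

Let msinv v : measurable_fun D0 (fun tau : mR => sin (tau * v) - tau * v).
Proof.
apply: measurable_funTS; apply: measurable_funB; last exact: mulrr_measurable.
by apply: mfun_sin; exact: mulrr_measurable.
Qed.

Lemma integrable_levy_cos v :
  sg.-integrable D0 (EFin \o (fun tau => cos (tau * v) - 1)).
Proof.
apply: (@integrable_le _ _ _ sg D0 _ (fun tau => v ^+ 2 * tau ^+ 2)) => //.
  by apply: integrableZlR => //; exact: integrable_tau2.
move=> tau _; have := cos_sub_le2 (tau * v) 0.
rewrite cos0 subr0 normr0 addr0 => /le_trans; apply.
by rewrite -normrM -expr2 ger0_norm ?sqr_ge0// exprMn mulrC.
Qed.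

Lemma integrable_levy_sin v :
  sg.-integrable D0 (EFin \o (fun tau => sin (tau * v) - tau * v)).
Proof.
apply: (@integrable_le _ _ _ sg D0 _ (fun tau => v ^+ 2 * tau ^+ 2)) => //.
  by apply: integrableZlR => //; exact: integrable_tau2.
move=> tau _; have := sinN_sub_le2 (tau * v) 0.
rewrite sin0 !subr0 normr0 addr0 => /le_trans; apply.
by rewrite -normrM -expr2 ger0_norm ?sqr_ge0// exprMn mulrC.
Qed.

Let lip (f : R -> R -> R) :
  (forall v, sg.-integrable D0 (EFin \o (f v))) ->
  (forall a b tau, `|f a tau - f b tau| <= `|tau * a - tau * b| * (`|tau * a| + `|tau * b|)) ->
  forall a b, `|(\int[sg]_(tau in `]0, +oo[) f a tau) - \int[sg]_(tau in `]0, +oo[) f b tau| <=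
    levy_var * (`|a - b| * (`|a| + `|b|)).
Proof.
move=> intf flip a b; rewrite -RintegralB//.
rewrite (le_trans (le_normr_Rintegral _ _))//; first exact: integrableBR.
rewrite mulrC -RintegralZl//; last exact: integrable_tau2.
apply: le_Rintegral => //.
- apply: integrable_norm; exact: integrableBR.
- by apply: integrableZlR => //; exact: integrable_tau2.
- move=> tau _; rewrite (le_trans (flip a b tau))//.
  by rewrite -mulrBr !normrM -mulrDr mulrACA -normrM -expr2 ger0_norm ?sqr_ge0// mulrC.
Qed.

(** Both parts of the exponent are locally Lipschitz with a constant that grows
    linearly, because the second derivatives in [v] of the integrands are
    bounded by [tau ^+ 2]. This yields continuity, quadratic growth, and stability of
    the integral over the plane under convergence of kernels in L2. *)
Lemma levy_cos_lip a b :
  `|levy_cos a - levy_cos b| <= levy_var * (`|a - b| * (`|a| + `|b|)).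
Proof.
apply: (@lip (fun v tau => cos (tau * v) - 1)) => [v|x y tau].
  exact: integrable_levy_cos.
rewrite opprD opprK addrACA (addrC (-1)) subrr addr0; exact: cos_sub_le2.
Qed.

Lemma levy_sin_lip a b :
  `|levy_sin a - levy_sin b| <= levy_var * (`|a - b| * (`|a| + `|b|)).
Proof.
apply: (@lip (fun v tau => sin (tau * v) - tau * v)) => [v|x y tau];
  [exact: integrable_levy_sin|exact: sinN_sub_le2].
Qed.

Lemma levy_cos0 : levy_cos 0 = 0.
Proof.
rewrite /levy_cos; under eq_Rintegral do rewrite mulr0 cos0 subrr.
by rewrite Rintegral_cst// mul0r.
Qed.

Lemma levy_sin0 : levy_sin 0 = 0.
Proof.
rewrite /levy_sin; under eq_Rintegral do rewrite mulr0 sin0 subrr.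
by rewrite Rintegral_cst// mul0r.
Qed.

Lemma levy_cos_le a : `|levy_cos a| <= levy_var * a ^+ 2.
Proof.
have := levy_cos_lip a 0; rewrite levy_cos0 !subr0 normr0 addr0 -normrM.
by rewrite -expr2 (ger0_norm (sqr_ge0 _)).
Qed.

Lemma levy_sin_le a : `|levy_sin a| <= levy_var * a ^+ 2.
Proof.
have := levy_sin_lip a 0; rewrite levy_sin0 !subr0 normr0 addr0 -normrM.
by rewrite -expr2 (ger0_norm (sqr_ge0 _)).
Qed.

Lemma levy_cos_le0 a : levy_cos a <= 0.
Proof.
have -> : 0 = \int[sg]_(tau in `]0, +oo[) (0 : R) by rewrite Rintegral_cst// mul0r.
apply: le_Rintegral => //.
- exact: integrable_levy_cos.
- apply: (@integrable_le _ _ _ sg D0 _ (fun tau => tau ^+ 2)) => //.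
    exact: integrable_tau2.
  by move=> tau _; rewrite normr0 sqr_ge0.
Qed.

Let cont_lip (g : R -> R) :
  (forall a b, `|g a - g b| <= levy_var * (`|a - b| * (`|a| + `|b|))) -> continuous g.
Proof.
move=> gl a; apply/subr_cvg0/norm_cvg0P.
have h : levy_var * (`|x - a| * (`|x| + `|a|)) @[x --> a] --> levy_var * (`|a - a| * (`|a| + `|a|)).
  apply: cvgM; first exact: cvg_cst.
  apply: cvgM; first by apply: cvg_norm; apply: cvgB; [exact: cvg_id|exact: cvg_cst].
  by apply: cvgD; [apply: cvg_norm; exact: cvg_id|exact: cvg_cst].
rewrite subrr normr0 mul0r mulr0 in h.
apply: (@squeeze_cvgr _ _ _ _ (cst 0) _ _ _ _ _ h); last exact: cvg_cst.
by apply: nearW => x /=; rewrite normr_ge0 gl.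
Qed.

Lemma levy_cos_measurable : measurable_fun setT levy_cos.
Proof. by apply: continuous_measurable_fun; apply: cont_lip; exact: levy_cos_lip. Qed.

Lemma levy_sin_measurable : measurable_fun setT levy_sin.
Proof. by apply: continuous_measurable_fun; apply: cont_lip; exact: levy_sin_lip. Qed.

Variable nu : probability (dual_space R) R.
Hypothesis nu_levy : is_levy_noise sg nu.

Lemma pairing_cf (u : test_space R) :
  \int[nu]_w cos (pairing w u) =
    expR (\int[@lebesgue2 R]_p levy_cos (u p)) * cos (\int[@lebesgue2 R]_p levy_sin (u p)) /\
  \int[nu]_w sin (pairing w u) =
    expR (\int[@lebesgue2 R]_p levy_cos (u p)) * sin (\int[@lebesgue2 R]_p levy_sin (u p)).
Proof.
have := nu_levy u.
have cE (x : R) : cexp ('i * x%:C)%C = (cos x +i* sin x)%C.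
  by rewrite /cexp /= !mul0r !mul1r subrr add0r expR0; exact: mul1r.
have reE (x : R) : complex.Re (cexp ('i * x%:C) - 1 - 'i * x%:C)%C = cos x - 1.
  by rewrite cE /= !mul0r mul1r subr0 oppr0 addr0.
have imE (x : R) : complex.Im (cexp ('i * x%:C) - 1 - 'i * x%:C)%C = sin x - x.
  by rewrite cE /= !mul0r mul1r subr0 add0r.
have -> : levy_exponent sg u = ((\int[@lebesgue2 R]_p levy_cos (u p)) +i*
    (\int[@lebesgue2 R]_p levy_sin (u p)))%C.
  rewrite /levy_exponent /Cintegral /=; congr (_ +i* _)%C.
    by apply: eq_Rintegral => p _; apply: eq_Rintegral => tau _; exact: reE.
  by apply: eq_Rintegral => p _; apply: eq_Rintegral => tau _; exact: imE.
rewrite /Cintegral; under [X in (X +i* _)%C]eq_Rintegral do rewrite cE /=.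
under [X in (_ +i* X)%C]eq_Rintegral do rewrite cE /=.
rewrite /cexp /= => -[].
by rewrite !mul0r subr0 addr0.
Qed.
End exponent.

Section one_minus_cos.
Variable R : realType.

(** With [cos x = 1 - 2 sin^2 (x / 2)], this needs the lower bound [3 / 4 * `|y|]
    for the sine at [`|y| <= 1 / 2], which follows from [cos >= 3 / 4] there. *)
Lemma one_minus_cos_ge (x : R) : `|x| <= 1 -> x ^+ 2 / 4 <= 1 - cos x.
Proof.
move=> x1; pose y := x / 2.
have -> : x = y + y by rewrite /y -splitr.
have [c cy] := @MVT_abs R sin cos 0 y (fun x => is_derive_sin x).
rewrite sin0 !subr0 => sE; rewrite normr0 in cy.
have y2 : `|y| <= 2^-1 by rewrite /y normrM [X in _ * X]ger0_norm// ler_piMl.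
have c2 : `|c| <= 2^-1.
  by rewrite (le_trans cy)// ge_max y2 invr_ge0 ler0n.
have cc : 3 / 4 <= cos c.
  have := cos_sub_le2 c 0; rewrite cos0 subr0 normr0 addr0.
  have cq : `|c| * `|c| <= 2^-1 * 2^-1 by exact: ler_pM.
  move=> /le_trans/(_ cq); rewrite ler_norml => /andP[+ _]; lra.
rewrite cosD -!expr2 cos2sin2 sE exprMn.
have : (3 / 4) ^+ 2 * y ^+ 2 <= cos c ^+ 2 * y ^+ 2.
  by rewrite ler_wpM2r ?sqr_ge0// lerXn2r// ?nnegrE ?(le_trans _ cc)//; lra.
have := sqr_ge0 y; lra.
Qed.
End one_minus_cos.

Section second_moment.
Variable R : realType.
Notation mR := (measurableTypeR R).
Notation leb2 := (@lebesgue2 R).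
Variable sg : {measure set mR -> \bar R}.
Hypothesis sg2 : (\int[sg]_(tau in `]0%R, +oo[) (tau ^+ 2)%:E < +oo)%E.
Variable nu : probability (dual_space R) R.
Hypothesis nu_levy : is_levy_noise sg nu.

Notation C := (levy_var sg).

Lemma integrable_levy_cos_comp (f : mR * mR -> R) : measurable_fun setT f ->
  leb2.-integrable setT (EFin \o (fun p => f p ^+ 2)) ->
  leb2.-integrable setT (EFin \o (fun p => levy_cos sg (f p))).
Proof.
move=> mf if2; apply: (@integrable_le _ _ _ leb2 setT _ (fun p => C * f p ^+ 2)) => //.
- exact: measurableT_comp (levy_cos_measurable sg2) mf.
- exact: integrableZlR.
- by move=> p _; exact: levy_cos_le.
Qed.

Lemma integrable_levy_sin_comp (f : mR * mR -> R) : measurable_fun setT f ->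
  leb2.-integrable setT (EFin \o (fun p => f p ^+ 2)) ->
  leb2.-integrable setT (EFin \o (fun p => levy_sin sg (f p))).
Proof.
move=> mf if2; apply: (@integrable_le _ _ _ leb2 setT _ (fun p => C * f p ^+ 2)) => //.
- exact: measurableT_comp (levy_sin_measurable sg2) mf.
- exact: integrableZlR.
- by move=> p _; exact: levy_sin_le.
Qed.

(** The characteristic function at [a] differs from 1 by [O(a ^+ 2)] since both
    parts of its exponent do. *)
Lemma pairing_one_minus_cos (u : test_space R) (a : R) :
  leb2.-integrable setT (EFin \o (fun p => u p ^+ 2)) ->
  \int[nu]_w (1 - cos (a * pairing w u)) <= 2 * C * a ^+ 2 * \int[leb2]_p (u p ^+ 2).
Proof.
move=> iu; have mu := test_fun_measurable u.
have mau : measurable_fun setT (fun p : mR * mR => a * u p) by exact: mfun_scale.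
have iau : leb2.-integrable setT (EFin \o (fun p => (a * u p) ^+ 2)).
  have := integrableZlR (a ^+ 2) measurableT iu.
  by apply: eq_integrable => // p _ /=; rewrite exprMn.
have [cfE _] := pairing_cf nu_levy (a *: u).
have pE w : pairing w (a *: u) = a * pairing w u.
  by have := pairing_lin w a u 0; rewrite addr0 => ->; rewrite /pairing linear0 addr0.
have tE (p : R * R) : (a *: u) p = a * u p by [].
have eE : (fun w => cos (pairing w (a *: u))) = (fun w => cos (a * pairing w u)).
  by apply/funext => w; rewrite pE.
rewrite eE in cfE.
rewrite RintegralB//; last first.
- apply: (@prob_bounded_integrable _ _ _ nu _ 1) => [|w]; last exact: cos_max.
  by apply: mfun_cos; apply: mfun_scale; exact: pairing_measurable.
- exact: finite_measure_integrable_cst.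
rewrite cfE Rintegral_cst// mul1r (congr1 fine (probability_setT nu)) /=.
have bnd (g : R -> R) : leb2.-integrable setT (EFin \o (fun p => g (a * u p))) ->
    (forall v, `|g v| <= C * v ^+ 2) ->
    `|\int[leb2]_p g (a * u p)| <= C * a ^+ 2 * \int[leb2]_p (u p ^+ 2).
  move=> ig gC; rewrite (le_trans (le_normr_Rintegral _ ig))// -RintegralZl//.
  apply: le_Rintegral => //.
  - exact: integrable_norm.
  - exact: integrableZlR.
  - by move=> p _; rewrite -mulrA -exprMn.
have bA := bnd _ (integrable_levy_cos_comp mau iau) (levy_cos_le sg2).
have bB := bnd _ (integrable_levy_sin_comp mau iau) (levy_sin_le sg2).
set A := (\int[leb2]_p levy_cos sg (a * u p)) in bA *.
set B := (\int[leb2]_p levy_sin sg (a * u p)) in bB *.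
have A0 : A <= 0.
  have -> : 0 = \int[leb2]_p (0 : R) by rewrite Rintegral_cst// mul0r.
  apply: le_Rintegral => //.
  - exact: integrable_levy_cos_comp.
  - apply: (@integrable_le _ _ _ leb2 setT _ (fun p => u p ^+ 2)) => //.
    by move=> p _; rewrite normr0 sqr_ge0.
  - by move=> p _; exact: levy_cos_le0.
have e1 := expR_ge1Dx A.
have e2 : expR A <= 1 by rewrite -[leRHS]expR0 ler_expR.
have e3 := one_sub_cos_le B.
have e4 : expR A * (1 - cos B) <= `|B|.
  rewrite -[leRHS]mul1r ler_pM ?expR_ge0 ?subr_ge0 ?cos_le1//.
  by rewrite (le_trans (ler_norm _))// distrC.
have -> : 1 - expR A * cos B = (1 - expR A) + expR A * (1 - cos B) by ring.
have e5 : - A <= `|A| by rewrite -normrN ler_norm.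
by move: bA bB; lra.
Qed.

(** A second moment bound from the characteristic function near 0. On the event
    [`|pairing w u| <= n + 1] the square is at most [4 (n + 1)^2] times
    [1 - cos (pairing w u / (n + 1))]; these events exhaust the space and
    monotone convergence applies. *)
Lemma pairing_var (u : test_space R) :
  leb2.-integrable setT (EFin \o (fun p => u p ^+ 2)) ->
  (\int[nu]_w ((pairing w u) ^+ 2)%:E <= (8 * C * \int[leb2]_p (u p ^+ 2))%:E)%E.
Proof.
move=> iu; have mY := pairing_measurable u.
pose S n : set (dual_space R) := [set w | `|pairing w u| <= n.+1%:R].
have mS n : measurable (S n).
  rewrite -[S n]setTI.
  have -> : S n = (fun w => `|pairing w u|) @^-1` `]-oo, n.+1%:R].
    by apply/seteqP; split => w; rewrite /S /= in_itv.
  by apply: (mfun_norm mY) => //; exact: measurable_itv.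
pose f n w := (pairing w u ^+ 2 * \1_(S n) w)%:E.
have mf n : measurable_fun setT (f n).
  apply/measurable_EFinP; apply: measurable_funM; first exact: measurable_funX.
  exact: measurable_indic.
have f0 n w : setT w -> (0 <= f n w)%E by move=> _; rewrite lee_fin mulr_ge0// sqr_ge0.
have ndf w : setT w -> {homo f^~ w : n m / (n <= m)%N >-> (n <= m)%E}.
  move=> _ n m nm; rewrite lee_fin ler_wpM2l ?sqr_ge0// !indicE.
  have [|_] := boolP (w \in S n); last by rewrite ler0n.
  by rewrite inE /S /= => h; rewrite mem_set//= (le_trans h)// ler_nat ltnS.
have flim w : (pairing w u ^+ 2)%:E = limn (f^~ w).
  apply/esym/cvg_lim => //; apply: cvg_EFin; first exact: nearW.
  apply: (@cvg_near_cst _ R); near=> n.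
  rewrite /f /= indicE mem_set ?mulr1//= /S /=.
  near: n; exists (Num.truncn `|pairing w u|) => // n /= h.
  by rewrite ltW// (lt_le_trans (truncnS_gt _))// ler_nat ltnS.
under eq_integral do rewrite flim.
rewrite monotone_convergence//; apply: lime_le.
  apply: ereal_nondecreasing_is_cvgn => n m nm.
  by apply: ge0_le_integral => // w _; [exact: f0|exact: ndf].
apply: nearW => n.
have n0 : (0 : R) < n.+1%:R by rewrite ltr0n.
pose a : R := n.+1%:R^-1.
have i1 : nu.-integrable setT (EFin \o (fun w => 1 - cos (a * pairing w u))).
  apply: (@prob_bounded_integrable _ _ _ nu _ 2) => [|w].
    by apply: measurable_funB => //; exact/mfun_cos/mfun_scale.
  by have := cos_geN1 (a * pairing w u); have := cos_le1 (a * pairing w u); rewrite ler_norml; lra.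
apply: (@le_trans _ _ (\int[nu]_w ((4 * n.+1%:R ^+ 2) * (1 - cos (a * pairing w u)))%:E)%E).
  apply: ge0_le_integral => //.
  - by move=> w _; exact: f0.
  - by apply: (measurable_int nu); apply: integrableZlR.
  - move=> w _; rewrite lee_fin indicE.
    have [|_] := boolP (w \in S n); last first.
      by rewrite mulr0 mulr_ge0// ?mulr_ge0 ?sqr_ge0// subr_ge0 cos_le1.
    rewrite inE /S /= mulr1 => h.
    have : `|a * pairing w u| <= 1.
      by rewrite normrM gtr0_norm ?invr_gt0// mulrC ler_pdivrMr// mul1r.
    move/one_minus_cos_ge => h2.
    have -> : pairing w u ^+ 2 = 4 * n.+1%:R ^+ 2 * ((a * pairing w u) ^+ 2 / 4).
      rewrite /a; move: (n.+1%:R) (lt0r_neq0 n0) => N N0; by field.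
    by rewrite ler_wpM2l// mulr_ge0// sqr_ge0.
have := integrableZlR (4 * n.+1%:R ^+ 2) measurableT i1.
move=> /(integrable_fin_num measurableT)/fineK <-.
rewrite lee_fin -/(Rintegral _ _ _) RintegralZl//.
have := pairing_one_minus_cos a iu.
have k0 : 0 <= 4 * n.+1%:R ^+ 2 :> R by rewrite mulr_ge0// sqr_ge0.
move=> /(ler_wpM2l k0)/le_trans; apply.
rewrite /a le_eqVlt; apply/orP; left; apply/eqP.
by move: (n.+1%:R) (lt0r_neq0 n0) => N N0; field.
Unshelve. all: by end_near. Qed.
End second_moment.

(** * Random variables attached to square-integrable kernels *)
Section square_integrable.
Context d (T : measurableType d) (R : realType).
Variable m : {measure set T -> \bar R}.

Lemma integrable_cst0 (D : set T) : measurable D ->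
  m.-integrable D (EFin \o (fun=> 0 : R)).
Proof.
move=> mD; apply/integrableP; split; first exact: measurable_cst.
by under eq_integral do rewrite /= normr0; rewrite integral0.
Qed.

Lemma integrable_of_integral_le (f : T -> R) (c : R) : measurable_fun setT f ->
  (forall x, 0 <= f x) -> (\int[m]_x (f x)%:E <= c%:E)%E ->
  m.-integrable setT (EFin \o f) /\ \int[m]_x f x <= c.
Proof.
move=> mf f0 fc.
have intf : m.-integrable setT (EFin \o f).
  apply/integrableP; split; first exact/measurable_EFinP.
  under eq_integral do rewrite /= ger0_norm//.
  by rewrite (le_lt_trans fc)// ltry.
split => //; rewrite -lee_fin /Rintegral fineK//; exact: integrable_fin_num.
Qed.

Lemma cvg_L2_sqr_integral (f_ : nat -> T -> R) (f : T -> R) :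
  (forall n, measurable_fun setT (f_ n)) -> measurable_fun setT f ->
  cvg_L2 m f_ f -> forall e, 0 < e -> \forall n \near \oo,
    m.-integrable setT (EFin \o (fun x => (f_ n x - f x) ^+ 2)) /\
    \int[m]_x ((f_ n x - f x) ^+ 2) <= e.
Proof.
move=> mf_ mf ff e e0.
have := ff; rewrite /cvg_L2 => {}ff.
have s0 : 0 < Num.sqrt e by rewrite sqrtr_gt0.
have [n0 _ H] : \forall n \near \oo,
   ('N[m]_2%:E[(fun x => (f_ n x - f x)%:E)] < (Num.sqrt e)%:E)%E.
  have N : nbhs (0 : \bar R)%E [set y | (y < (Num.sqrt e)%:E)%E].
    by apply: open_nbhs_nbhs; split; [exact: open_ereal_lt_ereal|rewrite /= lte_fin].
  exact: (ff _ N).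
exists n0 => // n /H {}H.
apply: integrable_of_integral_le => [||].
- by apply: measurable_funX; exact: measurable_funB.
- by move=> x; exact: sqr_ge0.
- have -> : (\int[m]_x ((f_ n x - f x) ^+ 2)%:E =
      'N[m]_2%:E[(fun x => (f_ n x - f x)%:E)] `^ 2)%E.
    rewrite poweR_Lnorm//; apply: eq_integral => x _ /=.
    by rewrite powR_mulrn// real_normK// num_real.
  have -> : e%:E = ((Num.sqrt e)%:E `^ 2)%E.
    by rewrite poweR_EFin powR_mulrn ?sqrtr_ge0// sqr_sqrtr// ltW.
  apply: gt0_ler_poweR => //; rewrite ?in_itv/= ?leey ?andbT ?lee_fin ?sqrtr_ge0//.
  + exact: Lnorm_ge0.
  + exact: ltW.
Qed.

Lemma integrable_sqr_add (f g : T -> R) : measurable_fun setT f -> measurable_fun setT g ->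
  m.-integrable setT (EFin \o (fun x => f x ^+ 2)) ->
  m.-integrable setT (EFin \o (fun x => g x ^+ 2)) ->
  m.-integrable setT (EFin \o (fun x => (f x + g x) ^+ 2)) /\
  \int[m]_x ((f x + g x) ^+ 2) <= 2 * \int[m]_x (f x ^+ 2) + 2 * \int[m]_x (g x ^+ 2).
Proof.
move=> mf mg if2 ig2.
have i2 : m.-integrable setT (EFin \o (fun x => 2 * f x ^+ 2 + 2 * g x ^+ 2)).
  by apply: integrableDR => //; exact: integrableZlR.
have le2 x : (f x + g x) ^+ 2 <= 2 * f x ^+ 2 + 2 * g x ^+ 2.
  by have := sqr_ge0 (f x - g x); lra.
have i1 : m.-integrable setT (EFin \o (fun x => (f x + g x) ^+ 2)).
  apply: integrable_le i2 _ => //.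
    by apply: measurable_funX; exact: measurable_funD.
  by move=> x _; rewrite ger0_norm ?sqr_ge0.
split => //; rewrite -!RintegralZl// -RintegralD//; try exact: integrableZlR.
exact: le_Rintegral.
Qed.

Lemma integrable_sqr_scale (a : R) (f : T -> R) :
  m.-integrable setT (EFin \o (fun x => f x ^+ 2)) ->
  m.-integrable setT (EFin \o (fun x => (a * f x) ^+ 2)) /\
  \int[m]_x ((a * f x) ^+ 2) = a ^+ 2 * \int[m]_x (f x ^+ 2).
Proof.
move=> if2.
have e : (fun x => (a * f x) ^+ 2) = (fun x => a ^+ 2 * f x ^+ 2).
  by apply/funext => x; rewrite exprMn.
by rewrite e RintegralZl//; split => //; exact: integrableZlR.
Qed.

End square_integrable.

Section prob_L1_L2.
Context d (T : measurableType d) (R : realType).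
Variable P : probability T R.

(** The arithmetic-geometric mean inequality in place of Cauchy-Schwarz;
    optimising over [e] is left to the applications. *)
Lemma L1_of_L2 (f : T -> R) (e : R) : 0 < e -> measurable_fun setT f ->
  P.-integrable setT (EFin \o (fun x => f x ^+ 2)) ->
  P.-integrable setT (EFin \o f) /\
  \int[P]_x `|f x| <= e / 2 + (2 * e)^-1 * \int[P]_x (f x ^+ 2).
Proof.
move=> e0 mf if2.
have i1 : P.-integrable setT (EFin \o (fun=> e / 2)) by exact: finite_measure_integrable_cst.
have i2 : P.-integrable setT (EFin \o (fun x => e / 2 + (2 * e)^-1 * f x ^+ 2)).
  by apply: integrableDR => //; exact: integrableZlR.
have le2 x : `|f x| <= e / 2 + (2 * e)^-1 * f x ^+ 2.
  have -> : f x ^+ 2 = `|f x| ^+ 2 by rewrite real_normK// num_real.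
  rewrite -subr_ge0.
  have -> : e / 2 + (2 * e)^-1 * `|f x| ^+ 2 - `|f x| = (2 * e)^-1 * (`|f x| - e) ^+ 2.
    by field; rewrite gt_eqF.
  by rewrite mulr_ge0 ?sqr_ge0// invr_ge0 mulr_ge0// ltW.
have i0 : P.-integrable setT (EFin \o f) by apply: integrable_le i2 _ => //.
split => //.
have -> : e / 2 + (2 * e)^-1 * \int[P]_x (f x ^+ 2) =
   \int[P]_x (e / 2 + (2 * e)^-1 * f x ^+ 2).
  rewrite RintegralD//; last exact: integrableZlR.
  by rewrite Rintegral_cst// RintegralZl// (congr1 fine (probability_setT P)) /= mulr1.
by apply: le_Rintegral => //; exact: integrable_norm.
Qed.
End prob_L1_L2.

Section levy_approx.
Variable R : realType.
Notation mR := (measurableTypeR R).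
Notation leb2 := (@lebesgue2 R).
Variable sg : {measure set mR -> \bar R}.
Hypothesis sg2 : (\int[sg]_(tau in `]0%R, +oo[) (tau ^+ 2)%:E < +oo)%E.
Variable nu : probability (dual_space R) R.
Hypothesis nu_levy : is_levy_noise sg nu.
Notation C := (levy_var sg).
Implicit Types (f g : mR * mR -> R) (Y Z : dual_space R -> R).

Definition L2fun f := measurable_fun setT f /\
  leb2.-integrable setT (EFin \o (fun p => f p ^+ 2)).

(** That [Y] is a version of [<., f>], through approximation in L2 of the plane
    and in L1 of the probability space. Weakening L2 to L1 on the second side
    makes the notion stable under time integration, where only L1 bounds are
    available, and still determines the law of [Y]. *)
Definition levy_approx f Y := [/\ L2fun f, measurable_fun setT Y &
  forall e, 0 < e -> exists u : test_space R,
   [/\ leb2.-integrable setT (EFin \o (fun p => (u p - f p) ^+ 2)),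
       \int[leb2]_p ((u p - f p) ^+ 2) <= e,
       nu.-integrable setT (EFin \o (fun w => pairing w u - Y w)) &
       \int[nu]_w `|pairing w u - Y w| <= e]].

Lemma is_pairing_approx f Y : L2fun f -> is_pairing nu f Y -> levy_approx f Y.
Proof.
move=> [mf f2] [mY [u_ [uf uY]]]; split => // e e0.
have H1 := @cvg_L2_sqr_integral _ _ R leb2 _ _ (fun n => test_fun_measurable (u_ n)) mf uf e e0.
have e20 : 0 < e ^+ 2 by rewrite exprn_gt0.
have H2 := @cvg_L2_sqr_integral _ _ R nu _ _ (fun n => pairing_measurable (u_ n)) mY uY (e ^+ 2) e20.
near \oo => n; have [i1 b1] : leb2.-integrable setT (EFin \o (fun p => (u_ n p - f p) ^+ 2)) /\
  \int[leb2]_p ((u_ n p - f p) ^+ 2) <= e by near: n; exact: H1.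
have [i2 b2] : nu.-integrable setT (EFin \o (fun w => (pairing w (u_ n) - Y w) ^+ 2)) /\
  \int[nu]_w ((pairing w (u_ n) - Y w) ^+ 2) <= e ^+ 2 by near: n; exact: H2.
have mD : measurable_fun setT (fun w => pairing w (u_ n) - Y w).
  by apply: measurable_funB => //; exact: pairing_measurable.
have [i3 b3] := L1_of_L2 e0 mD i2.
exists (u_ n); split => //; rewrite (le_trans b3)//.
have ei : 0 <= (2 * e)^-1 by rewrite invr_ge0 mulr_ge0// ltW.
rewrite (@le_trans _ _ (e / 2 + (2 * e)^-1 * e ^+ 2))//.
  by rewrite lerD2l ler_wpM2l.
by rewrite le_eqVlt; apply/orP; left; apply/eqP; field; rewrite gt_eqF.
Unshelve. all: by end_near. Qed.

Lemma L2fun_lin a f g : L2fun f -> L2fun g -> L2fun (fun p => a * f p + g p).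
Proof.
move=> [mf f2] [mg g2]; split.
  by apply: measurable_funD => //; exact: mfun_scale.
have [af2 _] := integrable_sqr_scale a f2.
by have [] := integrable_sqr_add (mfun_scale a mf) mg af2 g2.
Qed.

Lemma levy_approx_lin a f g Y Z : levy_approx f Y -> levy_approx g Z ->
  levy_approx (fun p => a * f p + g p) (fun w => a * Y w + Z w).
Proof.
move=> [Lf mY Hf] [Lg mZ Hg]; split.
- exact: L2fun_lin.
- by apply: measurable_funD => //; exact: mfun_scale.
move=> e e0; pose k := 2 * a ^+ 2 + `|a| + 3.
have k0 : 0 < k by rewrite /k ltr_wpDl// addr_ge0// mulr_ge0// sqr_ge0.
have ek0 : 0 < e / k by rewrite divr_gt0.
have [u [iu bu iuY buY]] := Hf _ ek0; have [v [iv bv ivZ bvZ]] := Hg _ ek0.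
have [mf f2] := Lf; have [mg g2] := Lg.
exists (a *: u + v).
have e1 : (fun p => ((a *: u + v) p - (a * f p + g p)) ^+ 2) =
    (fun p => (a * (u p - f p) + (v p - g p)) ^+ 2).
  by apply/funext => p; rewrite test_fun_lin; congr (_ ^+ 2); ring.
have e2 : (fun w => pairing w (a *: u + v) - (a * Y w + Z w)) =
    (fun w => a * (pairing w u - Y w) + (pairing w v - Z w)).
  by apply/funext => w; rewrite pairing_lin; ring.
have muf : measurable_fun setT (fun p : mR * mR => u p - f p).
  by apply: measurable_funB => //; exact: test_fun_measurable.
have mvg : measurable_fun setT (fun p : mR * mR => v p - g p).
  by apply: measurable_funB => //; exact: test_fun_measurable.
have [iau bau] := integrable_sqr_scale a iu.
have [i1 b1] := integrable_sqr_add (mfun_scale a muf) mvg iau iv.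
have i2 : nu.-integrable setT (EFin \o (fun w => a * (pairing w u - Y w) + (pairing w v - Z w))).
  by apply: integrableDR => //; exact: integrableZlR.
have ek : k * (e / k) = e by field; rewrite gt_eqF.
split.
- by rewrite e1.
- have -> : \int[leb2]_p (((a *: u + v) p - (a * f p + g p)) ^+ 2) =
    \int[leb2]_p ((a * (u p - f p) + (v p - g p)) ^+ 2)
    by apply: eq_Rintegral => p _; rewrite test_fun_lin; congr (_ ^+ 2); ring.
  rewrite (le_trans b1)// bau -[leRHS]ek.
  have : 2 * (a ^+ 2 * \int[leb2]_p ((u p - f p) ^+ 2)) <= 2 * (a ^+ 2 * (e / k)).
    by rewrite ler_wpM2l// ler_wpM2l// sqr_ge0.
  have : 0 <= `|a| * (e / k) by rewrite mulr_ge0// ltW.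
  move: bv; rewrite /k; lra.
- by rewrite e2.
- have -> : \int[nu]_w `|pairing w (a *: u + v) - (a * Y w + Z w)| =
    \int[nu]_w `|a * (pairing w u - Y w) + (pairing w v - Z w)|.
    by apply: eq_Rintegral => w _; rewrite pairing_lin; congr `|_|; ring.
  apply: (@le_trans _ _ (\int[nu]_w (`|a| * `|pairing w u - Y w| + `|pairing w v - Z w|))).
    apply: le_Rintegral => //.
    + exact: integrable_norm.
    + by apply: integrableDR => //; [apply: integrableZlR => //|]; exact: integrable_norm.
    + by move=> w _; rewrite (le_trans (ler_normD _ _))// normrM.
  rewrite RintegralD//; last 2 first.
  + by apply: integrableZlR => //; exact: integrable_norm.
  + exact: integrable_norm.
  rewrite RintegralZl//; last exact: integrable_norm.
  rewrite -[leRHS]ek.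
  have : `|a| * \int[nu]_w `|pairing w u - Y w| <= `|a| * (e / k) by rewrite ler_wpM2l.
  have : 0 <= 2 * a ^+ 2 * (e / k) by apply: mulr_ge0; [rewrite mulr_ge0// sqr_ge0|exact: ltW].
  move: bvZ; rewrite /k; lra.
Qed.

Lemma levy_approx0 : levy_approx (fun=> 0) (fun=> 0).
Proof.
have i0 : leb2.-integrable setT (EFin \o (fun=> 0 : R)) by exact: integrable_cst0.
split => //.
- by split => //; under [X in EFin \o X]eq_fun do rewrite expr0n.
- move=> e e0; exists 0; split.
  + by apply: eq_integrable i0 => // p _ /=; rewrite subr0 expr0n.
  + rewrite (@eq_Rintegral _ _ _ _ _ (fun=> 0)) ?Rintegral_cst ?mul0r ?ltW// => p _.
    by rewrite subr0 expr0n.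
  + have i1 : nu.-integrable setT (EFin \o (fun=> 0 : R)) by exact: integrable_cst0.
    by apply: eq_integrable i1 => // p _ /=; rewrite subr0 /pairing linear0.
  + rewrite (@eq_Rintegral _ _ _ _ _ (fun=> 0)) ?Rintegral_cst ?mul0r ?ltW// => p _.
    by rewrite subr0 /pairing linear0 normr0.
Qed.

Lemma levy_approx_scale a f Y : levy_approx f Y ->
  levy_approx (fun p => a * f p) (fun w => a * Y w).
Proof.
move=> fY; have := levy_approx_lin a fY levy_approx0.
by under eq_fun do rewrite addr0; under [X in levy_approx _ X]eq_fun do rewrite addr0.
Qed.

Lemma levy_approx_sub f g Y Z : levy_approx f Y -> levy_approx g Z ->
  levy_approx (fun p => f p - g p) (fun w => Y w - Z w).
Proof.
move=> fY gZ; have := levy_approx_lin (-1) gZ fY.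
have -> : (fun p => -1 * g p + f p) = (fun p => f p - g p) by apply/funext => p; ring.
by have -> : (fun p => -1 * Z p + Y p) = (fun p => Y p - Z p) by apply/funext => p; ring.
Qed.

Lemma levy_approx_sum (I : Type) (s : seq I) (a : I -> R) (f : I -> mR * mR -> R)
    (Y : I -> dual_space R -> R) : (forall i, levy_approx (f i) (Y i)) ->
  levy_approx (fun p => \sum_(i <- s) a i * f i p) (fun w => \sum_(i <- s) a i * Y i w).
Proof.
move=> H; elim: s => [|i s IH].
  under eq_fun do rewrite big_nil; under [X in levy_approx _ X]eq_fun do rewrite big_nil.
  exact: levy_approx0.
under eq_fun do rewrite big_cons; under [X in levy_approx _ X]eq_fun do rewrite big_cons.
exact: levy_approx_lin.
Qed.

(** The second moment bound for test functions passes to the limit as a bound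
    of the L1 norm of [Y] by the L2 norm of [f]. *)
Lemma levy_approx_L1 f Y (delta : R) : levy_approx f Y -> 0 < delta ->
  nu.-integrable setT (EFin \o Y) /\
  \int[nu]_w `|Y w| <= delta / 2 + 8 * C / delta * \int[leb2]_p (f p ^+ 2).
Proof.
move=> [[mf f2] mY H] d0.
have key e : 0 < e -> nu.-integrable setT (EFin \o Y) /\
   \int[nu]_w `|Y w| <= e + (delta / 2 + 8 * C / delta * (\int[leb2]_p (f p ^+ 2) + e)).
  move=> e0; have [u [iu bu iuY buY]] := H e e0.
  have muf : measurable_fun setT (fun p : mR * mR => u p - f p).
    by apply: measurable_funB => //; exact: test_fun_measurable.
  have [iu2 bu2] : leb2.-integrable setT (EFin \o (fun p => u p ^+ 2)) /\
      \int[leb2]_p (u p ^+ 2) <= 2 * e + 2 * \int[leb2]_p (f p ^+ 2).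
    have [i b] := integrable_sqr_add muf mf iu f2.
    have E : (fun p => (u p - f p + f p) ^+ 2) = (fun p => u p ^+ 2).
      by apply/funext => p; rewrite subrK.
    rewrite E in i; split => //.
    have -> : \int[leb2]_p (u p ^+ 2) = \int[leb2]_p ((u p - f p + f p) ^+ 2).
      by apply: eq_Rintegral => p _; rewrite subrK.
    by rewrite (le_trans b)// lerD2r ler_wpM2l.
  have mu := pairing_measurable u.
  have [ip bp] := integrable_of_integral_le (measurable_funX 2 mu)
    (fun w => sqr_ge0 (pairing w u)) (pairing_var sg2 nu_levy iu2).
  have [ipu bpu] := L1_of_L2 d0 mu ip.
  have iY : nu.-integrable setT (EFin \o Y).
    have := integrableBR measurableT ipu iuY.
    by apply: eq_integrable => // w _ /=; rewrite subKr.
  split => //.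
  apply: (@le_trans _ _ (\int[nu]_w (`|pairing w u - Y w| + `|pairing w u|))).
    apply: le_Rintegral => //.
    - exact: integrable_norm.
    - by apply: integrableDR => //; exact: integrable_norm.
    - move=> w _.
      have e1 : Y w = pairing w u - (pairing w u - Y w) by rewrite subKr.
      by rewrite [in leLHS]e1 (le_trans (ler_normB _ _))// addrC.
  rewrite RintegralD//; [|exact: integrable_norm|exact: integrable_norm].
  rewrite lerD// (le_trans bpu)// lerD2l.
  have di : 0 <= (2 * delta)^-1 by rewrite invr_ge0 mulr_ge0// ltW.
  rewrite (le_trans (ler_wpM2l di bp))//.
  have -> : 8 * C / delta * (\int[leb2]_p (f p ^+ 2) + e) =
    (2 * delta)^-1 * (8 * C * (2 * e + 2 * \int[leb2]_p (f p ^+ 2))).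
    by field; rewrite gt_eqF.
  by rewrite ler_wpM2l// ler_wpM2l// mulr_ge0// levy_var_ge0.
have [iY _] := key 1 ltr01; split => //.
apply/ler_addgt0Pr => e e0.
pose k := 1 + 8 * C / delta.
have k0 : 0 < k.
  apply: ltr_pwDl => //; apply: divr_ge0; last exact: ltW.
  by apply: mulr_ge0 => //; exact: levy_var_ge0.
have [_ b] := key (e / k) (divr_gt0 e0 k0).
rewrite (le_trans b)// le_eqVlt; apply/orP; left; apply/eqP.
have ek : k * (e / k) = e by field; rewrite gt_eqF.
by rewrite -[X in _ = _ + X]ek; move: (e / k) => x; rewrite /k; ring.
Qed.

End levy_approx.

(** * The law of a noise variable with a nonnegative kernel *)
Section restricted_measure.
Variable R : realType.
Notation mR := (measurableTypeR R).
Variable sg : {measure set mR -> \bar R}.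
Local Notation D0 := (`]0, +oo[%classic : set mR).
Hypothesis sg2 : (\int[sg]_(tau in `]0%R, +oo[) (tau ^+ 2)%:E < +oo)%E.

Lemma measurable_pos_axis : measurable D0.
Proof. exact: measurable_itv. Qed.

Notation rsg := [the {measure set mR -> \bar R} of mrestr sg measurable_pos_axis].

(** The measure is only controlled on the positive half-line, hence the
    restriction; there [tau ^+ 2] is integrable and positive, so that the sets
    where it is at least [(n + 1)^-2] have finite measure. *)
Lemma sigma_finite_levy : sigma_finite setT rsg.
Proof.
have mt2 : measurable_fun setT (fun tau : mR => (tau ^+ 2)%:E : \bar R).
  by apply/measurable_EFinP; apply: measurable_funX.
pose A n : set mR := [set tau | ((n.+1%:R^-1 ^+ 2)%:E <= `|(tau ^+ 2)%:E|)%E].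
have mA n : measurable (A n).
  rewrite -[A n]setTI; apply: emeasurable_fun_c_infty => //.
  exact: measurableT_comp.
exists (fun n => ~` D0 `|` A n).
  apply/esym/seteqP; split => // tau _.
  have [t0|t0] := ltP 0 tau; last first.
    by exists 0%N => //; left; rewrite /= in_itv/= andbT; apply/negP; rewrite -leNgt.
  exists (Num.truncn (tau^-1)) => //; right; rewrite /A/= lee_fin.
  rewrite ger0_norm ?sqr_ge0// lerXn2r// ?nnegrE ?invr_ge0 ?(ltW t0)//.
  by rewrite invf_ple ?posrE// ltW// truncnS_gt.
move=> n; split; first by apply: measurableU => //; apply: measurableC; exact: measurable_itv.
have -> : rsg (~` D0 `|` A n) = sg (D0 `&` A n).
  by rewrite /= /mrestr setIUl setICl set0U setIC.
have a0 : (0 : R) < n.+1%:R^-1 ^+ 2 by rewrite exprn_gt0// invr_gt0 ltr0n.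
have mt2D : measurable_fun D0 (fun tau : mR => (tau ^+ 2)%:E : \bar R) by exact: measurable_funTS.
have := @le_integral_abse _ _ _ sg D0 measurable_pos_axis _ _ mt2D a0.
under eq_integral do rewrite gee0_abs ?lee_fin ?sqr_ge0//.
move=> /le_lt_trans/(_ sg2); rewrite -/(A n) => h.
rewrite ltNge; apply/negP; rewrite leye_eq => /eqP E.
by move: h; rewrite E gt0_muley// ?lte_fin// ltxx.
Qed.

Definition levy_measure_pos : {sigma_finite_measure set mR -> \bar R} :=
  sigma_finite_pack sigma_finite_levy.

Lemma integral_levy_pos (phi : mR -> \bar R) :
  (forall tau, tau <= 0 -> phi tau = 0%E) ->
  (\int[levy_measure_pos]_tau phi tau = \int[sg]_(tau in `]0%R, +oo[) phi tau)%E.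
Proof.
move=> phi0.
have -> : phi = phi \_ D0.
  apply/funext => tau; rewrite patchE; case: ifPn => //.
  by rewrite notin_setE/= in_itv/= andbT => /negP; rewrite -leNgt => /phi0.
rewrite -integral_mkcond [in RHS](eq_integral phi); last first.
  by move=> x xD; rewrite patchE xD.
by apply: eq_measure_integral => B mB BD; rewrite /= /as_sigma_finite /= /mrestr setIidl.
Qed.

Lemma Rintegral_levy_pos (phi : mR -> R) : (forall tau, tau <= 0 -> phi tau = 0) ->
  \int[levy_measure_pos]_tau phi tau = \int[sg]_(tau in `]0, +oo[) phi tau.
Proof.
by move=> phi0; congr fine; apply: integral_levy_pos => tau /phi0 ->.
Qed.

Lemma integrable_levy_pos (phi : mR -> R) : measurable_fun setT phi ->
  (forall tau, tau <= 0 -> phi tau = 0) -> sg.-integrable D0 (EFin \o phi) ->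
  levy_measure_pos.-integrable setT (EFin \o phi).
Proof.
move=> mphi phi0 /integrableP[_ iphi]; apply/integrableP; split.
  exact/measurable_EFinP.
by rewrite integral_levy_pos// => tau /phi0 /= ->; rewrite normr0.
Qed.
End restricted_measure.

Section choice_cvg.
Variable R : realType.

Lemma cvg_of_le_harmonic (x_ : nat -> R) (x K : R) :
  (forall n, `|x_ n - x| <= K * n.+1%:R^-1) -> x_ n @[n --> \oo] --> x.
Proof.
move=> h; apply/subr_cvg0/norm_cvg0P.
have hK : (K * n.+1%:R^-1) @[n --> \oo] --> K * (0 : R).
  by apply: cvgM; [exact: cvg_cst|exact: (@cvg_harmonic R)].
rewrite mulr0 in hK.
apply: (@squeeze_cvgr _ _ _ _ (cst 0) _ _ _ _ _ hK); last exact: cvg_cst.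
by apply: nearW => n /=; rewrite normr_ge0 h.
Qed.
End choice_cvg.

Section levy_cf.
Variable R : realType.
Notation mR := (measurableTypeR R).
Notation leb2 := (@lebesgue2 R).
Variable sg : {measure set mR -> \bar R}.
Local Notation D0 := (`]0, +oo[%classic : set mR).
Hypothesis sg2 : (\int[sg]_(tau in `]0%R, +oo[) (tau ^+ 2)%:E < +oo)%E.
Variable nu : probability (dual_space R) R.
Hypothesis nu_levy : is_levy_noise sg nu.
Notation C := (levy_var sg).
Implicit Types (f g : mR * mR -> R) (Y Z : dual_space R -> R).

(** Integrating the local Lipschitz bound: the cross term
    [`|u - f| * `|f|] is split with weight [e] into two squares. *)
Let exponent_close (g : R -> R) (u f : mR * mR -> R) (e : R) : 0 < e <= 1 ->
  (forall a b, `|g a - g b| <= C * (`|a - b| * (`|a| + `|b|))) ->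
  (forall k : mR * mR -> R, L2fun k -> leb2.-integrable setT (EFin \o (fun p => g (k p)))) ->
  L2fun f -> measurable_fun setT u ->
  leb2.-integrable setT (EFin \o (fun p => (u p - f p) ^+ 2)) ->
  \int[leb2]_p ((u p - f p) ^+ 2) <= e ^+ 2 ->
  `|(\int[leb2]_p g (u p)) - \int[leb2]_p g (f p)| <= C * (2 + \int[leb2]_p (f p ^+ 2)) * e.
Proof.
move=> /andP[e0 e1] glip gint [mf f2] mu iuf buf.
have Lu : L2fun u.
  split => //; have muf : measurable_fun setT (fun p : mR * mR => u p - f p) by exact: measurable_funB.
  have [i _] := integrable_sqr_add muf mf iuf f2.
  by apply: eq_integrable i => // p _ /=; rewrite subrK.
have iD : leb2.-integrable setT (EFin \o (fun p => g (u p) - g (f p))).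
  by apply: integrableBR; [| exact: gint | exact: gint].
have iB : leb2.-integrable setT
    (EFin \o (fun p => C * (1 + e^-1) * (u p - f p) ^+ 2 + C * e * f p ^+ 2)).
  by apply: integrableDR => //; exact: integrableZlR.
rewrite -RintegralB//; [|exact: gint|exact: gint].
rewrite (le_trans (le_normr_Rintegral _ iD))//.
apply: (@le_trans _ _ (\int[leb2]_p (C * (1 + e^-1) * (u p - f p) ^+ 2 + C * e * f p ^+ 2))).
  apply: le_Rintegral => //; first exact: integrable_norm.
  move=> p _; rewrite (le_trans (glip _ _))// -!mulrA -mulrDr ler_wpM2l ?levy_var_ge0//.
  set x := `|u p - f p|; set y := `|f p|.
  have -> : (u p - f p) ^+ 2 = x ^+ 2 by rewrite /x real_normK// num_real.
  have -> : f p ^+ 2 = y ^+ 2 by rewrite /y real_normK// num_real.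
  have x0 : 0 <= x by exact: normr_ge0.
  have ux : `|u p| <= x + y by rewrite /x /y -{1}(subrK (f p) (u p)) ler_normD.
  apply: (@le_trans _ _ (x * (x + y + y))); first by rewrite ler_wpM2l// lerD2r.
  rewrite -subr_ge0.
  have -> : (1 + e^-1) * x ^+ 2 + e * y ^+ 2 - x * (x + y + y) = e^-1 * (x - e * y) ^+ 2.
    by field; rewrite gt_eqF.
  by rewrite mulr_ge0 ?sqr_ge0// invr_ge0 ltW.
rewrite RintegralD//; [|exact: integrableZlR|exact: integrableZlR].
rewrite RintegralZl// RintegralZl//.
have C0 : 0 <= C by exact: levy_var_ge0.
apply: (@le_trans _ _ (C * (1 + e^-1) * e ^+ 2 + C * e * \int[leb2]_p (f p ^+ 2))).
  rewrite lerD2r ler_wpM2l// mulr_ge0// addr_ge0// invr_ge0 ltW//.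
rewrite -subr_ge0.
have -> : C * (2 + \int[leb2]_p (f p ^+ 2)) * e -
  (C * (1 + e^-1) * e ^+ 2 + C * e * \int[leb2]_p (f p ^+ 2)) = C * e * (1 - e).
  by field; rewrite gt_eqF.
by rewrite mulr_ge0 ?subr_ge0// mulr_ge0// ltW.
Qed.

Let prob_close (phi : R -> R) (X Y : dual_space R -> R) (e : R) :
  (forall a b, `|phi a - phi b| <= `|a - b|) -> (forall a, `|phi a| <= 1) ->
  measurable_fun setT phi -> measurable_fun setT X -> measurable_fun setT Y ->
  nu.-integrable setT (EFin \o (fun w => X w - Y w)) ->
  \int[nu]_w `|X w - Y w| <= e ->
  `|(\int[nu]_w phi (X w)) - \int[nu]_w phi (Y w)| <= e.
Proof.
move=> philip phi1 mphi mX mY iXY bXY.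
have i1 (Z : dual_space R -> R) : measurable_fun setT Z ->
    nu.-integrable setT (EFin \o (fun w => phi (Z w))).
  move=> mZ; apply: (@prob_bounded_integrable _ _ _ nu _ 1) => // .
  exact: measurableT_comp mphi mZ.
rewrite -RintegralB//; [|exact: i1|exact: i1].
have iB := integrableBR measurableT (i1 _ mX) (i1 _ mY).
rewrite (le_trans (le_normr_Rintegral _ iB))// (le_trans _ bXY)//.
apply: le_Rintegral => //; exact: integrable_norm.
Qed.

(** The characteristic functions of the approximating test functions converge,
    on one side by L1 convergence of the variables and on the other by
    convergence of the exponents. *)
Lemma levy_approx_cf f Y : levy_approx nu f Y ->
  \int[nu]_w cos (Y w) =
    expR (\int[leb2]_p levy_cos sg (f p)) * cos (\int[leb2]_p levy_sin sg (f p)) /\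
  \int[nu]_w sin (Y w) =
    expR (\int[leb2]_p levy_cos sg (f p)) * sin (\int[leb2]_p levy_sin sg (f p)).
Proof.
move=> [Lf mY H].
pose e n : R := n.+1%:R^-1.
have e0 n : 0 < e n by rewrite invr_gt0 ltr0n.
have e1 n : e n <= 1 by rewrite invf_le1// ler1n.
have e01 n : 0 < e n <= 1 by rewrite e0 e1.
have [u_ Hu] := choice (fun n => H (e n ^+ 2) (exprn_gt0 2 (e0 n))).
have intc k : L2fun k -> leb2.-integrable setT (EFin \o (fun p => levy_cos sg (k p))).
  by move=> [mk k2]; exact: integrable_levy_cos_comp.
have ints k : L2fun k -> leb2.-integrable setT (EFin \o (fun p => levy_sin sg (k p))).
  by move=> [mk k2]; exact: integrable_levy_sin_comp.
pose K := C * (2 + \int[leb2]_p (f p ^+ 2)).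
have cA : (\int[leb2]_p levy_cos sg (u_ n p)) @[n --> \oo] --> \int[leb2]_p levy_cos sg (f p).
  apply: (@cvg_of_le_harmonic _ _ _ K) => n; have [i1 b1 i2 b2] := Hu n.
  by apply: (exponent_close (e01 n)) => //; [exact: levy_cos_lip|exact: test_fun_measurable].
have cB : (\int[leb2]_p levy_sin sg (u_ n p)) @[n --> \oo] --> \int[leb2]_p levy_sin sg (f p).
  apply: (@cvg_of_le_harmonic _ _ _ K) => n; have [i1 b1 i2 b2] := Hu n.
  by apply: (exponent_close (e01 n)) => //; [exact: levy_sin_lip|exact: test_fun_measurable].
have cE := cvg_comp _ _ cA (@continuous_expR R _).
have cphi (phi : R -> R) : (forall a b, `|phi a - phi b| <= `|a - b|) ->
    (forall a, `|phi a| <= 1) -> measurable_fun setT phi ->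
    (\int[nu]_w phi (pairing w (u_ n))) @[n --> \oo] --> \int[nu]_w phi (Y w).
  move=> h1 h2 h3; apply: (@cvg_of_le_harmonic _ _ _ 1) => n; have [i1 b1 i2 b2] := Hu n.
  rewrite mul1r; apply: (@le_trans _ _ (e n ^+ 2)).
    by apply: prob_close => //; exact: pairing_measurable.
  by rewrite expr2 ler_piMl// ltW.
have mcos : measurable_fun setT (@cos R) by exact: continuous_measurable_fun (@continuous_cos R).
have msin : measurable_fun setT (@sin R) by exact: continuous_measurable_fun (@continuous_sin R).
have c1 := cphi _ (@cos_sub_le R) (@cos_max R) mcos.
have c2 := cphi _ (@sin_sub_le R) (@sin_max R) msin.
have c3 := cvg_comp _ _ cB (@continuous_cos R _).
have c4 := cvg_comp _ _ cB (@continuous_sin R _).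
split.
  apply: (cvg_unique _ c1); first exact: Rhausdorff.
  have -> : (fun n => \int[nu]_w cos (pairing w (u_ n))) = (fun n =>
    expR (\int[leb2]_p levy_cos sg (u_ n p)) * cos (\int[leb2]_p levy_sin sg (u_ n p))).
    by apply/funext => n; have [] := pairing_cf nu_levy (u_ n).
  by apply: cvgM; [exact: cE|exact: c3].
apply: (cvg_unique _ c2); first exact: Rhausdorff.
have -> : (fun n => \int[nu]_w sin (pairing w (u_ n))) = (fun n =>
  expR (\int[leb2]_p levy_cos sg (u_ n p)) * sin (\int[leb2]_p levy_sin sg (u_ n p))).
  by apply/funext => n; have [] := pairing_cf nu_levy (u_ n).
by apply: cvgM; [exact: cE|exact: c4].
Qed.
End levy_cf.

Section levy_nonneg.
Variable R : realType.
Notation mR := (measurableTypeR R).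
Notation leb := (@lebesgue_measure R).
Notation leb2 := (@lebesgue2 R).
Variable sg : {measure set mR -> \bar R}.
Local Notation D0 := (`]0, +oo[%classic : set mR).
Hypothesis sg2 : (\int[sg]_(tau in `]0%R, +oo[) (tau ^+ 2)%:E < +oo)%E.
Hypothesis sg1 : (\int[sg]_(tau in `]0%R, +oo[) tau%:E < +oo)%E.
Variable nu : probability (dual_space R) R.
Hypothesis nu_levy : is_levy_noise sg nu.
Implicit Types (f g : mR * mR -> R) (Y Z : dual_space R -> R).

Definition levy_mean := \int[sg]_(tau in `]0, +oo[) tau.

Definition leb2_sigma_finite : {sigma_finite_measure set (mR * mR)%type -> \bar R} :=
  sigma_finite_pack (mu := leb2) (sigma_finite_prod leb leb).

(** The intensity of the point process of pairs (height, position) of the jumps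
    of the noise; [jump f] is the contribution of one of them to [<., f>]. *)
Definition jump_measure : {sigma_finite_measure set (mR * (mR * mR))%type -> \bar R} :=
  sigma_finite_pack (sigma_finite_prod (levy_measure_pos sg2) leb2_sigma_finite).

(** The height is truncated at 0 so that jumps are nonnegative everywhere, also
    outside the half-line that carries the measure. *)
Definition jump f (z : mR * (mR * mR)) : R := Num.max z.1 0 * f z.2.

Let pos (tau : mR) : R := Num.max tau 0.

Let mpos : measurable_fun setT pos.
Proof. exact: measurable_maxr. Qed.

Let pos_gt tau : D0 tau -> pos tau = tau.
Proof. by rewrite /= in_itv/= andbT => t0; rewrite /pos max_l// ltW. Qed.

Let pos_le tau : tau <= 0 -> pos tau = 0.
Proof. by move=> t0; rewrite /pos max_r. Qed.

Let pos_ge0 tau : 0 <= pos tau.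
Proof. by rewrite /pos le_max lexx orbT. Qed.

Let ipos1 : (levy_measure_pos sg2).-integrable setT (EFin \o pos).
Proof.
apply: integrable_levy_pos => //.
apply/integrableP; split; first by apply/measurable_EFinP; exact: measurable_funTS.
rewrite (@eq_integral _ mR R sg D0 (fun tau => tau%:E))// => tau; rewrite inE => t0.
by rewrite /= pos_gt// ger0_norm//; move: t0; rewrite /= in_itv/= andbT => /ltW.
Qed.

Let ipos2 : (levy_measure_pos sg2).-integrable setT (EFin \o (fun tau => pos tau ^+ 2)).
Proof.
apply: integrable_levy_pos => [|tau t0|].
- exact: measurable_funX.
- by rewrite pos_le// expr0n.
- apply/integrableP; split; first by apply/measurable_EFinP/measurable_funTS/measurable_funX.
  rewrite (@eq_integral _ mR R sg D0 (fun tau => (tau ^+ 2)%:E))// => tau; rewrite inE => t0.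
  by rewrite /= pos_gt// ger0_norm// sqr_ge0.
Qed.

Lemma levy_mean_ge0 : 0 <= levy_mean.
Proof. by apply: Rintegral_ge0 => tau; rewrite /= in_itv/= andbT => /ltW. Qed.

Lemma integrable_tau1 : sg.-integrable D0 (EFin \o (fun tau => tau)).
Proof.
apply/integrableP; split; first by apply/measurable_EFinP; exact: measurable_funTS.
rewrite (@eq_integral _ mR R sg D0 (fun tau => tau%:E))// => tau; rewrite inE/= in_itv/= andbT => t0.
by rewrite gtr0_norm.
Qed.

Lemma measurable_jump f : measurable_fun setT f -> measurable_fun setT (jump f).
Proof.
move=> mf; apply: measurable_funM.
  exact: (measurableT_comp mpos (@measurable_fst _ _ _ _)).
exact: (measurableT_comp mf (@measurable_snd _ _ _ _)).
Qed.

Lemma Rintegral_jump_measure (F : mR * (mR * mR) -> R) (a : mR -> R) (k : mR * mR -> R) :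
  measurable_fun setT F -> (levy_measure_pos sg2).-integrable setT (EFin \o a) ->
  leb2.-integrable setT (EFin \o k) -> (forall tau p, `|F (tau, p)| <= a tau * k p) ->
  (forall tau p, tau <= 0 -> F (tau, p) = 0) ->
  jump_measure.-integrable setT (EFin \o F) /\
  \int[jump_measure]_z F z = \int[leb2]_p \int[sg]_(tau in `]0, +oo[) F (tau, p).
Proof.
move=> mF ia ik Fak F0; split.
  exact: (@integrable_prod_bound _ _ _ _ R (levy_measure_pos sg2) leb2_sigma_finite F a k).
have <- := @RFubini21 _ _ _ _ R (levy_measure_pos sg2) leb2_sigma_finite F a k mF ia ik Fak.
apply: eq_Rintegral => p _.
by rewrite Rintegral_levy_pos// => tau t0; exact: F0.
Qed.

Section one_function.
Variables (f : mR * mR -> R) (Y : dual_space R -> R).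
Hypothesis fY : levy_approx nu f Y.
Hypothesis f0 : forall p, 0 <= f p.
Hypothesis if1 : leb2.-integrable setT (EFin \o f).

Let Lf : L2fun f. Proof. by case: fY. Qed.
Let mf : measurable_fun setT f. Proof. by case: Lf. Qed.
Let mY : measurable_fun setT Y. Proof. by case: fY. Qed.
Let mh := measurable_jump mf.

Let jump_ge0 z : 0 <= jump f z.
Proof. by apply: mulr_ge0; [exact: pos_ge0|exact: f0]. Qed.

Let jump0 tau p : tau <= 0 -> jump f (tau, p) = 0.
Proof. by move=> t0; rewrite /jump /= -/(pos tau) pos_le// mul0r. Qed.

(** The mean of the sum of the jumps, subtracted in the centered noise. *)
Definition compensator := levy_mean * \int[leb2]_p f p.

Lemma integrable_jump :
  jump_measure.-integrable setT (EFin \o jump f) /\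
  \int[jump_measure]_z jump f z = compensator.
Proof.
have b1 tau p : `|jump f (tau, p)| <= pos tau * f p.
  by rewrite ger0_norm ?jump_ge0//; exact: lexx.
have [i E] := Rintegral_jump_measure mh ipos1 if1 b1 jump0.
split => //; rewrite E /compensator -RintegralZl//; apply: eq_Rintegral => p _.
rewrite /levy_mean -RintegralZr//; last exact: integrable_tau1.
by apply: eq_Rintegral => tau; rewrite inE => t0; rewrite /jump /= -/(pos tau) pos_gt.
Qed.

Let if2b (b : R) : leb2.-integrable setT (EFin \o (fun p => (b * f p) ^+ 2)).
Proof. by case: Lf => _ f2; have [] := integrable_sqr_scale b f2. Qed.

Lemma Rintegral_jump_cos b :
  \int[jump_measure]_z (cos (b * jump f z) - 1) = \int[leb2]_p levy_cos sg (b * f p).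
Proof.
have [|||_ ->] := @Rintegral_jump_measure (fun z => cos (b * jump f z) - 1)
  (fun tau => pos tau ^+ 2) (fun p => (b * f p) ^+ 2) _ ipos2 (if2b b).
- by apply: measurable_funB => //; exact/mfun_cos/mfun_scale.
- move=> tau p; have := cos_sub_le2 (b * jump f (tau, p)) 0.
  rewrite cos0 subr0 normr0 addr0 => /le_trans; apply.
  rewrite -normrM -expr2 ger0_norm ?sqr_ge0// /jump /= -/(pos tau).
  by rewrite mulrCA exprMn.
- by move=> tau p t0; rewrite jump0// mulr0 cos0 subrr.
apply: eq_Rintegral => p _; apply: eq_Rintegral => tau; rewrite inE => t0.
by rewrite /jump /= -/(pos tau) pos_gt// mulrCA.
Qed.

Lemma Rintegral_jump_sin b :
  \int[jump_measure]_z sin (b * jump f z) =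
  (\int[leb2]_p levy_sin sg (b * f p)) + b * compensator.
Proof.
have inf : leb2.-integrable setT (EFin \o (fun p => `|b| * f p)) by exact: integrableZlR.
have [|||_ ->] := @Rintegral_jump_measure (fun z => sin (b * jump f z))
  pos (fun p => `|b| * f p) _ ipos1 inf.
- exact/mfun_sin/mfun_scale.
- move=> tau p; rewrite (le_trans (sin_abs_le _))// normrM /jump /= -/(pos tau).
  by rewrite (ger0_norm (mulr_ge0 (pos_ge0 _) (f0 _))) mulrCA.
- by move=> tau p t0; rewrite jump0// mulr0 sin0.
have ibf : leb2.-integrable setT (EFin \o (fun p => b * f p)) by exact: integrableZlR.
have -> : b * compensator = \int[leb2]_p (levy_mean * (b * f p)).
  by rewrite RintegralZl// RintegralZl// /compensator mulrCA.
rewrite -RintegralD//; last 2 first.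
- by apply: integrable_levy_sin_comp => //; exact: mfun_scale.
- exact: integrableZlR.
apply: eq_Rintegral => p _.
rewrite /levy_sin /levy_mean -RintegralZr//; last exact: integrable_tau1.
rewrite -RintegralD//; last 2 first.
- exact: integrable_levy_sin.
- have := integrableZlR (b * f p) (@measurable_pos_axis R) integrable_tau1.
  by apply: eq_integrable => // tau _ /=; rewrite mulrC.
apply: eq_Rintegral => tau; rewrite inE => t0.
by rewrite /jump /= -/(pos tau) pos_gt// mulrCA subrK.
Qed.

(** Adding the compensator cancels the term [- i tau v] of the exponent. *)
Lemma levy_approx_poisson_cf :
  poisson_cf nu jump_measure (fun w => Y w + compensator) (jump f).
Proof.
move=> b; rewrite Rintegral_jump_cos Rintegral_jump_sin.
have [cE sE] := levy_approx_cf sg2 nu_levy (levy_approx_scale b fY).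
have mbY : measurable_fun setT (fun w => b * Y w) by exact: mfun_scale.
have ic : nu.-integrable setT (EFin \o (fun w => cos (b * Y w))).
  by apply: (@prob_bounded_integrable _ _ _ nu _ 1) => [|w]; [exact: mfun_cos|exact: cos_max].
have isn : nu.-integrable setT (EFin \o (fun w => sin (b * Y w))).
  by apply: (@prob_bounded_integrable _ _ _ nu _ 1) => [|w]; [exact: mfun_sin|exact: sin_max].
rewrite cosD sinD; split.
- have -> : \int[nu]_w cos (b * (Y w + compensator)) =
    \int[nu]_w (cos (b * compensator) * cos (b * Y w) - sin (b * compensator) * sin (b * Y w)).
    by apply: eq_Rintegral => w _; rewrite mulrDr cosD; ring.
  rewrite RintegralB//; [|exact: integrableZlR|exact: integrableZlR].
  by rewrite RintegralZl// RintegralZl// cE sE; ring.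
- have -> : \int[nu]_w sin (b * (Y w + compensator)) =
    \int[nu]_w (cos (b * compensator) * sin (b * Y w) + sin (b * compensator) * cos (b * Y w)).
    by apply: eq_Rintegral => w _; rewrite mulrDr sinD; ring.
  rewrite RintegralD//; [|exact: integrableZlR|exact: integrableZlR].
  by rewrite RintegralZl// RintegralZl// cE sE; ring.
Qed.

Let mW : measurable_fun setT (fun w => Y w + compensator).
Proof. exact: measurable_funD. Qed.

Let iW : nu.-integrable setT (EFin \o (fun w => Y w + compensator)).
Proof.
apply: integrableDR => //; last exact: finite_measure_integrable_cst.
by have [] := levy_approx_L1 sg2 nu_levy fY ltr01.
Qed.

(** The sum of nonnegative jumps is nonnegative: this is where the first moment
    of the jump heights gives a lower bound for a centered variable. *)
Lemma levy_approx_ge0 : {ae nu, forall w, 0 <= Y w + compensator}.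
Proof.
exact: (poisson_cf_ge0 mW iW (proj1 integrable_jump) jump_ge0 levy_approx_poisson_cf).
Qed.

Lemma levy_approx_laplace :
  \int[nu]_w expR (- Y w) =
  expR (\int[jump_measure]_z (jump f z - (1 - expR (- jump f z)))).
Proof.
have [ih Eh] := integrable_jump.
have L := poisson_cf_laplace mW iW ih jump_ge0 levy_approx_poisson_cf.
have ie : jump_measure.-integrable setT (EFin \o (fun z => 1 - expR (- jump f z))).
  apply: (integrable_le _ _ ih) => //.
    by apply: measurable_funB => //; exact/mfun_exp/mfun_opp.
  move=> z _; rewrite ger0_norm; last first.
    by rewrite subr_ge0 -[leRHS]expR0 ler_expR oppr_le0.
  by have := expR_ge1Dx (- jump f z); lra.
rewrite RintegralB// Eh expRD -L.
have -> : \int[nu]_w expR (- Y w) =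
    \int[nu]_w (expR compensator * expR (- (Y w + compensator))).
  by apply: eq_Rintegral => w _; rewrite -expRD; congr expR; ring.
have meW : measurable_fun setT (fun w => expR (- (Y w + compensator))).
  exact/mfun_exp/mfun_opp.
apply: RintegralZl => //.
apply/integrableP; split; first exact/measurable_EFinP.
apply: (@le_lt_trans _ _ (\int[nu]_w 1)%E).
  apply: ae_ge0_le_integral => //.
  - by apply: measurableT_comp => //; exact/measurable_EFinP.
  - apply: filterS levy_approx_ge0 => w Yw _.
    by rewrite /= lee_fin ger0_norm ?expR_ge0// -[leRHS]expR0 ler_expR oppr_le0.
rewrite integral_cst// mul1e.
exact: (le_lt_trans (probability_le1 nu measurableT) (ltry 1)).
Qed.
End one_function.

(** The function [x - (1 - expR (- x))] is nondecreasing on [[0, +oo[], hence the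
    Laplace transform is monotone in the kernel. *)
Lemma levy_laplace_le f g Y Z : levy_approx nu f Y -> levy_approx nu g Z ->
  (forall p, 0 <= f p) -> (forall p, f p <= g p) ->
  leb2.-integrable setT (EFin \o f) -> leb2.-integrable setT (EFin \o g) ->
  \int[nu]_w expR (- Y w) <= \int[nu]_w expR (- Z w).
Proof.
move=> fY gZ f0 fg if1 ig1.
have g0 p : 0 <= g p by exact: le_trans (f0 p) (fg p).
rewrite (levy_approx_laplace fY f0 if1) (levy_approx_laplace gZ g0 ig1) ler_expR.
have ij (k : mR * mR -> R) : (forall p, 0 <= k p) -> measurable_fun setT k ->
   leb2.-integrable setT (EFin \o k) ->
   jump_measure.-integrable setT (EFin \o (fun z => jump k z - (1 - expR (- jump k z)))).
  move=> k0 mk ik.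
  have mj := measurable_jump mk.
  have j0 z : 0 <= jump k z by apply: mulr_ge0; [exact: pos_ge0|exact: k0].
  have bnd z : 0 <= jump k z - (1 - expR (- jump k z)) <= jump k z.
    have := expR_ge1Dx (- jump k z).
    have : expR (- jump k z) <= 1 by rewrite -[leRHS]expR0 ler_expR oppr_le0.
    by move=> h1 h2; apply/andP; split; lra.
  have mF : measurable_fun setT (fun z => jump k z - (1 - expR (- jump k z))).
    by apply: measurable_funB => //; apply: measurable_funB => //; exact/mfun_exp/mfun_opp.
  have [] := Rintegral_jump_measure mF ipos1 ik _ _ => //.
  - by move=> tau p; have /andP[? ?] := bnd (tau, p); rewrite ger0_norm.
  - move=> tau p t0; rewrite /jump /= -/(pos tau) pos_le// mul0r oppr0 expR0 subrr subr0//.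
have [[mf _] _ _] := fY; have [[mg _] _ _] := gZ.
apply: le_Rintegral => //; [exact: ij|exact: ij|].
move=> z _.
have h0 : 0 <= jump f z by apply: mulr_ge0; [exact: pos_ge0|exact: f0].
have hfg : jump f z <= jump g z by apply: ler_wpM2l; [exact: pos_ge0|exact: fg].
set x := jump f z in h0 hfg *; set y := jump g z in hfg *.
have : expR (- y) >= expR (- x) * (1 - (y - x)).
  have -> : - y = - x + - (y - x) by ring.
  by rewrite expRD ler_wpM2l ?expR_ge0// expR_ge1Dx.
have : expR (- x) <= 1 by rewrite -[leRHS]expR0 ler_expR oppr_le0.
move=> ex1 ex2.
have : expR (- x) * (y - x) <= y - x by rewrite ler_piMl// subr_ge0.
lra.
Qed.
End levy_nonneg.

(** * Time integrals of a process as limits of Riemann sums *)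
Section approx_closed.
Variable R : realType.
Notation mR := (measurableTypeR R).
Notation leb2 := (@lebesgue2 R).
Variable nu : probability (dual_space R) R.

(** Versions of [<., f>] form a closed relation; this identifies a limit of
    finite sums of field values. *)
Lemma levy_approx_closed (g : mR * mR -> R) (I : dual_space R -> R) :
  L2fun g -> measurable_fun setT I ->
  (forall e : R, 0 < e -> exists f Y, [/\ levy_approx nu f Y,
     \int[leb2]_p ((f p - g p) ^+ 2) <= e,
     nu.-integrable setT (EFin \o (fun w => Y w - I w)) &
     \int[nu]_w `|Y w - I w| <= e]) -> levy_approx nu g I.
Proof.
move=> [mg g2] mI H; split => // e e0.
have e40 : 0 < e / 4 by rewrite divr_gt0.
have [f [Y [[[mf f2] mY HY] b1 i2 b2]]] := H _ e40.
have [u [iu bu iuY buY]] := HY _ e40.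
have muf : measurable_fun setT (fun p : mR * mR => u p - f p).
  by apply: measurable_funB => //; exact: test_fun_measurable.
have mfg : measurable_fun setT (fun p : mR * mR => f p - g p) by exact: measurable_funB.
have ifg : leb2.-integrable setT (EFin \o (fun p => (f p - g p) ^+ 2)).
  have [_ i] := L2fun_lin (-1) (conj mg g2) (conj mf f2).
  by apply: eq_integrable i => // p _ /=; rewrite mulN1r addrC.
have [i3 b3] := integrable_sqr_add muf mfg iu ifg.
exists u; split.
- by apply: eq_integrable i3 => // p _ /=; rewrite addrA subrK.
- have -> : \int[leb2]_p ((u p - g p) ^+ 2) = \int[leb2]_p ((u p - f p + (f p - g p)) ^+ 2).
    by apply: eq_Rintegral => p _; rewrite addrA subrK.
  by move: b3 bu b1; lra.
- have := integrableDR measurableT iuY i2.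
  by apply: eq_integrable => // w _ /=; rewrite addrA subrK.
- apply: (@le_trans _ _ (\int[nu]_w (`|pairing w u - Y w| + `|Y w - I w|))).
    apply: le_Rintegral => //.
    + have := integrable_norm (integrableDR measurableT iuY i2).
      by apply: eq_integrable => // w _ /=; rewrite addrA subrK.
    + by apply: integrableDR => //; exact: integrable_norm.
    + by move=> w _; rewrite -{1}(subrK (Y w) (pairing w u)) -addrA ler_normD.
  rewrite RintegralD//; [|exact: integrable_norm|exact: integrable_norm].
  by move: buY b2 e0; lra.
Qed.
End approx_closed.

Lemma integrable_indic_fin d (T : measurableType d) (R : realType)
    (m : {measure set T -> \bar R}) (A : set T) : measurable A -> (m A < +oo)%E ->
  m.-integrable setT (EFin \o (\1_A : T -> R)) /\ \int[m]_x \1_A x = fine (m A).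
Proof.
move=> mA Ay; split; last by rewrite /Rintegral integral_indic// setIT.
apply/integrableP; split; first by apply/measurable_EFinP; exact: measurable_indic.
under eq_integral do rewrite /= ger0_norm//.
by rewrite integral_indic// setIT.
Qed.

Section integral_of_process.
Context d (O : measurableType d) (R : realType).
Notation mR := (measurableTypeR R).
Notation leb := (@lebesgue_measure R).
Variables (P : probability O R) (H : O * mR -> R).
Hypothesis mH : measurable_fun setT H.

Let P' : {sigma_finite_measure set O -> \bar R} := P.

(** A jointly measurable process with bounded first moments is almost surely
    integrable in time, and its time integral is controlled in L1. *)
Lemma process_integral_L1 (J : set mR) (eps : R) : measurable J -> (leb J < +oo)%E ->
  (forall u, J u -> P.-integrable setT (EFin \o (fun w => H (w, u))) /\
     \int[P]_w `|H (w, u)| <= eps) ->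
  [/\ measurable_fun setT (fun w => \int[leb]_(u in J) H (w, u)),
      {ae P, forall w, leb.-integrable J (EFin \o (fun u => H (w, u)))},
      P.-integrable setT (EFin \o (fun w => \int[leb]_(u in J) H (w, u))) &
      \int[P]_w `|\int[leb]_(u in J) H (w, u)| <= eps * fine (leb J)].
Proof.
move=> mJ Jy HJ.
pose Hc (z : O * mR) := H z * \1_J z.2.
have mHc : measurable_fun setT Hc.
  apply: measurable_funM => //.
  by apply: (measurableT_comp (f := \1_J : mR -> R)) => //; exact: measurable_indic.
have mEHc : measurable_fun setT (EFin \o Hc) by exact/measurable_EFinP.
have HcE w : (fun u => Hc (w, u)) = (fun u => H (w, u)) \_ J.
  apply/funext => u; rewrite /Hc /= patchE indicE.
  by case: ifPn => _ /=; rewrite ?mulr1 ?mulr0.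
have HcI w : \int[leb]_(u in J) H (w, u) = \int[leb]_u Hc (w, u).
  by rewrite Rintegral_mkcond HcE.
have inner u : (\int[P]_w `|(Hc (w, u))%:E| <= (eps * \1_J u)%:E)%E.
  rewrite indicE; have [uJ|uJ] := boolP (u \in J).
    rewrite inE in uJ; have [iu bu] := HJ u uJ.
    rewrite mulr1 (@eq_integral _ _ _ _ _ (fun w => (`|H (w, u)|)%:E)); last first.
      by move=> w _; rewrite /Hc /= indicE mem_set//= mulr1.
    rewrite -[leLHS]fineK; first by rewrite lee_fin.
    by apply: integrable_fin_num => //; exact: (integrable_norm iu).
  rewrite mulr0 (@eq_integral _ _ _ _ _ (cst 0%E)) ?integral0// => w _.
  by rewrite /Hc /= indicE (negbTE uJ) mulr0 normr0.
have outer : (\int[leb]_u \int[P]_w `|(Hc (w, u))%:E| <= (eps * fine (leb J))%:E)%E.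
  apply: (@le_trans _ _ (\int[leb]_u (eps * \1_J u)%:E)%E).
    apply: ge0_le_integral => //.
    - by move=> u _; apply: integral_ge0.
    - apply: (@measurable_fun_fubini_tonelli_G _ _ O mR R P' (fun z => `|(Hc z)%:E|%E)) => //.
      exact: measurableT_comp.
    - apply/measurable_EFinP; apply: measurable_funM => //; exact: measurable_indic.
  have [iJ IJ] := @integrable_indic_fin _ mR R leb J mJ Jy.
  have := integrableZlR eps measurableT iJ => /(integrable_fin_num measurableT)/fineK <-.
  by rewrite -/(Rintegral _ _ _) RintegralZl// lee_fin IJ.
have iHc : (P' \x leb)%E.-integrable setT (EFin \o Hc).
  apply/(integrable21ltyP P' leb mEHc) => /=.
  by rewrite (le_lt_trans outer)// ltry.
have mI : measurable_fun setT (fun w => \int[leb]_(u in J) H (w, u)).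
  have -> : (fun w => \int[leb]_(u in J) H (w, u)) = fine \o (fubini_F leb (EFin \o Hc)).
    by apply/funext => w; rewrite HcI.
  by apply: measurableT_comp => //; exact: (@measurable_fubini_F _ _ O mR R P' leb (EFin \o Hc) iHc).
have aei : {ae P, forall w, leb.-integrable J (EFin \o (fun u => H (w, u)))}.
  have := ae_integrable1 iHc; apply: filterS => w.
  move=> h; apply/(integrable_mkcond _ mJ); rewrite restrict_EFin -HcE; exact: h.
have absI w : ((`|\int[leb]_(u in J) H (w, u)|)%:E <= \int[leb]_u `|(Hc (w, u))%:E|)%E.
  rewrite HcI.
  have mw : measurable_fun setT (fun u => Hc (w, u)) by exact: measurableT_comp mHc _.
  have [h|h] := boolP (leb.-integrable setT (EFin \o (fun u => Hc (w, u)))).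
    rewrite EFin_normr_Rintegral//; apply: le_abse_integral => //.
    exact/measurable_EFinP.
  have -> : (\int[leb]_u `|(Hc (w, u))%:E|)%E = +oo%E; last exact: leey.
  apply/eqP; rewrite -leye_eq leNgt; apply/negP => h2.
  by move/negP: h; apply; apply/integrableP; split => //; exact/measurable_EFinP.
have tot : (\int[P]_w (`|\int[leb]_(u in J) H (w, u)|)%:E <= (eps * fine (leb J))%:E)%E.
  rewrite (le_trans _ outer)//.
  have mA : measurable_fun setT (fun z => `|(Hc z)%:E|%E) by exact: measurableT_comp.
  have <- := @fubini_tonelli _ _ O mR R P' leb (fun z => `|(Hc z)%:E|%E) mA (fun z => abse_ge0 _).
  apply: ge0_le_integral => //.
  - by apply/measurable_EFinP; exact: mfun_norm.
  - exact: (@measurable_fun_fubini_tonelli_F _ _ O mR R leb _ mA (fun z => abse_ge0 _)).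
have [i3 b3] := integrable_of_integral_le (mfun_norm mI) (fun w => normr_ge0 _) tot.
split => //; apply: (@integrable_le _ _ _ P setT _ _ measurableT mI i3) => w _ //.
Qed.
End integral_of_process.

Section riemann_sums.
Context d (O : measurableType d) (R : realType).
Notation mR := (measurableTypeR R).
Notation leb := (@lebesgue_measure R).
Variables (P : probability O R) (H : O * mR -> R).
Hypothesis mH : measurable_fun setT H.
Variables (D eps B : R) (n : nat).
Hypothesis D0 : 0 < D.
Hypothesis Hint : forall u, 0 <= u <= n%:R * D ->
  P.-integrable setT (EFin \o (fun w => H (w, u))) /\ \int[P]_w `|H (w, u)| <= B.
Hypothesis Hcell : forall (i : nat) u, (i < n)%N -> i%:R * D < u <= i.+1%:R * D ->
  \int[P]_w `|H (w, u) - H (w, i.+1%:R * D)| <= eps.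

Let leb_itv (a b : R) : a <= b -> leb `]a, b]%classic = (b - a)%:E.
Proof.
rewrite lebesgue_measure_itv/= lte_fin le_eqVlt => /predU1P[->|->].
  by rewrite ltxx subrr.
by rewrite EFinB.
Qed.

(** Right-endpoint Riemann sums approximate the time integral in L1 as soon as
    the process is close in L1 to its right-endpoint value on each cell. The sum
    is built cell by cell, by induction on their number [k]. *)
Lemma riemann_process (k : nat) : (k <= n)%N ->
  P.-integrable setT (EFin \o (fun w =>
    \int[leb]_(u in `]0, k%:R * D]) H (w, u) - \sum_(i < k) D * H (w, i.+1%:R * D))) /\
  \int[P]_w `|\int[leb]_(u in `]0, k%:R * D]) H (w, u) -
      \sum_(i < k) D * H (w, i.+1%:R * D)| <= k%:R * D * eps.
Proof.
have kD0 (j : nat) : 0 <= j%:R * D by rewrite mulr_ge0// ltW.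
have kDn (j : nat) : (j <= n)%N -> j%:R * D <= n%:R * D by move=> jn; rewrite ler_pM2r// ler_nat.
have mHu u : measurable_fun setT (fun w => H (w, u)) by exact: measurableT_comp mH _.
elim: k => [_|k IH kn].
  have E : (fun w => \int[leb]_(u in `]0, 0%:R * D]) H (w, u) -
      \sum_(i < 0) D * H (w, i.+1%:R * D)) = (fun=> 0).
    apply/funext => w; rewrite big_ord0 subr0 mul0r set_itv_ge ?bnd_simp// .
    exact: Rintegral_set0.
  rewrite E; split; first exact: integrable_cst0.
  have -> : \int[P]_w `|\int[leb]_(u in `]0, 0%:R * D]) H (w, u) -
      \sum_(i < 0) D * H (w, i.+1%:R * D)| = \int[P]_w (0 : R).
    by apply: eq_Rintegral => w _; rewrite (congr1 (fun f => f w) E) normr0.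
  by rewrite Rintegral_cst// !mul0r.
have [iD bD] := IH (ltnW kn).
pose c := k.+1%:R * D.
have c0 : 0 <= c <= n%:R * D by rewrite kD0 kDn.
pose J : set mR := `]k%:R * D, c]%classic.
have mJ : measurable J by exact: measurable_itv.
have kc : k%:R * D <= c by rewrite ler_pM2r// ler_nat.
have cE : c - k%:R * D = D by rewrite /c -mulrBl -natr1 addrAC subrr add0r mul1r.
have lJ : leb J = D%:E by rewrite leb_itv// cE.
have Jy : (leb J < +oo)%E by rewrite lJ ltry.
have Jin u : J u -> 0 <= u <= n%:R * D.
  rewrite /J /= in_itv/= => /andP[ku uc]; rewrite (le_trans uc) ?kDn// andbT.
  by rewrite (le_trans (kD0 k))// ltW.
pose H2 (z : O * mR) := H z - H (z.1, c).
have mH2 : measurable_fun setT H2.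
  apply: measurable_funB => //.
  by apply: (measurableT_comp (mHu c)).
have HJ2 u : J u -> P.-integrable setT (EFin \o (fun w => H2 (w, u))) /\
     \int[P]_w `|H2 (w, u)| <= eps.
  move=> Ju; split; last by apply: Hcell.
  by apply: integrableBR => //; [exact: (Hint (Jin u Ju)).1|exact: (Hint c0).1].
have [mI2 aI2 iI2 bI2] := process_integral_L1 mH2 mJ Jy HJ2.
pose J0 : set mR := `]0, c]%classic.
have mJ0 : measurable J0 by exact: measurable_itv.
have HJ0 u : J0 u -> P.-integrable setT (EFin \o (fun w => H (w, u))) /\
     \int[P]_w `|H (w, u)| <= B.
  rewrite /J0 /= in_itv/= => /andP[u0 uc]; apply: Hint.
  by rewrite (ltW u0)/= (le_trans uc)// kDn.
have J0y : (leb J0 < +oo)%E by rewrite leb_itv ?kD0// ltry.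
have [mI0 aI0 _ _] := process_integral_L1 mH mJ0 J0y HJ0.
pose Dk w := \int[leb]_(u in `]0, k%:R * D]) H (w, u) - \sum_(i < k) D * H (w, i.+1%:R * D).
pose Rk w := \int[leb]_(u in J) H2 (w, u).
pose Dk1 w := \int[leb]_(u in `]0, k.+1%:R * D]) H (w, u) - \sum_(i < k.+1) D * H (w, i.+1%:R * D).
have mDk : measurable_fun setT Dk by have /integrableP[/measurable_EFinP] := iD.
have mDk1 : measurable_fun setT Dk1.
  apply: measurable_funB => //; apply: measurable_sum => i; exact: mfun_scale.
have ae1 : {ae P, forall w, Dk1 w = Dk w + Rk w}.
  apply: filterS aI0 => w iw; rewrite /Dk1 /Dk /Rk big_ord_recr /=.
  have iJ : leb.-integrable J (EFin \o (fun u => H (w, u))).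
    apply: (integrableS _ _ _ iw) => //.
    by move=> u; rewrite /J /J0 /= !in_itv/= => /andP[ku ->]; rewrite andbT (le_lt_trans (kD0 k)).
  have := @Rintegral_itvB R (fun u => H (w, u)) (BRight 0) (BRight c) (k%:R * D) iw.
  rewrite !bnd_simp => /(_ (kD0 k) kc) E.
  have E2 : \int[leb]_(u in J) H2 (w, u) = \int[leb]_(u in J) H (w, u) - D * H (w, c).
    rewrite /H2 /= RintegralB//.
      by rewrite Rintegral_cst// (congr1 fine lJ) /= mulrC.
    apply: (@integrable_le _ mR R leb J _ (fun u => `|H (w, c)| * \1_J u)) => //.
    - apply: integrableZlR => //.
      by apply: (integrableS _ _ _ (proj1 (@integrable_indic_fin _ mR R leb J mJ Jy))).
    - by move=> u Ju; rewrite indicE mem_set//= mulr1.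
  by rewrite E2 -/c -E; ring.
have iDR : P.-integrable setT (EFin \o (fun w => Dk w + Rk w)) by exact: integrableDR.
have i1 : P.-integrable setT (EFin \o Dk1).
  have /integrableP[_ fin] := iDR.
  apply/integrableP; split; first exact/measurable_EFinP.
  rewrite (le_lt_trans _ fin)// le_eqVlt; apply/orP; left; apply/eqP.
  apply: ae_eq_integral => //.
  - by apply: measurableT_comp => //; exact/measurable_EFinP.
  - by apply: measurableT_comp => //; exact: (measurable_int P iDR).
  - by apply: filterS ae1 => w /= ->.
split => //; rewrite -/(Dk1 _).
have -> : \int[P]_w `|Dk1 w| = \int[P]_w `|Dk w + Rk w|.
  apply: ae_eq_Rintegral.
  - exact: mfun_norm.
  - by apply: mfun_norm; exact: measurable_funD.
  - by apply: filterS ae1 => w ->.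
apply: (@le_trans _ _ (\int[P]_w (`|Dk w| + `|Rk w|))).
  apply: le_Rintegral => //.
  - exact: integrable_norm.
  - by apply: integrableDR => //; exact: integrable_norm.
  - by move=> w _; exact: ler_normD.
rewrite RintegralD//; [|exact: integrable_norm|exact: integrable_norm].
have -> : k.+1%:R * D * eps = k%:R * D * eps + eps * D by rewrite -natr1; ring.
by rewrite lerD//; move: bI2; rewrite lJ.
Qed.
End riemann_sums.

Section riemann_indicator.
Variable R : realType.

(** As a function of the time [u] of evaluation, the kernel of the field at a
    point is proportional to the indicator of [u >= m], with [m] the larger
    coordinate of the point. *)
Lemma riemann_indicator (D m : R) (n : nat) : 0 < D -> 0 <= m <= n%:R * D ->
  `|\sum_(i < n) D * (m <= i.+1%:R * D)%R%:R - (n%:R * D - m)| <= D.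
Proof.
move=> D0 /andP[m0 mn].
have key (k : nat) : Num.max 0 (k%:R * D - m) <= \sum_(i < k) D * (m <= i.+1%:R * D)%R%:R <=
    Num.max 0 (k%:R * D - m + D).
  elim: k => [|k /andP[lo up]].
    by rewrite big_ord0 mul0r sub0r ge_max lexx oppr_le0 m0/= le_max lexx.
  have kk : k.+1%:R * D = k%:R * D + D by rewrite -natr1 mulrDl mul1r.
  rewrite big_ord_recr /=; move: lo up; set S := \sum_(i < k) _.
  move: (k.+1%:R * D) (k%:R * D) kk => b a bE; rewrite ge_max le_max => /andP[l1 l2] up.
  have [mk|mk] := leP m b; rewrite ?mulr1 ?mulr0 ?addr0 ge_max le_max.
    apply/andP; split; [apply/andP; split; lra|apply/orP; right].
    by case/orP: up => ?; lra.
  apply/andP; split; [apply/andP; split; lra|].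
  by case/orP: up => ?; apply/orP; [left|right]; lra.
have /andP[] := key n.
rewrite max_r ?subr_ge0// max_r; last by rewrite addr_ge0 ?subr_ge0// ltW.
by rewrite ler_norml => h1 h2; apply/andP; split; lra.
Qed.
End riemann_indicator.

Section kernel_box.
Variable R : realType.
Notation mR := (measurableTypeR R).
Notation leb := (@lebesgue_measure R).
Notation leb2 := (@lebesgue2 R).

Definition kbox (a b : R) (p : mR * mR) : R :=
  \1_`[0, a]%classic p.1 * \1_`[0, b]%classic p.2.

Lemma kboxE a b p : kbox a b p = ((0 <= p.1 <= a) && (0 <= p.2 <= b))%:R.
Proof. by rewrite /kbox !indicE !mem_setE -natrM mulnb. Qed.

Lemma kbox_ge0 a b p : 0 <= kbox a b p.
Proof. by rewrite kboxE ler0n. Qed.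

Lemma kbox_sqr a b p : kbox a b p ^+ 2 = kbox a b p.
Proof. by rewrite kboxE; case: (_ && _); rewrite ?expr1n ?expr0n. Qed.

Lemma kbox_mono a b a' b' p : a <= a' -> b <= b' -> kbox a b p <= kbox a' b' p.
Proof.
move=> aa bb; rewrite !kboxE ler_nat.
case: (boolP ((0 <= p.1 <= a) && _)) => // /andP[/andP[-> pa] /andP[-> pb]].
by rewrite (le_trans pa aa) (le_trans pb bb).
Qed.

Lemma kbox_measurable a b : measurable_fun setT (kbox a b).
Proof.
have mi (c : R) : measurable (`[0, c]%classic : set mR) by exact: measurable_itv.
have mind (c : R) : measurable_fun setT (\1_`[0, c]%classic : mR -> R).
  by apply: measurable_indic; exact: mi.
apply: measurable_funM.
  exact: (measurableT_comp (mind a) (@measurable_fst _ _ _ _)).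
exact: (measurableT_comp (mind b) (@measurable_snd _ _ _ _)).
Qed.

Lemma kbox_integral a b : 0 <= a -> 0 <= b ->
  leb2.-integrable setT (EFin \o kbox a b) /\ \int[leb2]_p kbox a b p = a * b.
Proof.
move=> a0 b0.
pose S : set (mR * mR) := `[0, a]%classic `*` `[0, b]%classic.
have E : kbox a b = \1_S :> (mR * mR -> R).
  apply/funext => p; rewrite kboxE indicE /S; congr (_%:R).
  congr nat_of_bool; apply/idP/idP => [/andP[h1 h2]|].
    by rewrite inE; split; rewrite /= in_itv.
  by rewrite inE => -[]; rewrite /= !in_itv/= => -> ->.
have mS : measurable S by apply: measurableX; exact: measurable_itv.
have lS : leb2 S = (a * b)%:E.
  have li (c : R) : 0 <= c -> leb (`[0, c]%classic : set mR) = c%:E.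
    rewrite lebesgue_measure_itv/= lte_fin le_eqVlt => /predU1P[<-|->].
      by rewrite ltxx.
    by rewrite sube0.
  pose I (c : R) : set mR := `[0, c]%classic.
  have -> : leb2 S = (leb (I a) * leb (I b))%E.
    by apply: product_measure1E; exact: measurable_itv.
  by rewrite (li a)// (li b).
have [i I] := @integrable_indic_fin _ _ _ leb2 S mS ltac:(by rewrite lS ltry).
by rewrite E; split => //; rewrite I lS.
Qed.
End kernel_box.

(** * The kernels of the field and of its time integral *)
Section kappa_bound.
Variable R : realType.
Variable kappa : R * R -> R.
Hypothesis kappa_bnd :
  [locally [bounded kappa p | p in [set p : R * R | 0 <= p.1 /\ 0 <= p.2]]].

(** Local boundedness becomes boundedness on squares by compactness. *)
Lemma kappa_bounded (t : R) : exists2 K, 0 <= K &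
  forall p : R * R, 0 <= p.1 <= t -> 0 <= p.2 <= t -> `|kappa p| <= K.
Proof.
pose Q : set (R * R) := [set p : R * R | 0 <= p.1 /\ 0 <= p.2].
pose A : set (R * R) := `[0, t]%classic `*` `[0, t]%classic.
have cA : compact A by apply: compact_setX; exact: segment_compact.
have := (compact_near_coveringP A).1 cA R (+oo%R) (fun M p => Q p -> `|kappa p| <= M) _.
case.
  move=> p [/=]; rewrite !in_itv/= => /andP[p10 _] /andP[p20 _].
  have Qp : Q p by split.
  have [M [Mr HM]] := kappa_bnd Qp.
  have HM1 : \forall x \near p, Q x -> `|kappa x| <= M + 1.
    by have := HM (M + 1) ltac:(by rewrite ltrDl).
  near=> p' i => /= Qp'.
  apply: (@le_trans _ _ (M + 1)).
    by apply: (near HM1 p').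
  near: i; exists (M + 1); split; [exact: num_real|by move=> x /ltW].
move=> M [_ HM].
exists (Num.max 0 (M + 1)); first by rewrite le_max lexx.
move=> p p1 p2; rewrite le_max; apply/orP; right.
apply: HM; rewrite ?ltrDl//.
by split; [case/andP: p1|case/andP: p2].
Unshelve. all: by end_near. Qed.
End kappa_bound.

Section field_kernel.
Variable R : realType.
Notation mR := (measurableTypeR R).
Notation leb := (@lebesgue_measure R).
Notation leb2 := (@lebesgue2 R).
Variable kappa : R * R -> R.
Hypothesis kappa_ge0 : forall p : R * R, 0 <= p.1 -> 0 <= p.2 -> 0 <= kappa p.
Hypothesis kappa_meas : measurable_fun [set p : R * R | 0 <= p.1 /\ 0 <= p.2] kappa.
Variables (t K : R).
Hypothesis K0 : 0 <= K.
Hypothesis KP : forall p : R * R, 0 <= p.1 <= t -> 0 <= p.2 <= t -> `|kappa p| <= K.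

Definition ker (a b : R) (p : mR * mR) : R := kbox a b p * kappa p.

Let Q : set (mR * mR) := [set p | 0 <= p.1 /\ 0 <= p.2].

Let mQ : measurable Q.
Proof.
have -> : Q = `[0, +oo[%classic `*` `[0, +oo[%classic.
  by apply/seteqP; split => p; rewrite /Q /= !in_itv/= !andbT.
by apply: measurableX; exact: measurable_itv.
Qed.

Lemma ker_measurable a b : measurable_fun setT (ker a b).
Proof.
have -> : ker a b = (fun p => kbox a b p * ((kappa : mR * mR -> R) \_ Q) p).
  apply/funext => p; rewrite /ker patchE; case: ifPn => // pQ.
  rewrite kboxE; case: (boolP ((0 <= p.1 <= a) && _)); last by rewrite !mul0r.
  move=> /andP[/andP[p1 _] /andP[p2 _]]; exfalso; move/negP: pQ; apply.
  by rewrite inE; split.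
apply: measurable_funM; first exact: kbox_measurable.
by apply/measurable_restrict => //; rewrite setTI; exact: kappa_meas.
Qed.

Lemma ker_ge0 a b p : 0 <= ker a b p.
Proof.
rewrite /ker kboxE; case: (boolP ((0 <= p.1 <= a) && _)); last by rewrite mul0r.
by move=> /andP[/andP[p1 _] /andP[p2 _]]; rewrite mul1r kappa_ge0.
Qed.

Lemma ker_le a b p : a <= t -> b <= t -> ker a b p <= K * kbox a b p.
Proof.
move=> at_ bt; rewrite /ker kboxE; case: (boolP ((0 <= p.1 <= a) && _)); last by rewrite mul0r mulr0.
move=> /andP[/andP[p1 p1a] /andP[p2 p2b]]; rewrite mul1r mulr1.
by rewrite (le_trans (ler_norm _))// KP// ?p1 ?p2/= ?(le_trans p1a) ?(le_trans p2b).
Qed.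

Lemma ker_mono a b a' b' p : a <= a' -> b <= b' -> ker a b p <= ker a' b' p.
Proof.
move=> aa bb; have := kbox_mono p aa bb; rewrite /ker.
have [->|] := eqVneq (kbox a' b' p) 0.
  by have := kbox_ge0 a b p => k0 k1; have -> : kbox a b p = 0 by apply/eqP; rewrite eq_le k1.
rewrite [kbox a' b' p]kboxE.
case: (boolP ((0 <= p.1 <= a') && _)) => [|_]; last by rewrite eqxx.
by move=> /andP[/andP[p1 _] /andP[p2 _]] _ h; rewrite ler_wpM2r// kappa_ge0.
Qed.

Lemma ker_integrable a b : 0 <= a <= t -> 0 <= b <= t ->
  leb2.-integrable setT (EFin \o ker a b).
Proof.
move=> /andP[a0 at_] /andP[b0 bt]; have [ik _] := kbox_integral a0 b0.
apply: (@integrable_le _ _ _ leb2 setT _ (fun p => K * kbox a b p)) => //.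
- exact: ker_measurable.
- exact: integrableZlR.
- by move=> p _; rewrite ger0_norm ?ker_ge0// ker_le.
Qed.

Lemma ker_L2 a b : 0 <= a <= t -> 0 <= b <= t ->
  L2fun (ker a b) /\ \int[leb2]_p (ker a b p ^+ 2) <= K ^+ 2 * (t * t).
Proof.
move=> /andP[a0 at_] /andP[b0 bt]; have [ik I] := kbox_integral a0 b0.
have le2 p : ker a b p ^+ 2 <= K ^+ 2 * kbox a b p.
  rewrite -kbox_sqr -exprMn lerXn2r// ?nnegrE ?ker_ge0 ?mulr_ge0 ?kbox_ge0//.
  exact: ker_le.
have i2 : leb2.-integrable setT (EFin \o (fun p => K ^+ 2 * kbox a b p)) by exact: integrableZlR.
have ik2 : leb2.-integrable setT (EFin \o (fun p => ker a b p ^+ 2)).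
  apply: integrable_le i2 _ => //.
    by apply: measurable_funX; exact: ker_measurable.
  by move=> p _; rewrite ger0_norm ?sqr_ge0.
split; first by split => //; exact: ker_measurable.
apply: (@le_trans _ _ (\int[leb2]_p (K ^+ 2 * kbox a b p))); first exact: le_Rintegral.
by rewrite RintegralZl// I ler_wpM2l ?sqr_ge0// ler_pM.
Qed.

(** The difference of two nested boxes has area [a' * b' - a * b], so the field
    is continuous in L2 of the plane with respect to its indices. *)
Lemma ker_increment a b a' b' : 0 <= a <= a' -> 0 <= b <= b' -> a' <= t -> b' <= t ->
  \int[leb2]_p ((ker a b p - ker a' b' p) ^+ 2) <= K ^+ 2 * (a' * b' - a * b).
Proof.
move=> /andP[a0 aa] /andP[b0 bb] at_ bt.
have a'0 := le_trans a0 aa; have b'0 := le_trans b0 bb.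
have [ik I] := kbox_integral a0 b0; have [ik' I'] := kbox_integral a'0 b'0.
have iD : leb2.-integrable setT (EFin \o (fun p => kbox a' b' p - kbox a b p)) by exact: integrableBR.
have -> : a' * b' - a * b = \int[leb2]_p (kbox a' b' p - kbox a b p).
  by rewrite RintegralB// I I'.
have le2 p : (ker a b p - ker a' b' p) ^+ 2 <= K ^+ 2 * (kbox a' b' p - kbox a b p).
  have := kbox_mono p aa bb; rewrite /ker -mulrBl exprMn mulrC.
  rewrite [kbox a b p]kboxE [kbox a' b' p]kboxE.
  case: (boolP ((0 <= p.1 <= a) && _)) => _; case: (boolP ((0 <= p.1 <= a') && _)) => [h|_] /=.
  - by move=> _; rewrite subrr expr0n/= !mulr0.
  - by rewrite ler_nat.
  - move=> _; rewrite sub0r sqrrN expr1n subr0 !mulr1.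
    move: h => /andP[/andP[p1 p1a] /andP[p2 p2b]].
    have -> : kappa p ^+ 2 = `|kappa p| ^+ 2 by rewrite real_normK// num_real.
    rewrite lerXn2r ?nnegrE// KP// ?p1 ?p2/=.
      exact: le_trans p1a at_.
    exact: le_trans p2b bt.
  - by move=> _; rewrite subrr expr0n/= !mulr0.
have i2 : leb2.-integrable setT (EFin \o (fun p => K ^+ 2 * (kbox a' b' p - kbox a b p))).
  exact: integrableZlR.
rewrite -RintegralZl//; apply: le_Rintegral => //.
apply: integrable_le i2 _ => //.
  by apply: measurable_funX; apply: measurable_funB; exact: ker_measurable.
by move=> p _; rewrite ger0_norm ?sqr_ge0.
Qed.

(** The integral over [u] in [`[0, t]] of the kernels [ker (min s u) u] of the
    field. *)
Definition gker (s : R) (p : mR * mR) : R := ker s t p * (t - Num.max p.1 p.2).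

Lemma gker_ge0 s p : s <= t -> 0 <= gker s p.
Proof.
move=> st; rewrite /gker /ker kboxE; case: (boolP ((0 <= p.1 <= s) && _)); last by rewrite !mul0r.
move=> /andP[/andP[p1 p1s] /andP[p2 p2t]].
rewrite mul1r mulr_ge0// ?kappa_ge0// subr_ge0 ge_max p2t andbT.
exact: le_trans p1s st.
Qed.

Lemma gker_measurable s : measurable_fun setT (gker s).
Proof.
apply: measurable_funM; first exact: ker_measurable.
apply: measurable_funB => //; apply: measurable_maxr.
  exact: (@measurable_fst _ _ mR mR).
exact: (@measurable_snd _ _ mR mR).
Qed.

Lemma gker_le s p : s <= t -> gker s p <= t * ker s t p.
Proof.
move=> st; rewrite /gker /ker kboxE; case: (boolP ((0 <= p.1 <= s) && _)); last by rewrite !mul0r mulr0.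
move=> /andP[/andP[p1 p1s] /andP[p2 p2t]].
rewrite mul1r mulrC ler_wpM2r ?kappa_ge0// lerBlDr lerDl.
by rewrite le_max p1.
Qed.

Lemma gker_integrable s : 0 <= s <= t -> leb2.-integrable setT (EFin \o gker s).
Proof.
move=> /andP[s0 st]; have t0 := le_trans s0 st.
apply: (@integrable_le _ _ _ leb2 setT _ (fun p => t * ker s t p)) => //.
- exact: gker_measurable.
- by apply: integrableZlR => //; apply: ker_integrable; rewrite ?s0 ?t0 ?lexx.
- by move=> p _; rewrite ger0_norm ?gker_ge0// gker_le.
Qed.

Lemma gker_L2 s : 0 <= s <= t -> L2fun (gker s).
Proof.
move=> /andP[s0 st]; have t0 := le_trans s0 st.
split; first exact: gker_measurable.
have sst : 0 <= s <= t by rewrite s0.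
have ttt : 0 <= t <= t by rewrite t0/=.
have [[_ k2] _] := ker_L2 sst ttt.
have [i _] := integrable_sqr_scale t k2.
apply: integrable_le i _ => //.
  by apply: measurable_funX; exact: gker_measurable.
move=> p _; rewrite ger0_norm ?sqr_ge0// lerXn2r ?nnegrE ?gker_ge0 ?gker_le//.
by rewrite mulr_ge0// ker_ge0.
Qed.

(** The error is uniform in the point, at most the mesh times the bound of
    [kappa], because the sums are those of an indicator. *)
Lemma riemann_ker (s D : R) (n : nat) p : 0 <= s <= t -> 0 < D -> n%:R * D = t ->
  `|\sum_(i < n) D * ker (Num.max 0 (Num.min s (i.+1%:R * D))) (Num.max 0 (i.+1%:R * D)) p
    - gker s p| <= D * K * kbox s t p.
Proof.
move=> /andP[s0 st] D0 nD.
have uD0 (i : nat) : 0 <= i%:R * D by rewrite mulr_ge0// ltW.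
have [h|h] := boolP ((0 <= p.1 <= s) && (0 <= p.2 <= t)); last first.
  have k0 : kbox s t p = 0 by rewrite kboxE (negbTE h).
  have -> : gker s p = 0 by rewrite /gker /ker k0 !mul0r.
  rewrite k0 mulr0 subr0 big1 ?normr0// => i _.
  have it : i.+1%:R * D <= t by rewrite -nD ler_pM2r// ler_nat.
  have : kbox (Num.max 0 (Num.min s (i.+1%:R * D))) (Num.max 0 (i.+1%:R * D)) p <= kbox s t p.
    apply: kbox_mono; rewrite ge_max ?s0 ?(le_trans s0 st)//= ?it//.
    by rewrite ge_min lexx.
  rewrite k0 => kle; rewrite /ker.
  have -> : kbox (Num.max 0 (Num.min s (i.+1%:R * D))) (Num.max 0 (i.+1%:R * D)) p = 0.
    by apply/eqP; rewrite eq_le kle kbox_ge0.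
  by rewrite mul0r mulr0.
move: (h) => /andP[/andP[p1 p1s] /andP[p2 p2t]].
have kE (u : R) : 0 <= u -> ker (Num.max 0 (Num.min s u)) (Num.max 0 u) p =
    kappa p * (Num.max p.1 p.2 <= u)%R%:R.
  move=> u0; rewrite /ker kboxE p1 p2/= mulrC; congr (_ * _%:R).
  rewrite max_r ?le_min ?s0// max_r// p1s/=.
  by rewrite ge_max.
have -> : gker s p = kappa p * (n%:R * D - Num.max p.1 p.2).
  by rewrite /gker /ker kboxE h mul1r nD.
have -> : \sum_(i < n) D * ker (Num.max 0 (Num.min s (i.+1%:R * D))) (Num.max 0 (i.+1%:R * D)) p =
    kappa p * \sum_(i < n) D * (Num.max p.1 p.2 <= i.+1%:R * D)%R%:R.
  by rewrite mulr_sumr; apply: eq_bigr => i _; rewrite kE// mulrCA.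
rewrite -mulrBr normrM kboxE h mulr1 mulrC; apply: ler_pM => //.
  apply: riemann_indicator => //; rewrite le_max p1/= ge_max nD p2t andbT.
  exact: le_trans p1s st.
by apply: KP; rewrite ?p1 ?p2//=; exact: le_trans p1s st.
Qed.
End field_kernel.

Lemma gker_mono (R : realType) (kappa : R * R -> R) (s t t' : R) p :
  (forall p : R * R, 0 <= p.1 -> 0 <= p.2 -> 0 <= kappa p) ->
  s <= t -> t <= t' -> gker kappa t s p <= gker kappa t' s p.
Proof.
move=> k0 st tt; rewrite /gker.
have st' := le_trans st tt.
have [h|h] := boolP ((0 <= p.1 <= s) && (0 <= p.2 <= t)); last first.
  by rewrite {1}/ker kboxE (negbTE h) !mul0r; exact: (gker_ge0 k0 p st').
move: (h) => /andP[/andP[p1 p1s] /andP[p2 p2t]].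
rewrite /ker !kboxE h p1 p1s p2 (le_trans p2t tt)/= !mul1r.
by apply: ler_wpM2l; [exact: k0|rewrite lerD2r].
Qed.

Section integrated_field.
Variable R : realType.
Notation mR := (measurableTypeR R).
Notation leb := (@lebesgue_measure R).
Notation leb2 := (@lebesgue2 R).
Variable sg : {measure set mR -> \bar R}.
Hypothesis sg2 : (\int[sg]_(tau in `]0%R, +oo[) (tau ^+ 2)%:E < +oo)%E.
Variable nu : probability (dual_space R) R.
Hypothesis nu_levy : is_levy_noise sg nu.
Variables (kappa : R * R -> R) (X : R -> R -> dual_space R -> R).
Hypothesis kappa_ge0 : forall p : R * R, 0 <= p.1 -> 0 <= p.2 -> 0 <= kappa p.
Hypothesis kappa_meas : measurable_fun [set p : R * R | 0 <= p.1 /\ 0 <= p.2] kappa.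
Hypothesis kappa_bnd :
  [locally [bounded kappa p | p in [set p : R * R | 0 <= p.1 /\ 0 <= p.2]]].
Hypothesis X_field : is_levy_field nu kappa X.

Lemma field_approx a b : 0 <= a -> 0 <= b -> levy_approx nu (ker kappa a b) (X a b).
Proof.
move=> a0 b0; apply: is_pairing_approx; last exact: X_field.2.
have [K K0 KP] := kappa_bounded kappa_bnd (Num.max a b).
have [||] := @ker_L2 R kappa kappa_ge0 kappa_meas (Num.max a b) K K0 KP a b => //.
  by rewrite a0 le_max lexx.
by rewrite b0 le_max lexx orbT.
Qed.

(** The field at the indices [(min s u, u)], that is, the random parts of the
    forward rates at time [s] for [u >= s] and of the spot rates before. The
    truncations at 0 extend it to all real [u]. *)
Definition field_curve (s : R) (z : dual_space R * mR) : R :=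
  X (Num.max 0 (Num.min s z.2)) (Num.max 0 z.2) z.1.

Lemma field_curve_measurable s : measurable_fun setT (field_curve s).
Proof.
pose E : set (dual_space R * (mR * mR)) := [set q | 0 <= q.2.1 /\ 0 <= q.2.2].
have mE : measurable E.
  have -> : E = setT `*` (`[0, +oo[%classic `*` `[0, +oo[%classic).
    by apply/seteqP; split => [q|q []]; rewrite /E /= !in_itv/= !andbT.
  by apply: measurableX => //; apply: measurableX; exact: measurable_itv.
have mX : measurable_fun E (fun q => X q.2.1 q.2.2 q.1) by exact: X_field.1.
pose phi (z : dual_space R * mR) : dual_space R * (mR * mR) :=
  (z.1, (Num.max 0 (Num.min s z.2), Num.max 0 z.2)).
have mphi : measurable_fun setT phi.
  have m2 : measurable_fun setT (fun z : dual_space R * mR => z.2).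
    exact: measurable_snd.
  apply: measurable_fun_pair; first exact: measurable_fst.
  apply: measurable_fun_pair; apply: measurable_maxr => //.
  exact: measurable_minr.
apply: (measurable_comp mE _ mX mphi) => q [z _ <-]; rewrite /E /phi /=.
by rewrite !le_max !lexx.
Qed.

Lemma field_curve_approx s u : levy_approx nu
  (ker kappa (Num.max 0 (Num.min s u)) (Num.max 0 u)) (fun w => field_curve s (w, u)).
Proof. by apply: field_approx; rewrite le_max lexx. Qed.

Variables (s t : R).
Hypothesis s0 : 0 <= s.
Hypothesis st : s <= t.
Hypothesis t0 : 0 < t.

Notation C := (levy_var sg).

Let in_range (u : R) : 0 <= u <= t ->
  0 <= Num.max 0 (Num.min s u) <= t /\ 0 <= Num.max 0 u <= t.
Proof.
move=> /andP[u0 ut]; rewrite !le_max lexx/= !ge_max ut (ltW t0)/=.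
by split => //; rewrite ge_min st.
Qed.

Let field_curve_bounded K : 0 <= K ->
  (forall p : R * R, 0 <= p.1 <= t -> 0 <= p.2 <= t -> `|kappa p| <= K) ->
  forall u, 0 <= u <= t ->
  nu.-integrable setT (EFin \o (fun w => field_curve s (w, u))) /\
  \int[nu]_w `|field_curve s (w, u)| <= 1 / 2 + 8 * C / 1 * (K ^+ 2 * (t * t)).
Proof.
move=> K0 KP u ut; have [a_in b_in] := in_range ut.
have [i b] := levy_approx_L1 sg2 nu_levy (field_curve_approx s u) ltr01.
split => //; rewrite (le_trans b)// lerD2l ler_wpM2l//.
  by rewrite divr_ge0// mulr_ge0// levy_var_ge0.
by have [] := ker_L2 kappa_ge0 kappa_meas K0 KP a_in b_in.
Qed.

Let field_curve_increment K delta D : 0 <= K ->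
  (forall p : R * R, 0 <= p.1 <= t -> 0 <= p.2 <= t -> `|kappa p| <= K) -> 0 < delta ->
  forall u u' : R, 0 <= u <= u' -> u' <= t -> u' - u <= D ->
  \int[nu]_w `|field_curve s (w, u) - field_curve s (w, u')| <=
    delta / 2 + 8 * C / delta * (K ^+ 2 * (2 * t * D)).
Proof.
move=> K0 KP d0 u u' /andP[u0 uu] u't uD.
have [_ b] := levy_approx_L1 sg2 nu_levy
  (levy_approx_sub (field_curve_approx s u) (field_curve_approx s u')) d0.
rewrite (le_trans b)// lerD2l ler_wpM2l//.
  by rewrite divr_ge0 ?(ltW d0)// mulr_ge0// levy_var_ge0.
have u'0 := le_trans u0 uu.
have uin : 0 <= u <= t by rewrite u0 (le_trans uu).
have u'in : 0 <= u' <= t by rewrite u'0.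
have E (v : R) : 0 <= v -> Num.max 0 (Num.min s v) = Num.min s v /\ Num.max 0 v = v.
  by move=> v0; rewrite !max_r// le_min s0.
have [-> ->] := E u u0; have [-> ->] := E u' u'0.
have m0 : 0 <= Num.min s u by rewrite le_min s0.
have mm : Num.min s u <= Num.min s u' by rewrite le_min ge_min lexx/= ge_min uu orbT.
have mt : Num.min s u' <= t by rewrite ge_min st.
rewrite (le_trans (ker_increment kappa_meas K0 KP _ _ mt u't))//.
- by rewrite m0.
- by rewrite u0.
rewrite ler_wpM2l ?sqr_ge0//.
have mdiff : Num.min s u' - Num.min s u <= u' - u.
  by rewrite /Num.min; case: ltP => ?; case: ltP => ?; lra.
have -> : Num.min s u' * u' - Num.min s u * u =
   Num.min s u' * (u' - u) + (Num.min s u' - Num.min s u) * u by ring.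
have h1 : Num.min s u' * (u' - u) <= t * D.
  by apply: ler_pM => //; rewrite ?subr_ge0// (le_trans m0 mm).
have h2 : (Num.min s u' - Num.min s u) * u <= D * t.
  apply: ler_pM => //; rewrite ?subr_ge0//; first exact: le_trans mdiff uD.
  exact: le_trans uu u't.
lra.
Qed.

Let Jt : set mR := `]0, t]%classic.

Let leb_t : (leb Jt < +oo)%E.
Proof. by rewrite lebesgue_measure_itv/= lte_fin t0 -EFinB ltry. Qed.

Let mJt : measurable Jt. Proof. exact: measurable_itv. Qed.

Let range_of u : Jt u -> 0 <= u <= t.
Proof. by rewrite /Jt /= in_itv/= => /andP[/ltW -> ->]. Qed.

Lemma integrated_field_ae :
  {ae nu, forall w, leb.-integrable `]0, t] (EFin \o (fun u => field_curve s (w, u)))}.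
Proof.
have [K K0 KP] := kappa_bounded kappa_bnd t.
have [] := process_integral_L1 (field_curve_measurable s) mJt leb_t
  (fun u ut => field_curve_bounded K0 KP (range_of ut)).
by [].
Qed.

(** A stochastic Fubini theorem. Riemann sums of the field are versions of
    [<., r>] for the Riemann sums [r] of the kernels; the former converge to the
    time integral in L1 because the field is continuous in L1, the latter to
    [gker] in L2. *)
Lemma integrated_field_approx :
  levy_approx nu (gker kappa t s) (fun w => \int[leb]_(u in `]0, t]) field_curve s (w, u)).
Proof.
have [K K0 KP] := kappa_bounded kappa_bnd t.
have sst : 0 <= s <= t by rewrite s0.
have tt : 0 <= t <= t by rewrite ltW/=.
have [mI _ _ _] := process_integral_L1 (field_curve_measurable s) mJt leb_t
  (fun u ut => field_curve_bounded K0 KP (range_of ut)).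
have LG := gker_L2 kappa_ge0 kappa_meas K0 KP sst.
apply: levy_approx_closed => // e e0.
(* [delta] bounds the part of the L1 error that does not decrease with the
   mesh [D]; [eta] makes [D] small enough for the remaining errors *)
pose delta := e / t.
have d0 : 0 < delta by rewrite divr_gt0.
pose A := t * (8 * C / delta * (K ^+ 2 * (2 * t))).
have A0 : 0 <= A.
  have C0 : 0 <= C by exact: levy_var_ge0.
  by rewrite /A !mulr_ge0 ?invr_ge0 ?sqr_ge0 ?(ltW t0) ?(ltW d0).
pose B := K ^+ 2 * (t * t).
have B0 : 0 <= B by rewrite /B !mulr_ge0 ?sqr_ge0 ?(ltW t0).
pose eta := Num.min 1 (Num.min (e / (2 * (A + 1))) (e / (B + 1))).
have eta0 : 0 < eta.
  by rewrite !lt_min ltr01 !divr_gt0// ?mulr_gt0// ltr_wpDl.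
pose n := (Num.truncn (t / eta)).+1.
pose D := t / n%:R.
have n0 : (0 : R) < n%:R by rewrite ltr0n.
have D0 : 0 < D by rewrite divr_gt0.
have nD : n%:R * D = t by rewrite /D mulrC divfK ?gt_eqF.
have Deta : D <= eta.
  rewrite /D ler_pdivrMr// mulrC -ler_pdivrMr// ltW//; exact: truncnS_gt.
have /andP[D1 /andP[D2 D3]] : [&& D <= 1, D <= e / (2 * (A + 1)) & D <= e / (B + 1)].
  by move: Deta; rewrite /eta !le_min.
pose r p := \sum_(i < n) D *
  ker kappa (Num.max 0 (Num.min s (i.+1%:R * D))) (Num.max 0 (i.+1%:R * D)) p.
pose Sn w := \sum_(i < n) D * field_curve s (w, i.+1%:R * D).
have Lr : levy_approx nu r Sn.
  apply: (@levy_approx_sum R nu 'I_n (index_enum 'I_n) (fun=> D)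
    (fun i => ker kappa (Num.max 0 (Num.min s (i.+1%:R * D))) (Num.max 0 (i.+1%:R * D)))
    (fun i w => field_curve s (w, i.+1%:R * D))) => i.
  exact: field_curve_approx.
exists r, Sn.
pose eps := delta / 2 + 8 * C / delta * (K ^+ 2 * (2 * t * D)).
have Hint u : 0 <= u <= n%:R * D -> nu.-integrable setT (EFin \o (fun w => field_curve s (w, u))) /\
    \int[nu]_w `|field_curve s (w, u)| <= 1 / 2 + 8 * C / 1 * (K ^+ 2 * (t * t)).
  by rewrite nD; exact: field_curve_bounded.
have Hcell (i : nat) u : (i < n)%N -> i%:R * D < u <= i.+1%:R * D ->
    \int[nu]_w `|field_curve s (w, u) - field_curve s (w, i.+1%:R * D)| <= eps.
  move=> ilt /andP[iu ui].
  have u0 : 0 <= u by rewrite (le_trans _ (ltW iu))// mulr_ge0// ltW.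
  apply: (field_curve_increment K0 KP d0); rewrite ?u0//.
    by rewrite -nD ler_pM2r// ler_nat.
  by move: iu; rewrite -natr1 mulrDl mul1r; lra.
have [iR bR] := riemann_process (field_curve_measurable s) D0 Hint Hcell (leqnn n).
rewrite nD in iR bR.
have mSn : measurable_fun setT Sn by case: Lr.
split => //.
- have [ik Ik] := kbox_integral s0 (ltW t0).
  have iG : leb2.-integrable setT (EFin \o (fun p => (D * K) ^+ 2 * kbox s t p)).
    exact: integrableZlR.
  apply: (@le_trans _ _ (\int[leb2]_p ((D * K) ^+ 2 * kbox s t p))).
    have le2 p : (r p - gker kappa t s p) ^+ 2 <= (D * K) ^+ 2 * kbox s t p.
      have -> : (r p - gker kappa t s p) ^+ 2 = `|r p - gker kappa t s p| ^+ 2.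
        by rewrite real_normK// num_real.
      rewrite -kbox_sqr -exprMn lerXn2r ?nnegrE ?mulr_ge0 ?kbox_ge0 ?(ltW D0)//;
      first exact: ltW.
      exact: (riemann_ker KP p sst D0 nD).
    apply: le_Rintegral => //.
    apply: (integrable_le _ _ iG) => //.
      apply: measurable_funX; apply: measurable_funB; first by case: Lr => -[].
      by case: LG.
    by move=> p _; rewrite ger0_norm ?sqr_ge0.
  rewrite RintegralZl// Ik exprMn -mulrA.
  have h1 : K ^+ 2 * (s * t) <= B.
    by rewrite /B ler_wpM2l ?sqr_ge0// ler_wpM2r// ltW.
  apply: (@le_trans _ _ (D * B)).
    apply: ler_pM => //; rewrite ?sqr_ge0 ?mulr_ge0 ?sqr_ge0 ?(ltW t0)//.
    by rewrite expr2 ler_piMl// ltW.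
  have B10 : 0 < B + 1 by rewrite ltr_wpDl.
  move: D3; rewrite ler_pdivlMr// mulrDr; have := ltW D0; lra.
- have := integrableZlR (-1) measurableT iR.
  by apply: eq_integrable => // w _ /=; rewrite mulN1r opprB.
- have -> : \int[nu]_w `|Sn w - \int[leb]_(u in `]0, t]) field_curve s (w, u)| =
    \int[nu]_w `|\int[leb]_(u in `]0, t]) field_curve s (w, u) - Sn w|.
    by apply: eq_Rintegral => w _; rewrite distrC.
  rewrite (le_trans bR)//.
  have -> : t * eps = e / 2 + A * D.
    by rewrite /eps /A /delta; field; rewrite !gt_eqF.
  have A10 : 0 < 2 * (A + 1) by rewrite mulr_gt0// ltr_wpDl.
  move: D2; rewrite ler_pdivlMr//; have := ltW D0; lra.
Qed.
End integrated_field.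

(** * The drift of the forward rates *)
Section within_curves.
Variable R : realType.

Lemma within_continuous_curve (f : R * R -> R) (S : set (R * R)) (A : set R) (g : R -> R * R) :
  {within S, continuous f} -> continuous g -> (forall u, A u -> S (g u)) ->
  {within A, continuous (fun u => f (g u))}.
Proof.
move=> /subspace_continuousP cf cg AS; apply/subspace_continuousP => x Ax.
move=> U nU; have /(cg x) := cf _ (AS _ Ax) U nU.
by apply: (@filterS _ (nbhs x)) => y /= h Ay; exact: h (AS _ Ay).
Qed.

Lemma continuous_pair1 (a : R) : continuous (fun u : R => (a, u)).
Proof.
move=> x W [[A B] /= [xA xB] AB]; apply: (@filterS _ (nbhs x) _ B) xB => u Bu.
by apply: AB; split=> //=; exact: nbhs_singleton xA.
Qed.

Lemma continuous_diag : continuous (fun u : R => (u, u)).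
Proof.
move=> x W [[A B] /= [xA xB] AB].
by apply: (@filterS2 _ (nbhs x) _ A B) xA xB => u Au Bu; exact: AB.
Qed.

Lemma Rintegral_itv_sum (a b : R) (f g h : R -> R) :
  (@lebesgue_measure R).-integrable `]a, b] (EFin \o f) ->
  (@lebesgue_measure R).-integrable `]a, b] (EFin \o g) ->
  (forall u, a < u -> u <= b -> h u = f u + g u) ->
  \int[@lebesgue_measure R]_(u in `[a, b]) h u =
  (\int[@lebesgue_measure R]_(u in `]a, b]) f u) +
  \int[@lebesgue_measure R]_(u in `]a, b]) g u.
Proof.
move=> fi gi hE.
have mI := measurable_itv `]a, b] : measurable (`]a, b]%classic : set (measurableTypeR R)).
have eqh : {in `]a, b]%classic : set (measurableTypeR R), (fun u => f u + g u) =1 h}.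
  by move=> u; rewrite inE /= in_itv/= => /andP[au ub]; rewrite hE.
rewrite -RintegralD// -Rintegral_itv_obnd_cbnd; last first.
  apply: (eq_integrable mI (EFin \o (fun u => f u + g u))); last exact: integrableDR.
  by move=> u /eqh /= ->.
by apply: eq_Rintegral => u /eqh.
Qed.

Lemma ler_cancel (a b c d x y : R) :
  a + b - (c + d) <= a + x + b - (c + y + d) -> y <= x.
Proof. lra. Qed.

Lemma ler_drift (a a' b b' d d' e e' : R) :
  a = expR d * b -> a' = expR d' * b' -> b = expR (- e) -> b' = expR (- e') ->
  a <= a' -> d - e <= d' - e'.
Proof. by move=> -> -> -> ->; rewrite -!expRD ler_expR. Qed.
End within_curves.

Section martingale_drift.
Variable R : realType.
Notation mR := (measurableTypeR R).
Notation leb := (@lebesgue_measure R).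
Notation leb2 := (@lebesgue2 R).
Variable sg : {measure set mR -> \bar R}.
Hypothesis sg2 : (\int[sg]_(tau in `]0%R, +oo[) (tau ^+ 2)%:E < +oo)%E.
Hypothesis sg1 : (\int[sg]_(tau in `]0%R, +oo[) tau%:E < +oo)%E.
Variable nu : probability (dual_space R) R.
Hypothesis nu_levy : is_levy_noise sg nu.
Variables (kappa : R * R -> R) (X : R -> R -> dual_space R -> R) (mu : R -> R -> R).
Hypothesis kappa_ge0 : forall p : R * R, 0 <= p.1 -> 0 <= p.2 -> 0 <= kappa p.
Hypothesis kappa_meas : measurable_fun [set p : R * R | 0 <= p.1 /\ 0 <= p.2] kappa.
Hypothesis kappa_bnd :
  [locally [bounded kappa p | p in [set p : R * R | 0 <= p.1 /\ 0 <= p.2]]].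
Hypothesis X_field : is_levy_field nu kappa X.
Hypothesis mu_cont : {within [set p : R * R | 0 <= p.1 <= p.2],
  continuous (fun p => mu p.1 p.2)}.
Notation F := (forward_rate mu X).
Hypothesis mart : forall t : R, 0 <= t ->
    is_martingale nu `[0, t] (rate_filtration F)
      (fun s => discounted_bond_price F s t).

Lemma mu_row_continuous s a b : 0 <= s -> s <= a -> {within `[a, b], continuous (mu s)}.
Proof.
move=> s0 sa; refine (@within_continuous_curve _ _ _ `[a, b] _ mu_cont (@continuous_pair1 R s) _).
by move=> u; rewrite /= in_itv/= => /andP[au _]; rewrite s0 (le_trans sa).
Qed.

Lemma mu_diag_continuous b : {within `[0, b], continuous (fun u => mu u u)}.
Proof.
refine (@within_continuous_curve _ _ _ `[0, b] _ mu_cont (@continuous_diag R) _).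
by move=> u; rewrite /= in_itv/= => /andP[su _]; rewrite su lexx.
Qed.

Lemma mu_row_integrable s a b : 0 <= s -> s <= a ->
  leb.-integrable `]a, b] (EFin \o mu s).
Proof.
move=> s0 sa; apply: (@integrableS _ mR R leb `[a, b]).
- exact: measurable_itv.
- exact: measurable_itv.
- by move=> u; rewrite /= !in_itv/= => /andP[/ltW -> ->].
- apply: continuous_compact_integrable; first exact: segment_compact.
  exact: mu_row_continuous.
Qed.

Lemma mu_diag_integrable b : leb.-integrable `]0, b] (EFin \o (fun u => mu u u)).
Proof.
apply: (@integrableS _ mR R leb `[0, b]).
- exact: measurable_itv.
- exact: measurable_itv.
- by move=> u; rewrite /= !in_itv/= => /andP[au ->]; rewrite ltW.
- apply: continuous_compact_integrable; first exact: segment_compact.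
  exact: mu_diag_continuous.
Qed.

(** The deterministic part of [int_s^t F_{s,u} du + int_0^s R_u du]. *)
Definition drift s t : R :=
  (\int[leb]_(u in `]s, t]) mu s u) + \int[leb]_(u in `]0, s]) mu u u.

(** The random part of [int_s^t F_{s,u} du + int_0^s R_u du]: the index of
    the field is [(s, u)] for [u >= s] and [(u, u)] for [u <= s]. *)
Definition cumulated_field s t w : R :=
  \int[leb]_(u in `]0, t]) field_curve X s (w, u).

Lemma discounted_price_exp s t : 0 <= s -> s <= t -> 0 < t ->
  {ae nu, forall w, expR (- cumulated_field s t w) =
                    expR (drift s t) * discounted_bond_price F s t w}.
Proof.
move=> s0 st t0.
have := integrated_field_ae sg2 nu_levy kappa_ge0 kappa_meas kappa_bnd X_field st t0.
apply: filterS => w iw.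
have iS (a b : R) : 0 <= a -> b <= t ->
    leb.-integrable `]a, b] (EFin \o (fun u => field_curve X s (w, u))).
  move=> a0 bt; apply: (@integrableS _ mR R leb `]0, t]) iw.
  - exact: measurable_itv.
  - exact: measurable_itv.
  - by move=> u; rewrite /= !in_itv/= => /andP[au ub]; rewrite (le_lt_trans a0 au) (le_trans ub bt).
have E1 : \int[leb]_(u in `[s, t]) F s u w =
    (\int[leb]_(u in `]s, t]) mu s u) + \int[leb]_(u in `]s, t]) field_curve X s (w, u).
  apply: Rintegral_itv_sum (mu_row_integrable t s0 (lexx s)) (iS s t s0 (lexx t)) _.
  move=> u su ut; rewrite /forward_rate /field_curve /= min_l ?(ltW su)// !max_r//.
  by rewrite (le_trans s0)// ltW.
have E2 : \int[leb]_(u in `[0, s]) spot_rate F u w =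
    (\int[leb]_(u in `]0, s]) mu u u) + \int[leb]_(u in `]0, s]) field_curve X s (w, u).
  apply: Rintegral_itv_sum (mu_diag_integrable s) (iS 0 s (lexx 0) st) _.
  by move=> u u0 us; rewrite /spot_rate /forward_rate /field_curve /= min_r// !max_r// ltW.
have E3 : cumulated_field s t w = (\int[leb]_(u in `]0, s]) field_curve X s (w, u)) +
    \int[leb]_(u in `]s, t]) field_curve X s (w, u).
  have := @Rintegral_itvB R (fun u => field_curve X s (w, u)) (BRight 0) (BRight t) s iw.
  rewrite !bnd_simp => /(_ s0 st) <-; rewrite /cumulated_field; ring.
rewrite /discounted_bond_price /bond_price E1 E2 -!expRD; congr expR.
by rewrite /drift E3; ring.
Qed.

(** A martingale has constant mean. *)
Lemma cumulated_field_laplace s t : 0 <= s -> s <= t -> 0 < t ->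
  \int[nu]_w expR (- cumulated_field s t w) =
  expR (drift s t) * \int[nu]_w discounted_bond_price F 0 t w.
Proof.
move=> s0 st t0.
have [[_ _] mI _] := integrated_field_approx sg2 nu_levy kappa_ge0 kappa_meas kappa_bnd X_field s0 st t0.
have st_in : `[0, t]%classic s by rewrite /= in_itv/= s0.
have zero_in : `[0, t]%classic 0 by rewrite /= in_itv/= lexx ltW.
have [iZ _ _] := mart (ltW t0) st_in.
have mZ := measurable_int nu iZ.
have [_ _ ce] := mart (ltW t0) zero_in.
have [_ _ cE] := ce s st_in s0.
have -> : \int[nu]_w discounted_bond_price F 0 t w = \int[nu]_w discounted_bond_price F s t w.
  by apply: cE; exact: (@measurableT _ (g_sigma_algebraType _)).
rewrite -RintegralZl//; apply: ae_eq_Rintegral.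
- exact/mfun_exp/mfun_opp.
- by apply: mfun_scale; exact/measurable_EFinP.
- exact: discounted_price_exp.
Qed.

(** At [s = 0] the kernel is supported on a segment, hence null almost
    everywhere. *)
Lemma cumulated_field0_laplace t : 0 < t -> \int[nu]_w expR (- cumulated_field 0 t w) = 1.
Proof.
move=> t0.
have LA := integrated_field_approx sg2 nu_levy kappa_ge0 kappa_meas kappa_bnd X_field (lexx 0) (ltW t0) t0.
have [[mG G2] mI _] := LA.
have [K K0 KP] := kappa_bounded kappa_bnd t.
have G0 : \int[leb2]_p (gker kappa t 0 p ^+ 2) <= 0.
  have [ik Ik] := kbox_integral (lexx 0) (ltW t0).
  have I0 : \int[leb2]_p ((t * K) ^+ 2 * kbox 0 t p) = 0 by rewrite RintegralZl// Ik mul0r mulr0.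
  rewrite -[leRHS]I0.
  apply: le_Rintegral; [exact: measurableT|exact: G2|exact: (integrableZlR _ measurableT ik)|].
  move=> p _; rewrite -kbox_sqr -exprMn lerXn2r ?nnegrE ?(gker_ge0 kappa_ge0)//; try exact: ltW.
    by rewrite !mulr_ge0 ?kbox_ge0 ?(ltW t0).
  rewrite (le_trans (gker_le kappa_ge0 p (ltW t0)))// -mulrA ler_wpM2l ?(ltW t0)//.
  by apply: (ker_le KP) => //; exact: ltW.
have iI : nu.-integrable setT (EFin \o cumulated_field 0 t).
  by have [] := levy_approx_L1 sg2 nu_levy LA ltr01.
have I0 : \int[nu]_w `|cumulated_field 0 t w| = 0.
  apply/eqP; rewrite eq_le Rintegral_ge0// andbT.
  apply/ler_addgt0Pr => e e0; rewrite add0r.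
  have [_ b] := levy_approx_L1 sg2 nu_levy LA e0.
  rewrite (le_trans b)//.
  have : 8 * levy_var sg / e * \int[leb2]_p (gker kappa t 0 p ^+ 2) <= 0.
    by rewrite mulr_ge0_le0// divr_ge0 ?(ltW e0)// mulr_ge0// levy_var_ge0.
  by move: e0; lra.
have ae0 := Rintegral0_ae (integrable_norm iI) (fun w => normr_ge0 _) I0.
have -> : 1 = \int[nu]_w (1 : R).
  by rewrite Rintegral_cst// mul1r (congr1 fine (probability_setT nu)).
apply: ae_eq_Rintegral => //; first exact/mfun_exp/mfun_opp.
by apply: filterS ae0 => w /= /eqP; rewrite normr_eq0 => /eqP ->; rewrite oppr0 expR0.
Qed.

(** The martingale property gives the mean of [expR (- cumulated_field s t)] as
    [expR (drift s t - drift 0 t)]. The kernel of the cumulated field increases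
    with [t], so this mean does too; in the increment from [t] to [t'] the spot
    rate terms cancel. *)
Lemma drift_increment s t t' : 0 <= s -> s <= t -> t < t' -> 0 < t ->
  \int[leb]_(u in `]t, t']) mu 0 u <= \int[leb]_(u in `]t, t']) mu s u.
Proof.
move=> s0 st tt t0; have t'0 := lt_trans t0 tt; have st' := le_trans st (ltW tt).
have L1 := integrated_field_approx sg2 nu_levy kappa_ge0 kappa_meas kappa_bnd X_field s0 st t0.
have L2 := integrated_field_approx sg2 nu_levy kappa_ge0 kappa_meas kappa_bnd X_field s0 st' t'0.
have [K K0 KP] := kappa_bounded kappa_bnd t.
have [K' K'0 KP'] := kappa_bounded kappa_bnd t'.
have s_t : 0 <= s <= t by rewrite s0.
have s_t' : 0 <= s <= t' by rewrite s0.
have le_laplace : \int[nu]_w expR (- cumulated_field s t w) <=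
    \int[nu]_w expR (- cumulated_field s t' w).
  exact: (levy_laplace_le sg2 sg1 nu_levy L1 L2 (fun p => gker_ge0 kappa_ge0 p st)
    (fun p => gker_mono p kappa_ge0 st (ltW tt))
    (gker_integrable kappa_ge0 kappa_meas KP s_t) (gker_integrable kappa_ge0 kappa_meas KP' s_t')).
have E a (a0 : 0 < a) : \int[nu]_w discounted_bond_price F 0 a w = expR (- drift 0 a).
  have := cumulated_field_laplace (lexx 0) (ltW a0) a0.
  rewrite cumulated_field0_laplace// => e1.
  by rewrite expRN -[RHS]mul1r e1 mulrC mulrA mulVf ?mul1r// gt_eqF// expR_gt0.
have := ler_drift (cumulated_field_laplace s0 st t0)
  (cumulated_field_laplace s0 st' t'0) (E t t0) (E t' t'0) le_laplace.
have split_row r : 0 <= r -> r <= t ->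
    \int[leb]_(u in `]r, t']) mu r u =
    (\int[leb]_(u in `]r, t]) mu r u) + \int[leb]_(u in `]t, t']) mu r u.
  move=> r0 rt; have := @Rintegral_itvB R (mu r) (BRight r) (BRight t') t (mu_row_integrable t' r0 (lexx r)).
  by rewrite !bnd_simp => /(_ rt (ltW tt)) <-; ring.
rewrite /drift !split_row//; try exact: ltW.
exact: ler_cancel.
Qed.

(** Continuity localises the comparison of integrals over small intervals to the
    right of [t]. *)
Lemma mu_ge_initial s t : 0 <= s -> s <= t -> mu 0 t <= mu s t.
Proof.
move=> s0 st.
have [->|sn0] := eqVneq s 0; first exact: lexx.
have sp : 0 < s by rewrite lt_neqAle eq_sym sn0.
have t0 := lt_le_trans sp st.
rewrite leNgt; apply/negP => lt_mu.
pose h u := mu s u - mu 0 u.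
have hc : h u @[u --> within `[t, t + 1] (nbhs t)] --> h t.
  have c (r : R) : 0 <= r -> r <= t -> mu r u @[u --> within `[t, t + 1] (nbhs t)] --> mu r t.
    move=> r0 rt.
    have := mu_row_continuous (b := t + 1) r0 rt.
    by move=> /subspace_continuousP; apply; rewrite /= in_itv/= lexx lerDl ler01.
  by apply: cvgB; apply: c => //; exact: ltW.
have ht : h t < 0 by rewrite subr_lt0.
have hd0 : 0 < - (h t / 2) by rewrite oppr_gt0 pmulr_llt0.
have /cvgrPdist_lt/(_ _ hd0) := hc.
rewrite near_withinE => -[e /= e0 He].
pose t' := t + Num.min 1 (e / 2).
have tt : t < t' by rewrite ltrDl lt_min ltr01 divr_gt0.
have hneg u : t < u -> u <= t' -> mu s u - mu 0 u <= h t / 2.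
  move=> tu ut.
  have ue : u - t <= Num.min 1 (e / 2) by move: ut; rewrite /t' -lerBlDl.
  have [u1 u2] : u - t <= 1 /\ u - t <= e / 2 by move: ue; rewrite le_min => /andP[].
  have := He u; rewrite /ball_ /= distrC ger0_norm ?subr_ge0 ?(ltW tu)// in_itv/= (ltW tu)/=.
  move=> /(_ _ _); rewrite -/(h u) => H.
  have : `|h t - h u| < - (h t / 2).
    apply: H; first by move: e0 u2; lra.
    by move: u1; lra.
  by rewrite ltr_norml => /andP[+ _]; rewrite /h; lra.
have := drift_increment s0 st tt t0; apply/negP; rewrite -ltNge.
have is1 := @mu_row_integrable s t t' s0 st.
have is0 := @mu_row_integrable 0 t t' (lexx 0) (ltW t0).
have mJ := measurable_itv `]t, t'] : measurable (`]t, t']%classic : set mR).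
rewrite -subr_lt0 -(RintegralB mJ is1 is0).
have lJ : fine (leb (`]t, t']%classic : set mR)) = t' - t.
  by rewrite lebesgue_measure_itv/= lte_fin tt -EFinB.
apply: (@le_lt_trans _ _ (\int[leb]_(u in `]t, t']) (h t / 2))).
  apply: le_Rintegral.
  - exact: mJ.
  - exact: integrableBR.
  - apply/integrableP; split; first by apply/measurable_EFinP; exact: measurable_cst.
    rewrite integral_cst//=.
    by rewrite lebesgue_measure_itv/= lte_fin tt -EFinB -EFinM ltry.
  - by move=> u; rewrite /= in_itv/= => /andP[tu ut]; exact: hneg.
by rewrite Rintegral_cst// lJ pmulr_llt0 ?subr_gt0// pmulr_llt0.
Qed.

Lemma forward_rate_ge0 s t : 0 <= s -> s <= t ->
  (\int[leb2]_(p in `[0%R, t] `*` `[0%R, t]) (kappa p)%:E *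
     \int[sg]_(tau in `]0%R, +oo[) tau%:E <= (mu 0%R t)%:E)%E ->
  {ae nu, forall w, 0 <= F s t w}.
Proof.
move=> s0 st mu0; have t0 := le_trans s0 st.
have [K K0 KP] := kappa_bounded kappa_bnd t.
have s_in : 0 <= s <= t by rewrite s0.
have t_in : 0 <= t <= t by rewrite t0 lexx.
have ik := ker_integrable kappa_ge0 kappa_meas KP s_in t_in.
have ikt := ker_integrable kappa_ge0 kappa_meas KP t_in t_in.
have LX := field_approx kappa_ge0 kappa_meas kappa_bnd X_field s0 t0.
have := levy_approx_ge0 sg2 sg1 nu_levy LX (fun p => ker_ge0 kappa_ge0 s t p) ik.
have c_le : compensator sg (ker kappa s t) <= mu 0 t.
  rewrite -lee_fin (le_trans _ mu0)//.
  have -> : (\int[leb2]_(p in `[0%R, t] `*` `[0%R, t]) (kappa p)%:E =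
      (\int[leb2]_p ker kappa t t p)%:E)%E.
    rewrite /Rintegral fineK; last exact: integrable_fin_num.
    rewrite [LHS]integral_mkcond; apply: eq_integral => p _.
    rewrite patchE /ker kboxE; case: ifPn => [|].
      by rewrite inE => -[]; rewrite /= !in_itv/= => -> ->; rewrite mul1r.
    rewrite notin_setE /= !in_itv/= => pn.
    by case: (boolP (_ && _)) => [/andP[? ?]|_]; [exfalso; apply: pn|rewrite mul0r].
  have -> : (\int[sg]_(tau in `]0%R, +oo[) tau%:E = (levy_mean sg)%:E)%E.
    by rewrite /levy_mean /Rintegral fineK//; apply: integrable_fin_num; [exact: measurable_itv|exact: integrable_tau1].
  rewrite -EFinM lee_fin mulrC /compensator ler_wpM2l ?levy_mean_ge0//.
  by apply: le_Rintegral => // p _; apply: ker_mono.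
apply: filterS => w; have := mu_ge_initial s0 st; rewrite /forward_rate; lra.
Qed.
End martingale_drift.

Unset Implicit Arguments.
Set Strict Implicit.
Set Printing Implicit Defensive.

Theorem corollary2p1 (R : realType)
  (sigma : {measure set (measurableTypeR R) -> \bar R})
  (nu : probability (dual_space R) R)
  (kappa : R * R -> R) (X : R -> R -> dual_space R -> R)
  (mu : R -> R -> R)
  (sigma_tau2 : (\int[sigma]_(tau in `]0%R, +oo[) (tau ^+ 2)%:E < +oo)%E)
  (nu_levy : is_levy_noise sigma nu)
  (kappa_ge0 : forall p : R * R, 0 <= p.1 -> 0 <= p.2 -> 0 <= kappa p)
  (kappa_meas : measurable_fun [set p : R * R | 0 <= p.1 /\ 0 <= p.2] kappa)
  (kappa_bnd :
    [locally [bounded kappa p | p in [set p : R * R | 0 <= p.1 /\ 0 <= p.2]]])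
  (X_field : is_levy_field nu kappa X)
  (mu_cont : {within [set p : R * R | 0 <= p.1 <= p.2],
    continuous (fun p => mu p.1 p.2)})
  (sigma_tau : (\int[sigma]_(tau in `]0%R, +oo[) tau%:E < +oo)%E) :
  let F := forward_rate mu X in
  (forall t : R, 0 <= t ->
    is_martingale nu `[0, t] (rate_filtration F)
      (fun s => discounted_bond_price F s t)) ->
  (forall t : R, 0 <= t ->
    (\int[@lebesgue2 R]_(p in `[0%R, t] `*` `[0%R, t]) (kappa p)%:E *
     \int[sigma]_(tau in `]0%R, +oo[) tau%:E <= (mu 0%R t)%:E)%E) ->
  (forall s t : R, 0 <= s <= t -> {ae nu, forall w, 0 <= F s t w}) /\
  (forall t : R, 0 <= t -> {ae nu, forall w, 0 <= spot_rate F t w}).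
Proof.
move=> F mart init; split=> [s t /andP[s0 st]|t t0].
  exact: (forward_rate_ge0 sigma_tau2 sigma_tau nu_levy kappa_ge0 kappa_meas
    kappa_bnd X_field mu_cont mart s0 st (init t (le_trans s0 st))).
exact: (forward_rate_ge0 sigma_tau2 sigma_tau nu_levy kappa_ge0 kappa_meas
  kappa_bnd X_field mu_cont mart t0 (lexx t) (init t t0)).
Qed.
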